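(* Let $(M,d)$ be a locally compact separable metric space, $\mu$ a $\sigma$-finite Borel measure on $M$, $X$ a Hunt process on $(M,\mathscr{B}(M))$ with life time $\zeta$, and let $N\in\mathscr{B}(M)$ be such that for any $x\in M\setminus N$, $$\mathbb{P}_x[X_t\in M_\Delta\setminus N\text{ for any }t\in[0,\infty)]=1\quad\text{and}\quad\mathbb{P}_x\bigl[[0,\zeta)\ni t\mapsto X_t\in M\text{ is continuous}\bigr]=1.$$ Let $\Psi:[0,\infty)\to[0,\infty)$ be a homeomorphism and $c_\Psi,\beta_1,\beta_2\in(0,\infty)$ with $1<\beta_1\le\beta_2$ be such that $c_\Psi^{-1}(\rho'/\rho)^{\beta_1}\le\Psi(\rho')/\Psi(\rho)\le c_\Psi(\rho'/\rho)^{\beta_2}$ for any $0<\rho\le\rho'<\infty$, and for $(\rho,t)\in[0,\infty)\times(0,\infty)$ set $\Phi(\rho,t):=\sup_{r\in(0,\infty)}\{\rho/r-t/\Psi(r)\}$. Let $R\in(0,\infty)$, let $U$ be a non-empty open subset of $M$ with $\operatorname{diam}U\le R$ and let $F=F_t(x,y):(0,\Psi(R)]\times U\times U\to(0,\infty)$ be Borel measurable. Let $\alpha_F,c_F,c,\gamma\in(0,\infty)$ and assume the following three conditions. (i) For any $(t,x,y),(s,z,w)\in(0,\Psi(R)]\times U\times U$ with $s\le t$, $$\frac{F_s(z,w)}{F_t(x,y)}\le c_F\Bigl(\frac{t\vee\Psi(d(x,z))\vee\Psi(d(y,w))}{s}\Bigr)^{\alpha_F}.$$ (ii) For any $(t,x)\in(0,\Psi(R))\times(U\setminus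 N)$ and any $A\in\mathscr{B}(U)$, $\mathcal{P}^U_t(x,A)\le\int_AF_t(x,y)\,d\mu(y)$. (iii) For any $(x,r)\in(U\setminus N)\times(0,R)$ with $B(x,r)\subset U$ and any $t\in(0,\infty)$, $\mathbb{P}_x[\tau_{B(x,r)}\le t]\le c\exp(-\Phi(\gamma r,t))$. Let $\varepsilon\in(0,1)$ and set $U^\circ_{\varepsilon R}:=\{x\in M\mid\inf_{y\in M\setminus U}d(x,y)>\varepsilon R\}$ (an open subset of $U$). Then there exists a Borel measurable function $p=p_t(x,y):(0,\infty)\times(M\setminus N)\times U^\circ_{\varepsilon R}\to[0,\infty)$ such that for any $(t,x)\in(0,\infty)\times(M\setminus N)$, $$\mathcal{P}_t(x,A)=\int_Ap_t(x,y)\,d\mu(y)\qquad\text{for any }A\in\mathscr{B}(U^\circ_{\varepsilon R}),$$ and for any $y\in U^\circ_{\varepsilon R}$, $$p_t(x,y)\le\begin{cases}c_\varepsilon F_t(x,y)\exp\bigl(-\Phi(\gamma_\varepsilon d(x,y),t)\bigr)&\text{if }t<\Psi(R)\text{ and }x\in U,\\ c_\varepsilon\bigl(\inf_{U\times U}F_{(2t)\wedge\Psi(R)}\bigr)\exp(-\Phi(\gamma_\varepsilon R,t))&\text{if }t<\Psi(R)\text{ and }x\notin U,\\ c_\varepsilon\bigl(\inf_{U\times U}F_{\Psi(R)}\bigr)&\text{if }t\ge\Psi(R),\end{cases}$$ where $\gamma_\varepsilon:=\frac15\varepsilon\gamma$ and $c_\varepsilon\in(0,\infty)$ is a constant explicit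 in (in particular, depending only on) $c_\Psi,\beta_1,\beta_2,c_F,\alpha_F,c,\gamma,\varepsilon$.
   Context: Conventions: $a\vee b=\max\{a,b\}$, $a\wedge b=\min\{a,b\}$, $\inf\emptyset:=\infty$, $\sup\emptyset:=0$; $B(x,r):=\{y\in M\mid d(x,y)<r\}$; $\operatorname{diam}A:=\sup_{x,y\in A}d(x,y)$; $\mathscr{B}(E)$ is the Borel $\sigma$-field of $E$. $M_\Delta=M\cup\{\Delta\}$ is the one-point compactification of $M$. A Hunt process $X=(\Omega,\mathscr{M},\{X_t\}_{t\in[0,\infty]},\{\mathbb{P}_x\}_{x\in M_\Delta})$ on $(M,\mathscr{B}(M))$ is a normal Markov process on $(M,\mathscr{B}(M))$ ($\mathbb{P}_x[X_0=x]=1$, $x\mapsto\mathbb{P}_x[X_t\in A]$ Borel for $A\in\mathscr{B}(M)$) with cemetery $\Delta$ ($X_t(\omega)=\Delta$ for all $t\in[\zeta(\omega),\infty]$, where $\zeta(\omega):=\inf\{t\in[0,\infty)\mid X_t(\omega)=\Delta\}$ is the life time), with shift operators $\theta_t:\Omega\to\Omega$, $X_s\circ\theta_t=X_{s+t}$, whose paths $[0,\infty)\ni t\mapsto X_t(\omega)\in M_\Delta$ are all right-continuous with left limits in $M_\Delta$ on $(0,\infty)$, whose minimum completed admissible filtration is right-continuous, and which is strong Markov and quasi-left-continuous with respect to that filtration. For $B\subset M$, $\tau_B:=\inf\{t\in[0,\infty)\mid X_t\in M_\Delta\setminus B\}$. For $t\in[0,\infty)$, $x\in M$, $A\in\mathscr{B}(M)$: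 $\mathcal{P}_t(x,A):=\mathbb{P}_x[X_t\in A]$ and $\mathcal{P}^U_t(x,A):=\mathbb{P}_x[X_t\in A,\,t<\tau_U]$. *)

(* Defs.v *)
From HB Require Import structures.
From mathcomp Require Import all_boot all_order all_algebra.
From mathcomp Require Import all_classical all_reals all_analysis.
From mathcomp Require Import measurable_realfun.
Set Implicit Arguments.
Unset Strict Implicit.
Unset Printing Implicit Defensive.
Import Order.TTheory GRing.Theory Num.Theory.
Import numFieldNormedType.Exports.
Local Open Scope classical_set_scope.
Local Open Scope ring_scope.

(* Measurable types are pointed in the library, hence so are the metric spaces
   carrying a Borel sigma-field. *)
#[short(type="pmetricType")]
HB.structure Definition PointedMetric (K : numDomainType) :=
  {T of PseudoPointedMetric K T & Metric K T}.

Notation borel T := (g_sigma_algebraType (@open T)).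

Notation "M ^Delta" := (one_point_compactification M)
  (at level 2, format "M ^Delta") : type_scope.

Notation completion P := (@completed_measure_extension _ _ _ P).

Definition separable_space (T : topologicalType) :=
  exists2 S : set T, countable S & dense S.

Section sets.
Context {R : realType} {M : metricType R}.
Local Open Scope ereal_scope.

(* The maximum with 0 implements the convention [sup set0 = 0]. *)
Definition diam (A : set M) : \bar R :=
  maxe 0 (ereal_sup [set (mdist x y)%:E | x in A & y in A]).

(* [ereal_inf set0 = +oo], so the result is [setT] when [U] is [setT]. *)
Definition inner_set (U : set M) (r : R) : set M :=
  [set x | r%:E < ereal_inf [set (mdist x y)%:E | y in ~` U]].

End sets.

Definition homeomorphism_on {T1 T2 : topologicalType}
    (A : set T1) (B : set T2) (f : T1 -> T2) :=
  exists g : T2 -> T1,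
    [/\ set_fun A B f, set_fun B A g,
        {in A, cancel f g} & {in B, cancel g f}] /\
    {within A, continuous f} /\ {within B, continuous g}.

(* [sup] is the supremum in [R], with value 0 on sets unbounded above. Here the
   set is bounded for [0 < t] when [Psi rho' / Psi rho] is at least a multiple
   of [(rho' / rho) `^ beta] for [rho <= rho'] and some [beta > 1]. *)
Definition Phi {R : realType} (Psi : R -> R) (rho t : R) : R :=
  sup [set rho / r - t / Psi r | r in [set r | 0 < r]].

Section filtration.
Context {R : realType} {E : ptopologicalType} {d : measure_display}
  {Omega : measurableType d}.
Variables (X : \bar R -> Omega -> E) (P : E -> probability Omega R).
Local Open Scope ereal_scope.

Definition natural_filtration (t : \bar R) : set (set Omega) :=
  <<s [set A | exists s, exists2 B : set (borel E),
         0 <= s <= t /\ measurable B & A = X s @^-1` B] >>.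

(* [\int[nu]_x P x A] is the probability of [A] under the initial law [nu]. *)
Definition null_event (nu : probability (borel E) R) (A : set Omega) :=
  exists B, [/\ natural_filtration +oo B, \int[nu]_x P x B = 0 & A `<=` B].

Definition completed_filtration (t : \bar R) : set (set Omega) :=
  [set A | forall nu, exists2 B, natural_filtration t B &
                                 null_event nu (A `+` B)].

Definition stopping_time (sigma : Omega -> \bar R) :=
  (forall w, 0 <= sigma w) /\
  (forall t : R, (0 <= t)%R ->
     completed_filtration t%:E [set w | sigma w <= t%:E]).

Definition stopped_sigma_field (sigma : Omega -> \bar R) : set (set Omega) :=
  [set A | completed_filtration +oo A /\
     forall t : R, (0 <= t)%R ->
       completed_filtration t%:E (A `&` [set w | sigma w <= t%:E])].

Definition right_continuous_filtration :=
  forall t : R, (0 <= t)%R ->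
    \bigcap_(s in [set s : R | (t < s)%R]) completed_filtration s%:E `<=`
    completed_filtration t%:E.

Definition markov_property :=
  forall (s t : R) (x : E) (A : set (borel E)) (B : set Omega),
    (0 <= s)%R -> (0 <= t)%R -> measurable A -> natural_filtration t%:E B ->
    P x (B `&` X (t%:E + s%:E) @^-1` A) =
    \int[P x]_(w in B) P (X t%:E w) (X s%:E @^-1` A).

(* The events of the completed filtration need not belong to the sigma-field of
   [Omega], but only to its completion with respect to [P x]. *)
Definition strong_markov_property :=
  forall (sigma : Omega -> \bar R) (s : R) (x : E) (A : set (borel E))
      (B : set Omega),
    stopping_time sigma -> (0 <= s)%R -> measurable A ->
    stopped_sigma_field sigma B ->
    completion (P x)
      (B `&` [set w | A (X (sigma w + s%:E) w)]) =
    \int[completion (P x)]_(w in B)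
      P (X (sigma w) w) (X s%:E @^-1` A).

Definition quasi_left_continuous :=
  forall (sigma_ : nat -> Omega -> \bar R) (sigma : Omega -> \bar R) (x : E),
    (forall n, stopping_time (sigma_ n)) -> stopping_time sigma ->
    (forall w, nondecreasing_seq (sigma_ ^~ w)) ->
    (forall w, sigma_ ^~ w @ \oo --> sigma w) ->
    {ae P x, forall w, sigma w < +oo ->
       X (sigma_ n w) w @[n --> \oo] --> X (sigma w) w}.

End filtration.

Section hitting.
Context {R : realType} {M : Type} {Omega : Type}.
Variable X : \bar R -> Omega -> M^Delta.
Local Open Scope ereal_scope.

Definition life_time (w : Omega) : \bar R :=
  ereal_inf [set t%:E | t in [set t : R | (0 <= t)%R /\ X t%:E w = None]].

Definition exit_time (B : set M) (w : Omega) : \bar R :=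
  ereal_inf [set t%:E | t in
    [set t : R | (0 <= t)%R /\ (~` (Some @` B)) (X t%:E w)]].

End hitting.

(* [None] is the cemetery; [hunt_X] is only meaningful at times in [0, +oo]. *)
Record hunt_process {R : realType} (M : pmetricType R) {d : measure_display}
    (Omega : measurableType d) := HuntProcess {
  hunt_X : \bar R -> Omega -> M^Delta ;
  hunt_P : M^Delta -> probability Omega R ;
  hunt_theta : R -> Omega -> Omega ;
  hunt_measurable : forall t : \bar R, (0 <= t)%E ->
    measurable_fun setT (hunt_X t : Omega -> borel M^Delta) ;
  hunt_normal : forall x : M^Delta,
    hunt_P x (hunt_X 0%E @^-1` [set x]) = 1%E ;
  hunt_kernel : forall (t : R) (A : set (borel M)), 0 <= t -> measurable A ->
    measurable_fun setT
      (fun x : borel M => hunt_P (Some x) (hunt_X t%:E @^-1` (Some @` A))) ;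
  hunt_markov : markov_property hunt_X hunt_P ;
  hunt_cemetery : forall (w : Omega) (t : \bar R),
    (life_time hunt_X w <= t)%E -> hunt_X t w = None ;
  hunt_shift : forall (t : R) (s : \bar R) (w : Omega),
    0 <= t -> (0 <= s)%E -> hunt_X s (hunt_theta t w) = hunt_X (s + t%:E)%E w ;
  hunt_right_continuous : forall (w : Omega) (t : R), 0 <= t ->
    hunt_X s%:E w @[s --> t^'+] --> hunt_X t%:E w ;
  hunt_left_limits : forall (w : Omega) (t : R), 0 < t ->
    exists l : M^Delta, hunt_X s%:E w @[s --> t^'-] --> l ;
  hunt_filtration : right_continuous_filtration hunt_X hunt_P ;
  hunt_strong_markov : strong_markov_property hunt_X hunt_P ;
  hunt_quasi_left_continuous : quasi_left_continuous hunt_X hunt_P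
}.

Section transition.
Context {R : realType} {M : pmetricType R} {d : measure_display}
  {Omega : measurableType d}.
Variable H : hunt_process M Omega.
Local Open Scope ereal_scope.

(* The probability, in the completion with respect to [hunt_P H (Some x)], of
   events defined through exit times. *)
Definition completed_prob (x : M) (A : set Omega) : \bar R :=
  completion (hunt_P H (Some x)) A.

Definition transition (t : R) (x : M) (A : set M) : \bar R :=
  hunt_P H (Some x) (hunt_X H t%:E @^-1` (Some @` A)).

Definition killed_transition (U : set M) (t : R) (x : M) (A : set M) : \bar R :=
  completed_prob x [set w | (Some @` A) (hunt_X H t%:E w) /\
                            t%:E < exit_time (hunt_X H) U w].

Definition avoids (N : set M) (w : Omega) :=
  forall t : R, (0 <= t)%R -> ~ (Some @` N) (hunt_X H t%:E w).

(* Before its life time the path stays in [M], which is an open subspace of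
   [M^Delta], so that continuity into [M] is continuity into [M^Delta]. *)
Definition continuous_path (w : Omega) :=
  {within [set t : R | (0 <= t)%R /\ t%:E < life_time (hunt_X H) w],
    continuous (fun t : R => hunt_X H t%:E w)}.

End transition.

(* Main.v *)
(* The idea is to bound [P_t (x, A)] for [A] in a small ball about [y0] using the
   Markov property at deterministic times only. Let [s_k] decrease to [0] and
   [rho_k] decrease, both geometrically. By continuity of paths, on [X_t \in A]
   the path is within [rho_k] of [y0] at time [t - s_k] and stays in [U] from then
   on, if [k] is large. Let [k] be the first such index. If [k = 0], the kernel
   killed on leaving [U] gives the bound. Otherwise the path crosses a shell about
   [y0] within time [s_(k-1)], an event of probability at most
   [c exp (- Phi (gamma r_k, s_(k-1)))] by (iii), and the killed kernel at time
   [s_k] costs a power of [s_0 / s_k] by (i) and (ii). As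
   [Phi (10^-k rho, b^k s) >= 2^k Phi (rho, s)] for a suitable ratio [b], the sum
   over [k] is comparable with its first term. Taking [s_0 = t], or
   [s_0 = Psi R / 2] for large [t], this yields [P_t (x, A) <= \int_A h_t (x, y)]
   with an explicit measurable [h], first for small and then for all [A]. A
   Radon-Nikodym theorem for kernels on a countably generated sigma-field gives a
   density that is jointly measurable, and [p] is its minimum with [h]. *)

Require Import Defs.
From HB Require Import structures.
From mathcomp Require Import all_boot all_order all_algebra.
From mathcomp Require Import all_classical all_reals all_analysis.
From mathcomp Require Import measurable_realfun.
From mathcomp Require Import ring lra.
Set Implicit Arguments.
Unset Strict Implicit.
Unset Printing Implicit Defensive.
Import Order.TTheory GRing.Theory Num.Theory.
Import numFieldNormedType.Exports.
Import HBSimple HBNNSimple.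
Local Open Scope classical_set_scope.
Local Open Scope ring_scope.

(** * Scale functions *)

(** The constant has to be fixed before the space, the process, [Psi] and [R0] are given. Every
    quantitative estimate on [Phi] therefore produces its constant in front of the quantifier over
    [Psi], with the scaling bounds as input. Exit events are controlled only in a completed
    sigma-field, while the Markov property at deterministic times concerns the natural filtration.
    Staying in [U] and crossing a shell are therefore encoded by events read at dyadic times, and
    continuity of paths compares them almost surely with the exit events. A single estimate,
    [offdiag_bound], serves all regimes because its length scale [D] is free: it is [mdist x y0]
    when this exceeds the radius [d0] with [Psi d0 = t], and [R0] otherwise. The bound is required
    at every [y] and the density must be measurable in [(t, x, y)], whereas a Radon-Nikodym
    derivative is determined only almost everywhere and separately for each [(t, x)]. Hence the
    upper bound is first an inequality between measures with a jointly measurable majorant, and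
    becomes pointwise only by truncation. *)

Lemma le_powR_of_root {R : realType} (b w l : R) : 0 < b -> 0 <= w ->
  w `^ b^-1 <= l -> w <= l `^ b.
Proof.
move=> b0 w0 wl; have l0 : 0 <= l by exact: le_trans (powR_ge0 _ _) wl.
have -> : w = (w `^ b^-1) `^ b by rewrite -powRrM mulVf ?gt_eqF// powRr1.
by rewrite ge0_ler_powR ?nnegrE ?powR_ge0 ?(ltW b0).
Qed.

Lemma powR_exprn {R : realType} (x a : R) n : 0 <= x ->
  (x ^+ n) `^ a = (x `^ a) ^+ n.
Proof.
by move=> x0; rewrite -powR_mulrn// -powRrM mulrC powRrM powR_mulrn// powR_ge0.
Qed.

Section gauge.
Context {R : realType}.
Implicit Types (Psi : R -> R) (rho t r D : R).

(** Abstracts the scale function. Values at two radii are compared through [gauge_quasi_monotone],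
    at the price of a factor [cPsi]. *)
Definition gauge (cPsi beta1 beta2 : R) Psi :=
  [/\ forall r, 0 < r -> 0 < Psi r,
      forall t, 0 < t -> exists2 r, 0 < r & Psi r = t &
      forall rho rho', 0 < rho -> rho <= rho' ->
        cPsi^-1 * (rho' / rho) `^ beta1 <= Psi rho' / Psi rho
          <= cPsi * (rho' / rho) `^ beta2].

Variables (cPsi beta1 beta2 : R).
Hypotheses (cPsi_gt0 : 0 < cPsi) (beta1_gt1 : 1 < beta1)
  (beta12 : beta1 <= beta2).

Lemma gauge_quasi_monotone Psi rho rho' : gauge cPsi beta1 beta2 Psi ->
  0 < rho -> rho <= rho' -> Psi rho <= cPsi * Psi rho'.
Proof.
move=> [P0 _ PB] rho0 rr'.
have /andP[+ _] := PB _ _ rho0 rr'.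
rewrite ler_pdivlMr ?P0// => h.
rewrite -ler_pdivrMl//; apply: le_trans h.
rewrite ler_pM2r ?P0// ler_peMr ?invr_ge0 ?(ltW cPsi_gt0)//.
have h1 : 1 <= rho' / rho by rewrite ler_pdivlMr// mul1r.
have := @ler_powR _ _ h1 0 beta1; rewrite powRr0; apply.
exact: le_trans ler01 (ltW beta1_gt1).
Qed.

(* For [u = d / r] large the superlinear term [u `^ beta1] dominates [kappa * u]. *)
Lemma gauge_affine_bound (kappa : R) : 0 <= kappa -> exists2 B, 0 <= B &
  forall Psi, gauge cPsi beta1 beta2 Psi ->
  forall d r, 0 < d -> 0 < r -> kappa * (d / r) - Psi d / Psi r <= B.
Proof.
move=> k0; pose u0 := (kappa * cPsi) `^ ((beta1 - 1)^-1).
have b10 : 0 < beta1 - 1 by rewrite subr_gt0.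
exists (kappa * Num.max 1 u0).
  by rewrite mulr_ge0// le_max ler01.
move=> Psi [P0 _ PB] d r d0 r0.
have [u1|u1] := leP (d / r) 1.
  rewrite lerBlDr (@le_trans _ _ (kappa * 1))//; first by rewrite ler_wpM2l.
  rewrite (@le_trans _ _ (kappa * Num.max 1 u0))//.
    by rewrite ler_wpM2l// le_max lexx.
  by rewrite lerDl divr_ge0// ltW// P0.
have rd : r <= d by move: u1; rewrite ltr_pdivlMr// mul1r => /ltW.
have /andP[+ _] := PB _ _ r0 rd.
have [uu0|uu0] := leP (d / r) u0.
  move=> _; rewrite lerBlDr (@le_trans _ _ (kappa * Num.max 1 u0))//.
    by rewrite ler_wpM2l// le_max uu0 orbT.
  by rewrite lerDl divr_ge0// ltW// P0.
move=> h; rewrite (@le_trans _ _ 0)//; last by rewrite mulr_ge0// le_max ler01.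
rewrite subr_le0; apply: le_trans h.
have dr0 : 0 < d / r by rewrite divr_gt0.
have -> : cPsi^-1 * (d / r) `^ beta1 =
    cPsi^-1 * (d / r) `^ (beta1 - 1) * (d / r).
  rewrite -mulrA -[X in _ * (_ * X)]powRr1 ?(ltW dr0)//.
  by rewrite -powRD ?subrK// (gt_eqF dr0) implybT.
rewrite ler_wpM2r ?(ltW dr0)// ler_pdivlMl// mulrC.
apply: le_powR_of_root => //; first by rewrite mulr_ge0// ltW.
exact: ltW.
Qed.

(** Writing [t] as [Psi d] turns the summand into the expression of [gauge_affine_bound] with slope
    [rho / d]. Without boundedness [sup] would take its default value and [Phi_ge] would fail. *)
Lemma Phi_has_sup Psi rho t : gauge cPsi beta1 beta2 Psi -> 0 <= rho -> 0 < t ->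
  has_sup [set rho / r - t / Psi r | r in [set r | 0 < r]].
Proof.
move=> gPsi rho0 t0; split.
  by exists (rho / 1 - t / Psi 1); exists 1 => //=.
have [_ surj _] := gPsi; have [d d0 dt] := surj _ t0.
have [B _ HB] := @gauge_affine_bound (rho / d) (divr_ge0 rho0 (ltW d0)).
exists B => _ [r /= r0 <-].
have := HB _ gPsi d r d0 r0; rewrite dt mulrA divfK//.
by rewrite gt_eqF.
Qed.

Lemma Phi_ge Psi rho t r : gauge cPsi beta1 beta2 Psi -> 0 <= rho -> 0 < t ->
  0 < r -> rho / r - t / Psi r <= Phi Psi rho t.
Proof.
move=> gPsi rho0 t0 r0; apply: ub_le_sup; last by exists r.
by have [] := Phi_has_sup gPsi rho0 t0.
Qed.

Lemma Phi_le Psi rho t B : (forall r, 0 < r -> rho / r - t / Psi r <= B) ->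
  Phi Psi rho t <= B.
Proof.
move=> H; apply: ge_sup.
  by exists (rho / 1 - t / Psi 1); exists 1 => //=.
by move=> _ [r /= r0 <-]; exact: H.
Qed.

Lemma Phi_ge0 Psi rho t : gauge cPsi beta1 beta2 Psi -> 0 <= rho -> 0 < t ->
  0 <= Phi Psi rho t.
Proof.
move=> gPsi rho0 t0; apply/ler_addgt0Pr => e e0.
(* A radius with [Psi r = t / e] makes the negative part of the summand equal to [e]. *)
have [_ surj _] := gPsi; have [r r0 rt] := surj _ (divr_gt0 t0 e0).
have := Phi_ge gPsi rho0 t0 r0; rewrite rt.
have -> : t / (t / e) = e by field; rewrite !gt_eqF.
move=> h; rewrite -lerBlDr; apply: le_trans h.
by rewrite lerD2r divr_ge0// ltW.
Qed.

(** Multiplying the summand by [l] also multiplies the subtracted term; as [1 <= l], keeping that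
    term unscaled only increases the result. *)
Lemma Phi_homogeneous Psi rho t l : gauge cPsi beta1 beta2 Psi ->
  0 <= rho -> 0 < t -> 1 <= l -> l * Phi Psi rho t <= Phi Psi (l * rho) t.
Proof.
move=> gPsi rho0 t0 l1; have l0 : 0 < l by exact: lt_le_trans ltr01 l1.
rewrite mulrC -ler_pdivlMr//; apply: Phi_le => r r0.
rewrite ler_pdivlMr//; apply: le_trans (Phi_ge gPsi _ t0 r0); last first.
  by rewrite mulr_ge0// ltW.
rewrite mulrBl lerB//; first by rewrite mulrAC [l * _]mulrC.
have [P0 _ _] := gPsi.
by rewrite ler_peMr// divr_ge0// ltW// P0.
Qed.

Lemma Phi_mono Psi rho rho' t t' : gauge cPsi beta1 beta2 Psi ->
  0 <= rho -> rho <= rho' -> 0 < t' -> t' <= t ->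
  Phi Psi rho t <= Phi Psi rho' t'.
Proof.
move=> gPsi rho0 rr' t0 tt'; apply: Phi_le => r r0.
apply: le_trans (Phi_ge gPsi (le_trans rho0 rr') t0 r0).
have [P0 _ _] := gPsi.
by rewrite lerB// ler_pM2r// invr_gt0// P0.
Qed.

Lemma Phi_lower (kappa C : R) : 0 < kappa -> 0 < C -> exists2 phi0, 0 < phi0 &
  forall Psi, gauge cPsi beta1 beta2 Psi ->
  forall D t, 0 < D -> 0 < t -> t <= C * Psi D ->
  phi0 <= Phi Psi (kappa * D) t.
Proof.
move=> k0 C0; have b10 : 0 < beta1 - 1 by rewrite subr_gt0.
pose w := 2 * C * cPsi / kappa.
have w0 : 0 < w by rewrite /w !(mulr_gt0, invr_gt0).
pose l := Num.max 1 (w `^ ((beta1 - 1)^-1)).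
have l1 : 1 <= l by rewrite /l le_max lexx.
have l0 : 0 < l by exact: lt_le_trans ltr01 l1.
exists (kappa / (2 * l)); first by rewrite divr_gt0// mulr_gt0.
move=> Psi gPsi D t D0 t0 tC.
have lD0 : 0 < l * D by rewrite mulr_gt0.
apply: le_trans (Phi_ge gPsi _ t0 lD0); last by rewrite mulr_ge0// ltW.
have [P0 _ PB] := gPsi.
have DlD : D <= l * D by rewrite ler_peMl// ltW.
have /andP[+ _] := PB _ _ D0 DlD; rewrite mulfK ?gt_eqF// => h.
have lw : w <= l `^ (beta1 - 1).
  by apply: le_powR_of_root; rewrite ?(ltW w0)// /l le_max lexx orbT.
have h2 : t / Psi (l * D) <= kappa / (2 * l).
  rewrite ler_pdivrMr ?P0//; apply: le_trans tC _.
  move: h; rewrite ler_pdivlMr ?P0// => h.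
  apply: (@le_trans _ _ (kappa / (2 * l) * (cPsi^-1 * l `^ beta1 * Psi D))).
    rewrite mulrA ler_wpM2r ?(ltW (P0 _ D0))//.
    have -> : l `^ beta1 = l `^ (beta1 - 1) * l.
      rewrite -[X in _ * X]powRr1 ?(ltW l0)//.
      by rewrite -powRD ?subrK// (gt_eqF l0) implybT.
    have -> : kappa / (2 * l) * (cPsi^-1 * (l `^ (beta1 - 1) * l)) =
       kappa / (2 * cPsi) * l `^ (beta1 - 1).
      by field; rewrite !gt_eqF.
    rewrite [leLHS](_ : C = kappa / (2 * cPsi) * w).
      by rewrite ler_wpM2l// divr_ge0 ?mulr_ge0// ltW.
    by rewrite /w; field; rewrite !gt_eqF.
  by rewrite ler_wpM2l// ltW// divr_gt0// mulr_gt0.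
rewrite lerBrDr; apply: le_trans (_ : kappa / (2 * l) + kappa / (2 * l) <= _).
  by rewrite lerD2l.
by rewrite le_eqVlt; apply/orP; left; apply/eqP; field; rewrite !gt_eqF.
Qed.

(* Replacing [r] by [r / 20] doubles [10^-1 * rho / r] and divides [Psi r] by at
   most [cPsi * 20 `^ beta2]; the ratio is chosen so that [b * t / Psi r] at most
   doubles as well. *)
Definition gauge_ratio : R := 2 / (Num.max 1 cPsi * 20 `^ beta2).

Lemma gauge_ratio_gt0 : 0 < gauge_ratio.
Proof.
by rewrite divr_gt0// mulr_gt0 ?powR_gt0// lt_max ltr01.
Qed.

Lemma gauge_ratio_le : gauge_ratio <= 10^-1.
Proof.
have b2 : 1 <= beta2 by rewrite (le_trans (ltW beta1_gt1)).
have Q20 : 20 <= 20 `^ beta2 :> R by rewrite le1r_powR//; lra.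
have m1 : 1 <= Num.max 1 cPsi by rewrite le_max lexx.
rewrite /gauge_ratio ler_pdivrMr ?mulr_gt0 ?powR_gt0 ?lt_max ?ltr01//.
have : 20 <= Num.max 1 cPsi * 20 `^ beta2.
  by rewrite -[leLHS]mul1r ler_pM.
set z := _ * _; clearbody z; lra.
Qed.

Lemma Phi_scale Psi rho t (j : nat) : gauge cPsi beta1 beta2 Psi ->
  0 <= rho -> 0 < t ->
  2 ^+ j * Phi Psi rho t <= Phi Psi (10^-1 ^+ j * rho) (gauge_ratio ^+ j * t).
Proof.
move=> gPsi rho0 t0; have b0 := gauge_ratio_gt0.
rewrite mulrC -ler_pdivlMr ?exprn_gt0//; apply: Phi_le => r r0.
rewrite ler_pdivlMr ?exprn_gt0//.
(* The radius is divided by [20 ^+ j] in one jump, so that the constant [cPsi] of the scaling bound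
   is paid once and not [j] times. *)
have r'0 : 0 < 20^-1 ^+ j * r by rewrite mulr_gt0// exprn_gt0.
apply: le_trans (Phi_ge gPsi _ _ r'0); rewrite ?mulr_ge0 ?exprn_ge0//; last first.
  by rewrite mulr_gt0 ?exprn_gt0.
rewrite mulrBl lerB//.
  rewrite le_eqVlt; apply/orP; left; apply/eqP.
  rewrite (_ : 20^-1 = 10^-1 * 2^-1 :> R); last by field.
  rewrite exprMn !exprVn.
  by field; rewrite !gt_eqF ?exprn_gt0.
have [P0 _ PB] := gPsi.
have rr : 20^-1 ^+ j * r <= r.
  by rewrite ger_pMl// exprn_ile1// ?invr_ge0//; lra.
have /andP[_] := PB _ _ r'0 rr.
have -> : r / (20^-1 ^+ j * r) = 20 ^+ j.
  by rewrite exprVn; field; rewrite !gt_eqF ?exprn_gt0.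
rewrite powR_exprn//.
rewrite ler_pdivrMr ?P0// => h.
rewrite ler_pdivrMr ?P0// /gauge_ratio expr_div_n.
set P' := Psi (_ * r) in h *; set m := Num.max 1 cPsi.
have m0 : 0 < m by rewrite /m lt_max ltr01.
have P'0 : 0 < P' by rewrite /P' P0.
have Pr := P0 _ r0.
rewrite (_ : t / Psi r * 2 ^+ j * P' = 2 ^+ j * t * (P' / Psi r)); last by ring.
rewrite mulrAC ler_pM2l ?mulr_gt0 ?exprn_gt0// ler_pdivlMr// ler_pdivrMl; last first.
  by rewrite exprn_gt0// mulr_gt0 ?powR_gt0.
(* The power [m ^+ j] dominates the single factor [cPsi] only for positive [j]; for [j = 0] the
   radius is unchanged. *)
have [j0|j0] := posnP j.
  by rewrite /P' j0 !expr0 !mul1r.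
apply: le_trans h _; rewrite ler_pM2r// exprMn ler_pM2r ?exprn_gt0 ?powR_gt0//.
apply: (@le_trans _ _ m); first by rewrite le_max lexx orbT.
by rewrite -(prednK j0) exprS ler_peMr ?(ltW m0)// exprn_ege1// le_max lexx.
Qed.

(** The quotient of consecutive terms is [L * expR (- (2 ^+ j * c))], which is eventually at most
    one half; the finitely many earlier terms go into the constant. *)
Lemma expR_doubling_decay (L c : R) : 0 <= L -> 0 < c ->
  exists2 C, 0 < C & forall j : nat, L ^+ j * expR (- (2 ^+ j * c)) <= C * 2^-1 ^+ j.
Proof.
move=> L0 c0; pose x (j : nat) := L ^+ j * expR (- (2 ^+ j * c)).
have x0 j : 0 <= x j by rewrite mulr_ge0 ?exprn_ge0 ?expR_ge0.
have [j0 Hj0] : exists j0 : nat, forall j : nat, (j0 <= j)%N -> x j.+1 <= 2^-1 * x j.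
  (* Beyond this index [2 * L < j * c <= 2 ^+ j * c], which is below the exponential of the
     right-hand side. *)
  exists (Num.truncn (2 * L / c)).+1 => j jj0.
  have -> : x j.+1 = L * expR (- (2 ^+ j * c)) * x j.
    rewrite /x !exprS (_ : - (2 * 2 ^+ j * c) = - (2 ^+ j * c) + - (2 ^+ j * c)).
      by rewrite expRD; ring.
    by ring.
  rewrite ler_wpM2r// expRN ler_pdivrMr ?expR_gt0//.
  rewrite ler_pdivlMl//; apply: le_trans (expR_ge1Dx _).
  have j2 : j%:R <= 2 ^+ j :> R by rewrite -natrX ler_nat ltnW// ltn_expl.
  have : 2 * L / c < j%:R.
    by apply: lt_le_trans (truncnS_gt _) _; rewrite ler_nat.
  rewrite ltr_pdivrMr// => h.
  have : j%:R * c <= 2 ^+ j * c by rewrite ler_pM2r.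
  lra.
pose C := 1 + \sum_(i < j0.+1) 2 ^+ i * x i.
exists C.
  by rewrite ltr_pwDl// sumr_ge0// => i _; rewrite mulr_ge0 ?exprn_ge0.
elim=> [|j IH]; rewrite -?/(x _).
  rewrite expr0 mulr1 /C big_ord_recl expr0 mul1r.
  by rewrite [leRHS]addrCA lerDl addr_ge0// sumr_ge0// => i _; rewrite mulr_ge0 ?exprn_ge0.
have [jj0|jj0] := leqP j0 j.
  apply: (le_trans (Hj0 _ jj0)).
  by rewrite exprS [leRHS]mulrCA ler_pM2l// invr_gt0.
rewrite exprVn ler_pdivlMr ?exprn_gt0// mulrC /C.
have jj1 : (j.+1 < j0.+1)%N by [].
rewrite (bigD1 (Ordinal jj1))//= addrCA lerDl addr_ge0//.
by apply: sumr_ge0 => i _; rewrite mulr_ge0 ?exprn_ge0.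
Qed.

(** By [Phi_scale] the exponent is at least [2 ^+ j] times the initial one. As the latter is at
    least [phi], a full copy can be split off and the remaining [(2 ^+ j - 1) * phi] beats
    [L ^+ j]. *)
Lemma Phi_geometric_sum (kappa C0 L : R) : 0 < kappa -> 0 < C0 -> 0 <= L ->
  exists2 C, 0 < C & forall Psi, gauge cPsi beta1 beta2 Psi ->
  forall D t, 0 < D -> 0 < t -> t <= C0 * Psi D -> forall j : nat,
  L ^+ j * expR (- Phi Psi (10^-1 ^+ j * (kappa * D)) (gauge_ratio ^+ j * t)) <=
  C * 2^-1 ^+ j * expR (- Phi Psi (kappa * D) t).
Proof.
move=> k0 C00 L0; have [phi phi0 Hphi] := Phi_lower k0 C00.
have [C CC HC] := expR_doubling_decay L0 phi0.
exists (C * expR phi); first by rewrite mulr_gt0// expR_gt0.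
move=> Psi gPsi D t D0 t0 tD j; have kD0 : 0 <= kappa * D by rewrite mulr_ge0 ?ltW.
have h1 := Phi_scale j gPsi kD0 t0.
have h2 := Hphi _ gPsi _ _ D0 t0 tD.
apply: (@le_trans _ _ (L ^+ j * (expR (- (2 ^+ j * phi)) *
    (expR phi * expR (- Phi Psi (kappa * D) t))))).
  rewrite ler_wpM2l ?exprn_ge0// -!expRD ler_expR.
  have : 0 <= (2 ^+ j - 1) * (Phi Psi (kappa * D) t - phi).
    by rewrite mulr_ge0// subr_ge0// exprn_ege1// ler1n.
  lra.
rewrite mulrA [leRHS](_ : _ = C * 2^-1 ^+ j * (expR phi * expR (- Phi Psi (kappa * D) t))).
  by rewrite ler_wpM2r// mulr_ge0 ?expR_ge0.
by ring.
Qed.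

(** The surplus [kappa1 / kappa2 - 1] of the rate pays for the power. If [t] lies between the powers
    [j.+1] and [j] of the ratio times [Psi D], the power is at most [L ^+ j.+1], while by
    [Phi_scale] the exponent is at least [2 ^+ j * phi]. For [Psi D <= t] the power is at most
    [1]. *)
Lemma Phi_absorb (kappa1 kappa2 C0 alpha : R) : 0 < kappa2 -> kappa2 < kappa1 ->
  0 < C0 -> 0 < alpha -> exists2 C, 0 < C &
  forall Psi, gauge cPsi beta1 beta2 Psi ->
  forall D t, 0 < D -> 0 < t -> t <= C0 * Psi D ->
  (Psi D / t) `^ alpha * expR (- Phi Psi (kappa1 * D) t) <=
  C * expR (- Phi Psi (kappa2 * D) t).
Proof.
move=> k20 k12 C00 al0.
have b0 := gauge_ratio_gt0; have b1 := gauge_ratio_le.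
have [phi phi0 Hphi] := Phi_lower k20 (ltr01 : 0 < 1 :> R).
pose dl := kappa1 / kappa2 - 1.
have dl0 : 0 < dl by rewrite subr_gt0 ltr_pdivlMr// mul1r.
pose L := (gauge_ratio^-1) `^ alpha.
have L0 : 0 <= L by rewrite powR_ge0.
have [C CC HC] := expR_doubling_decay L0 (mulr_gt0 dl0 phi0).
exists (1 + L * C); first by rewrite ltr_pwDl// mulr_ge0// ltW.
move=> Psi gPsi D t D0 t0 tD; have [P0 _ _] := gPsi.
have kD0 : 0 <= kappa2 * D by rewrite mulr_ge0 ?ltW.
have Ph0 := Phi_ge0 gPsi kD0 t0.
have h1 : kappa1 / kappa2 * Phi Psi (kappa2 * D) t <= Phi Psi (kappa1 * D) t.
  apply: le_trans (Phi_homogeneous gPsi kD0 t0 _) _.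
    by rewrite ler_pdivlMr// mul1r ltW.
  by rewrite mulrA divfK// gt_eqF.
suff H : (Psi D / t) `^ alpha * expR (- (dl * Phi Psi (kappa2 * D) t)) <= 1 + L * C.
  apply: le_trans (_ : (Psi D / t) `^ alpha *
     (expR (- (dl * Phi Psi (kappa2 * D) t)) * expR (- Phi Psi (kappa2 * D) t)) <= _).
    rewrite ler_wpM2l ?powR_ge0// -expRD ler_expR.
    by move: h1; rewrite /dl; lra.
  by rewrite mulrA ler_wpM2r ?expR_ge0.
have LC : 0 <= L * C by rewrite mulr_ge0// ltW.
have [tD'|tD'] := leP (Psi D) t.
  apply: (@le_trans _ _ 1); last by rewrite lerDl.
  rewrite -[leRHS]mul1r ler_pM ?powR_ge0 ?expR_ge0//.
    have := @ge0_ler_powR _ _ (ltW al0) (Psi D / t) 1.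
    rewrite !nnegrE powR1; apply; rewrite ?ler01 ?divr_ge0 ?(ltW t0) ?(ltW (P0 _ D0))//.
    by rewrite ler_pdivrMr// mul1r.
  by rewrite -[leRHS]expR0 ler_expR oppr_le0 mulr_ge0// ltW.
have [n Hn] : exists n, gauge_ratio ^+ n.+1 * Psi D < t.
  have /cvgrPdist_lt : gauge_ratio ^+ n @[n --> \oo] --> 0.
    by apply: cvg_expr; rewrite ger0_norm ?(ltW b0)//; apply: le_lt_trans b1 _; lra.
  have e0 : 0 < t / Psi D by rewrite divr_gt0 ?P0.
  move=> /(_ _ e0)[n _ /(_ n.+1 (leqnSn n))]/=.
  rewrite sub0r normrN ger0_norm ?exprn_ge0 ?(ltW b0)// => h; exists n.
  by rewrite -ltr_pdivlMr ?P0.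
have [j Hj jmin] := ex_minnP (ex_intro (fun n => gauge_ratio ^+ n.+1 * Psi D < t) n Hn).
have tj : t <= gauge_ratio ^+ j * Psi D.
  case: j Hj jmin => [|j] Hj jmin; first by rewrite expr0 mul1r ltW.
  rewrite leNgt; apply/negP => /jmin; by rewrite ltnn.
have h3 : 2 ^+ j * phi <= Phi Psi (kappa2 * D) t.
  apply: (@le_trans _ _ (2 ^+ j * Phi Psi (kappa2 * D) (Psi D))).
    by rewrite ler_pM2l ?exprn_gt0// Hphi ?P0// mul1r.
  apply: le_trans (Phi_scale j gPsi kD0 (P0 _ D0)) _.
  apply: Phi_mono gPsi _ _ t0 tj; first by rewrite mulr_ge0// exprn_ge0.
  by rewrite ler_piMl// exprn_ile1//; lra.
apply: (@le_trans _ _ (L ^+ j.+1 * expR (- (2 ^+ j * (dl * phi))))).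
  rewrite ler_pM ?powR_ge0 ?expR_ge0//; last first.
    by rewrite ler_expR lerN2 mulrCA ler_pM2l.
  rewrite /L -powR_exprn ?invr_ge0 ?(ltW b0)//.
  rewrite ge0_ler_powR ?nnegrE ?(ltW al0) ?exprn_ge0 ?invr_ge0 ?(ltW b0)//.
    by rewrite divr_ge0 ?(ltW t0)// ltW// P0.
  rewrite exprVn ler_pdivrMr// ler_pdivlMl ?exprn_gt0//.
  exact: ltW.
rewrite exprS -mulrA; apply: (@le_trans _ _ (L * (C * 2^-1 ^+ j))).
  by rewrite ler_wpM2l.
rewrite mulrA; apply: (@le_trans _ _ (L * C)); last by rewrite lerDr.
by rewrite ler_piMr// exprn_ile1//; lra.
Qed.

(** At distances comparable to the scale of the time the exponential is bounded below, so that it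
    can be inserted into a bound at the price of [expR B]. *)
Lemma Phi_upper (kappa : R) : 0 <= kappa -> exists2 B, 0 <= B &
  forall Psi, gauge cPsi beta1 beta2 Psi ->
  forall D, 0 < D -> Phi Psi (kappa * D) (Psi D) <= B.
Proof.
move=> k0; have [B B0 HB] := gauge_affine_bound k0; exists B => // Psi gPsi D D0.
by apply: Phi_le => r r0; rewrite -mulrA HB.
Qed.

Lemma measurable_domain_Phi :
  measurable [set z : R * R | 0 <= z.1 /\ 0 < z.2].
Proof.
rewrite (_ : [set z | _] = (`[0, +oo[ `*` `]0, +oo[)%classic).
  by apply: measurableX; exact: measurable_itv.
by apply/seteqP; split => -[u v] /=; rewrite !in_itv/= !andbT.
Qed.

(* [{Phi > a}] is a union of sets [{rho / r - t / Psi r > a}]; as the summand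
   increases in [rho] and decreases in [t], countably many rational quadrants
   suffice. *)
Lemma measurable_Phi Psi : gauge cPsi beta1 beta2 Psi ->
  measurable_fun [set z : R * R | 0 <= z.1 /\ 0 < z.2]
    (fun z => Phi Psi z.1 z.2).
Proof.
move=> gPsi mD; have [P0 _ _] := gPsi.
apply: (measurability _ (RGenOInfty.measurableE R)) => // _ [_ [a ->] <-].
set D := [set z : R * R | _].
pose G := [set qp : rat * rat | exists2 r, 0 < r & a < ratr qp.1 / r - ratr qp.2 / Psi r].
rewrite (_ : _ `&` _ = D `&` \bigcup_(i : rat) \bigcup_(j : rat)
    (if `[< G (i, j) >] then (`[ratr i, +oo[ `*` `]-oo, ratr j])%classic
     else set0)); last first.
  apply/seteqP; split => -[rho t]/= [[rho0 t0]].
    rewrite in_itv/= andbT => h; split=> //.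
    have [_ [r r0 <-] hr] : exists2 y,
        [set rho / r - t / Psi r | r in [set r | 0 < r]] y & a < y.
      by apply: sup_gt => //; have [] := Phi_has_sup gPsi rho0 t0.
    have Pr := P0 r r0; set e := rho / r - t / Psi r - a in hr *.
    have e0 : 0 < rho / r - t / Psi r - a by rewrite subr_gt0.
    have : rho - r * ((rho / r - t / Psi r - a) / 2) < rho.
      by rewrite ltrBlDr ltrDl mulr_gt0// divr_gt0.
    move=> /rat_in_itvoo[i]; rewrite in_itv/= => /andP[i1 i2].
    have : t < t + Psi r * ((rho / r - t / Psi r - a) / 2).
      by rewrite ltrDl mulr_gt0// divr_gt0.
    move=> /rat_in_itvoo[j]; rewrite in_itv/= => /andP[j1 j2].
    exists i => //; exists j => //; case: asboolP => [_|Gij].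
      by rewrite /= !in_itv/= (ltW i2) (ltW j1).
    exfalso; apply: Gij; exists r => //=.
    have i3 : rho / r - (rho / r - t / Psi r - a) / 2 < ratr i / r.
      by rewrite ltr_pdivlMr// mulrBl divfK ?gt_eqF// (mulrC _ r).
    have j3 : ratr j / Psi r < t / Psi r + (rho / r - t / Psi r - a) / 2.
      by rewrite ltr_pdivrMr// mulrDl divfK ?gt_eqF// (mulrC _ (Psi r)).
    lra.
  move=> [i _ [j _]]; case: asboolP => // -[r r0 /= h] []; rewrite !in_itv/= andbT.
  move=> ri tj; split => //; rewrite andbT; apply: (lt_le_trans h).
  apply: le_trans (Phi_ge gPsi rho0 t0 r0); have Pr := P0 r r0.
  by rewrite lerB// ler_pM2r ?invr_gt0.
apply: measurableI => //.
apply: bigcupT_measurable_rat => i; apply: bigcupT_measurable_rat => j.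
by case: ifPn => // _; apply: measurableX; exact: measurable_itv.
Qed.

End gauge.

(** * Densities of kernels *)

Lemma setY_triangle {T : Type} (A B C : set T) :
  A `+` C `<=` (A `+` B) `|` (B `+` C).
Proof.
move=> x; rewrite !setY_def => -[[Ax nCx]|[Cx nAx]].
  have [Bx|nBx] := pselect (B x); first by right; left.
  by left; left.
have [Bx|nBx] := pselect (B x); first by left; right.
by right; right.
Qed.

Lemma setYU_sub {T : Type} (A B C D : set T) :
  (A `|` B) `+` (C `|` D) `<=` (A `+` C) `|` (B `+` D).
Proof.
move=> x; rewrite !setY_def.
move=> [[[Ax|Bx] /not_orP[nC nD]]|[[Cx|Dx] /not_orP[nA nB]]].
- by left; left.
- by right; left.
- by left; right.
- by right; right.
Qed.

Definition countable_algebra {d} {T : measurableType d} (A : nat -> set T) :=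
  [/\ forall i, measurable (A i),
      forall i, exists j, A j = ~` A i,
      forall i j, exists k, A k = A i `|` A j &
      forall B : set T, measurable B -> <<s range A >> B].

Section countable_algebra.
Context {d : measure_display} {T : measurableType d} {R : realType}.
Variable A : nat -> set T.
Hypothesis Aalg : countable_algebra A.

Lemma measurable_setY (B C : set T) :
  measurable B -> measurable C -> measurable (B `+` C).
Proof. by move=> mB mC; rewrite setY_def; apply: measurableU; exact: measurableD. Qed.

(** The sets that can be approximated form a sigma-field containing the algebra. Countable unions
    are cut to finite ones by continuity of the finite measure from above. *)
Lemma countable_algebra_approx (m : {measure set T -> \bar R}) (B : set T) :
  (m setT < +oo)%E -> measurable B ->
  forall e : R, 0 < e -> exists i, (m (B `+` A i) < e%:E)%E.
Proof.
have [mA AC AU Agen] := Aalg => moo mB.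
pose G := [set B | measurable B /\
  forall e : R, 0 < e -> exists i, (m (B `+` A i) < e%:E)%E].
suff GB : <<s range A >> `<=` G by have [] := GB _ (Agen _ mB).
apply: smallest_sub; last first.
  move=> _ [i _ <-]; split => // e e0; exists i.
  by rewrite setYK measure0 lte_fin.
have GU C D : G C -> G D -> G (C `|` D).
  move=> [mC HC] [mD HD]; split; first exact: measurableU.
  move=> e e0; have e20 : 0 < e / 2 by rewrite divr_gt0.
  have [i Hi] := HC _ e20; have [j Hj] := HD _ e20.
  have [k Hk] := AU i j; exists k; rewrite Hk.
  apply: (@le_lt_trans _ _ (m (C `+` A i) + m (D `+` A j))%E); last first.
    by rewrite (splitr e) EFinD lteD.
  apply: le_trans (measureU2 m _ _); try exact: measurable_setY.
  apply: le_measure; rewrite ?inE; last exact: setYU_sub.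
    by apply: measurable_setY; apply: measurableU.
  by apply: measurableU; exact: measurable_setY.
split.
- split; first exact: measurable0.
  move=> e e0; have [i Hi] := AC 0%N; have [j Hj] := AU 0%N i.
  have [k Hk] := AC j; exists k.
  have -> : A k = set0 by rewrite Hk Hj Hi setUCr setCT.
  by rewrite setYK measure0 lte_fin.
- move=> C [mC HC]; rewrite setTD; split; first exact: measurableC.
  move=> e e0; have [i Hi] := HC _ e0; have [j Hj] := AC i; exists j; rewrite Hj.
  rewrite (_ : ~` C `+` ~` A i = C `+` A i)// !setY_def !setDE !setCK.
  by rewrite setUC [~` A i `&` _]setIC [~` C `&` _]setIC.
- move=> C GC; pose F n := \big[setU/set0]_(i < n.+1) C i.
  have GF n : G (F n).
    by elim: n => [|n IH]; rewrite /F big_ord_recr/= ?big_ord0 ?set0U//; exact: GU.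
  have mF n : measurable (F n) by have [] := GF n.
  have CF : \bigcup_k C k = \bigcup_n F n by rewrite bigcup_bigsetU_bigcup.
  have mC : measurable (\bigcup_k C k) by rewrite CF; exact: bigcupT_measurable.
  split => // e e0; have e20 : 0 < e / 2 by rewrite divr_gt0.
  have : (m \o (fun n => (\bigcup_k C k) `\` F n)) x @[x --> \oo] -->
      m (\bigcap_n ((\bigcup_k C k) `\` F n)).
    apply: nonincreasing_cvg_mu => //.
    + apply: le_lt_trans moo; apply: le_measure; rewrite ?inE//; exact: measurableD.
    + by move=> i; exact: measurableD.
    + by apply: bigcapT_measurable => i; exact: measurableD.
    + move=> p q pq; apply/subsetPset; apply: setDS.
      exact: subset_bigsetU.
  have -> : \bigcap_n ((\bigcup_k C k) `\` F n) = set0.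
    rewrite -subset0 => x H; have [[k _ Ckx] _] := H 0%N I.
    have [_ ] := H k I; apply; rewrite /F -bigcup_mkord.
    by exists k => //=.
  rewrite measure0 => /fine_cvgP[fin]; move=> /cvgrPdist_lt/(_ _ e20)[N _ HN].
  have mDN : (m (\bigcup_k C k `\` F N) < (e / 2)%:E)%E.
    have finN : m (\bigcup_k C k `\` F N) \is a fin_num.
      rewrite ge0_fin_numE//; apply: le_lt_trans moo.
      by apply: le_measure; rewrite ?inE//; exact: measurableD.
    have := HN N (leqnn N); rewrite /= sub0r normrN -lte_fin.
    rewrite ger0_norm ?fine_ge0//; first by rewrite fineK.
  have [i Hi] := (GF N).2 _ e20; exists i.
  apply: (@le_lt_trans _ _ (m ((\bigcup_k C k) `+` F N) + m (F N `+` A i))%E).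
    apply: le_trans (measureU2 m _ _); try exact: measurable_setY.
    apply: le_measure; rewrite ?inE; last exact: setY_triangle.
      exact: measurable_setY.
    by apply: measurableU; exact: measurable_setY.
  rewrite (splitr e) EFinD lteD// setY_def.
  rewrite (_ : F N `\` \bigcup_k C k = set0) ?setU0//.
  rewrite setD_eq0 CF; exact: bigcup_sup.
Qed.

(** The index type is countable, so that these functions can be enumerated and the first suitable
    one selected measurably. *)
Definition rational_step (s : seq (rat * nat)) (y : T) : R :=
  \sum_(p <- s) ratr p.1 * \1_(A p.2) y.

Lemma measurable_rational_step s D : measurable_fun D (rational_step s).
Proof.
have [mA _ _ _] := Aalg.
elim: s => [|p s IH]; rewrite /rational_step.
  by under eq_fun do rewrite big_nil; exact: measurable_cst.
under eq_fun do rewrite big_cons.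
apply: measurable_funD => //; apply: measurable_funM => //.
Qed.

Lemma rational_step_bounded s :
  exists M : {nonneg R}, forall y, `|rational_step s y| <= M%:num.
Proof.
have M0 : 0 <= \sum_(p <- s) `|ratr p.1 : R| by exact: sumr_ge0.
exists (NngNum M0) => y /=; apply: le_trans (ler_norm_sum _ _ _) _.
apply: ler_sum => p _; rewrite normrM indicE ler_piMr//.
by case: (_ \in _); rewrite ?normr1 ?normr0.
Qed.

Variable mu : {measure set T -> \bar R}.
Hypothesis muoo : (mu setT < +oo)%E.

Let L1_approx (f : T -> R) := measurable_fun setT f /\ forall e : R, 0 < e ->
  exists s, (\int[mu]_y `|f y - rational_step s y|%:E <= e%:E)%E.

Let L1_approxD f g : L1_approx f -> L1_approx g -> L1_approx (f \+ g).
Proof.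
move=> [mf Hf] [mg Hg]; split; first exact: measurable_funD.
move=> e e0; have e20 : 0 < e / 2 by rewrite divr_gt0.
have [s Hs] := Hf _ e20; have [t Ht] := Hg _ e20; exists (s ++ t).
have ms := @measurable_rational_step s setT.
have mt := @measurable_rational_step t setT.
apply: (@le_trans _ _ (\int[mu]_y (`|f y - rational_step s y|%:E +
    `|g y - rational_step t y|%:E))%E).
  apply: ge0_le_integral => //=.
  - apply/measurable_EFinP; apply: measurableT_comp => //.
    by apply: measurable_funB; [exact: measurable_funD|exact: measurable_rational_step].
  - by apply/measurable_EFinP; apply: measurable_funD; apply: measurableT_comp => //;
      exact: measurable_funB.
  - move=> y _; rewrite -EFinD lee_fin /rational_step big_cat/= opprD addrACA.
    exact: ler_normD.
rewrite ge0_integralD//; last 2 first.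
- by apply/measurable_EFinP; apply: measurableT_comp => //; exact: measurable_funB.
- by apply/measurable_EFinP; apply: measurableT_comp => //; exact: measurable_funB.
by rewrite (splitr e) EFinD leeD.
Qed.

Let L1_approx_indic v (B : set T) : measurable B -> L1_approx (fun y => v * \1_B y).
Proof.
have [mA _ _ _] := Aalg.
move=> mB; split; first exact: measurable_funM.
move=> e e0; have mf : mu setT \is a fin_num by rewrite ge0_fin_numE.
pose M := fine (mu setT); have M0 : 0 <= M by rewrite fine_ge0.
(* Half of the error is for the coefficient, weighted by the total mass, and half for the set,
   weighted by [|ratr q|]. The [+ 1] avoids a division by zero. *)
have [q Hq] : exists q : rat, `|v - ratr q| <= e / 2 / (M + 1).
  have d0 : 0 < e / 2 / (M + 1) by rewrite !divr_gt0// ltr_wpDl.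
  have [q] := @rat_in_itvoo R v (v + e / 2 / (M + 1)) ltac:(by rewrite ltrDl).
  rewrite in_itv/= => /andP[vq qv]; exists q.
  by rewrite distrC ger0_norm ?subr_ge0 ?(ltW vq)// lerBlDl ltW.
have d0 : 0 < e / 2 / (`|ratr q : R| + 1) by rewrite !divr_gt0// ltr_wpDl.
have [i Hi] := countable_algebra_approx muoo mB d0.
exists [:: (q, i)].
apply: (@le_trans _ _ (\int[mu]_y ((`|v - ratr q|)%:E + (`|ratr q| * \1_(B `+` A i) y)%:E))%E).
  apply: ge0_le_integral => //=.
  - apply/measurable_EFinP; apply: measurableT_comp => //.
    by apply: measurable_funB; [exact: measurable_funM|exact: measurable_rational_step].
  - apply/measurable_EFinP; apply: measurable_funD => //; apply: measurable_funM => //.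
    by apply: measurable_indic; exact: measurable_setY.
  - move=> y _; rewrite -EFinD lee_fin /rational_step big_seq1/=.
    rewrite (_ : v * \1_B y - _ = (v - ratr q) * \1_B y + ratr q * (\1_B y - \1_(A i) y)); last by ring.
    apply: le_trans (ler_normD _ _) _; rewrite !normrM lerD//.
      by rewrite ler_piMr// indicE; case: (_ \in _); rewrite ?normr1 ?normr0.
    rewrite ler_wpM2l// !indicE.
    have [Bx|Bx] := boolP (y \in B); have [Ax|Ax] := boolP (y \in A i) => /=.
    + by rewrite subrr normr0.
    + rewrite subr0 normr1 mem_set// setY_def; left.
      by split; [rewrite inE in Bx|rewrite notin_setE in Ax].
    + rewrite sub0r normrN normr1 mem_set// setY_def; right.
      by split; [rewrite inE in Ax|rewrite notin_setE in Bx].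
    + by rewrite subrr normr0.
have mY : measurable (B `+` A i) by exact: measurable_setY.
rewrite ge0_integralD//; last first.
  by apply/measurable_EFinP; apply: measurable_funM => //; exact: measurable_indic.
rewrite integral_cst//= (splitr e) EFinD leeD//.
  rewrite -(fineK mf) -EFinM lee_fin.
  apply: (@le_trans _ _ (e / 2 / (M + 1) * M)); first by rewrite ler_wpM2r.
  rewrite mulrAC ler_pdivrMr ?ltr_wpDl// ler_wpM2l ?lerDl//.
  by rewrite divr_ge0// ltW.
under eq_integral do rewrite EFinM.
rewrite ge0_integralZl//; last first.
  by apply/measurable_EFinP; exact: measurable_indic.
rewrite integral_indic// setIT.
apply: (@le_trans _ _ (`|ratr q|%:E * (e / 2 / (`|ratr q| + 1))%:E)%E).
  by rewrite lee_wpmul2l ?lee_fin//; exact: ltW.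
rewrite -EFinM lee_fin mulrA ler_pdivrMr ?ltr_wpDl// mulrC ler_wpM2l ?lerDl//.
by rewrite divr_ge0// ltW.
Qed.

Lemma rational_step_dense (f : T -> R) : measurable_fun setT f ->
  mu.-integrable setT (EFin \o f) -> forall e : R, 0 < e ->
  exists s, (\int[mu]_y `|f y - rational_step s y|%:E <= e%:E)%E.
Proof.
move=> mf intf e e0; have e20 : 0 < e / 2 by rewrite divr_gt0.
have [g [_ _ gf]] := approximation_sfun_integrable measurableT intf.
have Lg n : L1_approx (g n).
  have -> : (g n : T -> R) = (fun x => \sum_(y \in range (g n)) y * \1_(g n @^-1` [set y]) x).
    by apply/funext => x; rewrite fimfunE.
  under eq_fun do rewrite fsbig_finite//=.
  elim: (finmap.enum_fset _) => [|v s IH].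
    under eq_fun do rewrite big_nil.
    have := @L1_approx_indic 0 setT measurableT.
    by rewrite (_ : (fun y => _) = cst 0)//; apply/funext => y; rewrite mul0r.
  under eq_fun do rewrite big_cons.
  by apply: L1_approxD => //; apply: L1_approx_indic; exact: measurable_funPTI.
have := gf; move=> /fine_cvgP[fin]; move=> /cvgrPdist_lt/(_ _ e20)[N _ HN].
have [N' _ HN'] := fin.
pose n := maxn N N'.
have [s Hs] := (Lg n).2 _ e20; exists s.
have ms := @measurable_rational_step s setT.
have mg : measurable_fun setT (g n) by exact: (Lg n).1.
apply: (@le_trans _ _ (\int[mu]_y (`|f y - g n y|%:E + `|g n y - rational_step s y|%:E))%E).
  apply: ge0_le_integral => //=.
  - by apply/measurable_EFinP; apply: measurableT_comp => //; exact: measurable_funB.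
  - by apply/measurable_EFinP; apply: measurable_funD; apply: measurableT_comp => //;
      exact: measurable_funB.
  - by move=> y _; rewrite -EFinD lee_fin ler_distD.
rewrite ge0_integralD//; last 2 first.
- by apply/measurable_EFinP; apply: measurableT_comp => //; exact: measurable_funB.
- by apply/measurable_EFinP; apply: measurableT_comp => //; exact: measurable_funB.
rewrite (splitr e) EFinD leeD//.
have /= := HN n (leq_maxl _ _); have /= := HN' n (leq_maxr _ _).
move=> finn; rewrite sub0r normrN ger0_norm ?fine_ge0 ?integral_ge0//.
by move=> /ltW; rewrite -lee_fin fineK.
Qed.

End countable_algebra.

Lemma ge0_integral_mrestr {d} {T : measurableType d} {R : realType}
    (mu : {measure set T -> \bar R}) (D C : set T) (mD : measurable D)
    (f : T -> \bar R) : measurable C -> measurable_fun setT f ->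
  (forall x, 0 <= f x)%E ->
  (\int[mrestr mu mD]_(x in C) f x = \int[mu]_(x in C `&` D) f x)%E.
Proof.
move=> mC mf f0.
have mCD : measurable (C `&` D) by exact: measurableI.
have mC'D : measurable (C `\` D) by exact: measurableD.
rewrite -{1}(setUIDK C D) ge0_integral_setU//; last 2 first.
- exact: measurable_funTS.
- by apply/disj_setPS => x [[_ ?] [_]].
rewrite [X in (_ + X)%E]null_set_integral//; last 2 first.
- exact: measurable_funTS.
- change (mu ((C `\` D) `&` D) = 0%E); rewrite (_ : _ `&` _ = set0) ?measure0//.
  by rewrite -subset0 => x [[]].
rewrite adde0; apply: eq_measure_integral => B mB BCD.
by change (mu (B `&` D) = mu B); rewrite setIidl// => x /BCD[].
Qed.

Section kernel_density.
Context {d : measure_display} {T : measurableType d} {R : realType}.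
Variable A : nat -> set T.
Hypothesis Aalg : countable_algebra A.
Notation step := (@rational_step d T R A).

Section one_measure.
Variables (K mu : {measure set T -> \bar R}) (f : T -> R).
Hypotheses (Koo : (K setT < +oo)%E) (muoo : (mu setT < +oo)%E).
Hypotheses (mf : measurable_fun setT f) (f0 : forall x, 0 <= f x).
Hypothesis Kf : forall B, measurable B -> K B = (\int[mu]_(x in B) (f x)%:E)%E.

Let int_f : mu.-integrable setT (EFin \o f).
Proof.
apply/integrableP; split; first exact/measurable_EFinP.
under eq_integral do rewrite /= ger0_norm//.
by rewrite -Kf.
Qed.

Let int_step s : mu.-integrable setT (EFin \o step s).
Proof.
apply: measurable_bounded_integrable => //; first exact: measurable_rational_step.
have [M HM] := @rational_step_bounded _ _ R A s.
exists M%:num; split; first exact: num_real.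
by move=> x Mx y _; apply: le_trans (HM y) (ltW Mx).
Qed.

Let intS (g : T -> R) B : measurable B -> mu.-integrable setT (EFin \o g) ->
  mu.-integrable B (EFin \o g).
Proof. by move=> mB; exact: integrableS. Qed.

Let int_sub s : mu.-integrable setT (EFin \o (f \- step s)).
Proof.
have := integrableB measurableT int_f (int_step s).
by apply: eq_integrable => // x _; rewrite /= EFinB.
Qed.

Let subE s B : measurable B -> fine (K B) - \int[mu]_(x in B) step s x =
  \int[mu]_(x in B) (f x - step s x).
Proof.
by move=> mB; rewrite RintegralB//; [rewrite Kf|exact: intS|exact: intS].
Qed.

Lemma approx_set_of_L1 s (e : R) : (\int[mu]_x `|f x - step s x|%:E <= e%:E)%E ->
  forall i, `|fine (K (A i)) - \int[mu]_(x in A i) step s x| <= e.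
Proof.
have [mA _ _ _] := Aalg => H i; rewrite subE//.
rewrite -lee_fin; apply: le_trans H.
rewrite EFin_normr_Rintegral//; last exact: (intS _ (int_sub s)).
apply: le_trans (le_abse_integral _ _ _) _ => //.
  by apply: measurable_int; apply: (intS _ (int_sub s)).
apply: ge0_subset_integral => //.
by apply: measurable_int; apply: integrable_abse; exact: int_sub.
Qed.

(** The bound extends from the algebra to all measurable sets by approximation. On the set where
    [f - step s] is nonnegative and on its complement the integral of the absolute value is an
    integral of [f - step s] up to sign, whence the factor 2. *)
Lemma L1_of_approx_set s (e : R) :
  (forall i, `|fine (K (A i)) - \int[mu]_(x in A i) step s x| <= e) ->
  (\int[mu]_x `|f x - step s x|%:E <= (2 * e)%:E)%E.
Proof.
have [mA _ _ _] := Aalg => H.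
have ms := @measurable_rational_step _ _ R A Aalg s setT.
have mfs : measurable_fun setT (f \- step s) by exact: measurable_funB.
have [M HM] := @rational_step_bounded _ _ R A s.
have small C : measurable C ->
    (\int[mu]_(x in C) `|f x - step s x|%:E <= K C + M%:num%:E * mu C)%E.
  move=> mC; rewrite Kf// -integral_cst//.
  rewrite -ge0_integralD//=; last 2 first.
  - by move=> x _; rewrite lee_fin.
  - by apply/measurable_EFinP; exact: measurable_funTS.
  apply: ge0_le_integral => //.
  - apply/measurable_EFinP; apply: measurableT_comp => //; exact: measurable_funTS.
  - apply: emeasurable_funD => //; apply/measurable_EFinP; exact: measurable_funTS.
  - move=> x _; rewrite lee_fin; apply: le_trans (ler_normB _ _) _.
    by rewrite lerD// ger0_norm.
(* This finite measure dominates the integral of [|f - step s|] over any set, so approximation with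
   respect to [m] controls the change of the integral. *)
pose m : {measure set T -> \bar R} := measure_add K (mscale M mu).
have mE C : m C = (K C + M%:num%:E * mu C)%E by exact: measure_addE.
have moo : (m setT < +oo)%E.
  by rewrite mE lte_add_pinfty// lte_mul_pinfty.
have U B : measurable B -> `|\int[mu]_(x in B) (f x - step s x)| <= e.
  move=> mB; apply/ler_addgt0Pr => eta eta0.
  have [i Hi] := countable_algebra_approx Aalg moo mB eta0.
  have mAi := mA i.
  have mBA : measurable (B `\` A i) by exact: measurableD.
  have mAB : measurable (A i `\` B) by exact: measurableD.
  have mI : measurable (B `&` A i) by exact: measurableI.
  have E1 : \int[mu]_(x in B) (f x - step s x) = \int[mu]_(x in B `&` A i) (f x - step s x)
     + \int[mu]_(x in B `\` A i) (f x - step s x).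
    rewrite -Rintegral_setU//; first by rewrite setUIDK.
    - by rewrite setUIDK; exact: (intS _ (int_sub s)).
    - by apply/disj_setPS => x [[_ ?] [_]].
  have E2 : \int[mu]_(x in A i) (f x - step s x) = \int[mu]_(x in B `&` A i) (f x - step s x)
     + \int[mu]_(x in A i `\` B) (f x - step s x).
    rewrite setIC -Rintegral_setU//; first by rewrite setUIDK.
    - by rewrite setIC.
    - by rewrite setUIDK; exact: (intS _ (int_sub s)).
    - by apply/disj_setPS => x [[_ ?] [_]].
  have E3 : `|\int[mu]_(x in B `\` A i) (f x - step s x)| +
            `|\int[mu]_(x in A i `\` B) (f x - step s x)| <= eta.
    rewrite -lee_fin EFinD; apply: le_trans (ltW Hi).
    have -> : m (B `+` A i) = (m (B `\` A i) + m (A i `\` B))%E.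
      rewrite setY_def measureU//.
      by rewrite -subset0 => x [[_ nA] [Ax _]]; exact: nA.
    rewrite !mE !EFin_normr_Rintegral//; try exact: (intS _ (int_sub s)).
    by apply: leeD; [apply: le_trans (small _ mBA)|apply: le_trans (small _ mAB)];
      apply: le_abse_integral => //; apply: measurable_int; exact: (intS _ (int_sub s)).
  have := H i; rewrite subE//.
  move: E1 E2 E3.
  set a := \int[mu]_(x in B) _; set b := \int[mu]_(x in A i) _.
  set c := \int[mu]_(x in _ `&` _) _; set p := \int[mu]_(x in B `\` _) _.
  set q := \int[mu]_(x in A i `\` _) _ => -> E2 E3 E4.
  rewrite (_ : c + p = b + (p - q)); last by rewrite E2; ring.
  apply: le_trans (ler_normD _ _) _; rewrite lerD//.
  exact: le_trans (ler_normB _ _) _.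
pose E := [set x | 0 <= f x - step s x].
have mE' : measurable E.
  rewrite (_ : E = (f \- step s) @^-1` `[0, +oo[%classic).
    by rewrite -[X in measurable X]setTI; exact: mfs.
  by apply/seteqP; split => x /=; rewrite in_itv/= andbT.
have mCE := measurableC mE'.
rewrite -(setvU E) setUC ge0_integral_setU//; last 2 first.
- apply/measurable_EFinP; apply: measurableT_comp => //; exact: measurable_funTS.
- by apply/disj_setPS => x [].
rewrite mulrDl !mul1r EFinD leeD//.
- rewrite (eq_integral (fun x => (f x - step s x)%:E)); last first.
    by move=> x; rewrite inE => Ex; rewrite ger0_norm.
  apply: le_trans (lee_abs _) _.
  rewrite -EFin_normr_Rintegral//; last exact: (intS _ (int_sub s)).
  by rewrite lee_fin U.
- rewrite (eq_integral (fun x => - (f x - step s x)%:E)%E); last first.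
    move=> x; rewrite inE => /negP; rewrite -ltNge => /ltW Ex.
    by rewrite ler0_norm.
  rewrite integralN; last first.
    by apply: integrable_add_def => //; exact: (intS _ (int_sub s)).
  apply: le_trans (lee_abs _) _; rewrite abseN.
  rewrite -EFin_normr_Rintegral//; last exact: (intS _ (int_sub s)).
  by rewrite lee_fin U.
Qed.

End one_measure.

Section selection.
Context {d' : measure_display} {S : measurableType d'}.
Variables (K : S -> {measure set T -> \bar R}) (mu : {measure set T -> \bar R}).
Hypothesis muoo : (mu setT < +oo)%E.
Hypothesis mK : forall B, measurable B -> measurable_fun setT (fun x => K x B).

(* Closeness of [K x] and [\int[mu]_(y in _) st j y] on the countably many sets
   [A i] controls the [L^1] distance of [st j] to a density of [K x], so that
   choosing the first good [j] is measurable in [x]. *)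
Let st j : T -> R := step (odflt [::] (unpickle j)).
Let radius (k : nat) : R := 1 / (2 ^ (k + 1))%:R.
Let good k j : set S := [set x | forall i,
  `|fine (K x (A i)) - \int[mu]_(y in A i) st j y| <= radius k].
Let least k j : set S := good k j `\` \bigcup_(i < j) good k i.
Let sel k x := xget 0%N [set j | least k j x].
Let g_ k (z : S * T) : R := st (sel k z.1) z.2.

Let measurable_good k j : measurable (good k j).
Proof.
have [mA _ _ _] := Aalg.
rewrite (_ : good k j = \bigcap_i [set x |
    `|fine (K x (A i)) - \int[mu]_(y in A i) st j y| <= radius k]); last first.
  by apply/seteqP; split => x /= H i; [move=> _|]; exact: H.
apply: bigcapT_measurable => i.
have mh : measurable_fun setT (fun x => `|fine (K x (A i)) - \int[mu]_(y in A i) st j y|).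
  apply: measurableT_comp => //; apply: measurable_funB => //.
  by apply: measurableT_comp => //; exact: mK.
rewrite (_ : [set x | _] = (fun x => `|fine (K x (A i)) - \int[mu]_(y in A i) st j y|) @^-1`
   `]-oo, radius k]%classic); last by apply/seteqP; split => x /=; rewrite in_itv.
by rewrite -[X in measurable X]setTI; exact: mh.
Qed.

Let measurable_least k j : measurable (least k j).
Proof. by apply: measurableD => //; apply: bigcup_measurable. Qed.

Let leastP k x : (exists j, good k j x) -> good k (sel k x) x.
Proof.
move=> [j Hj].
have ex : exists j, asbool (good k j x) by exists j; apply/asboolP.
have [n /asboolP Hn nmin] := ex_minnP ex.
have : least k (sel k x) x.
  apply: (@xgetPex _ 0%N [set j | least k j x]); exists n; split => // -[i /= ltin gi].
  by have := nmin i (asboolT gi); rewrite leqNgt ltin.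
by case.
Qed.

(** [xget] returns [0] where no index is good, which adds a piece to the fibre over [0]. *)
Let selE k j : [set x | sel k x = j] =
  least k j `|` (if j == 0%N then ~` (\bigcup_i least k i) else set0).
Proof.
apply/seteqP; split => x /=.
  move=> <-; have [[i Hi]|H] := pselect (exists i, least k i x).
    by left; apply: (@xgetPex _ 0%N [set j | least k j x]); exists i.
  right; rewrite /sel xgetPN.
    by rewrite eqxx => -[i _ Hi]; apply: H; exists i.
  by move=> i /= Hi; apply: H; exists i.
have uniq i i' : least k i x -> least k i' x -> i = i'.
  move=> [gi ni] [gi' ni']; apply/eqP; rewrite eqn_leq; apply/andP; split.
    by rewrite leqNgt; apply/negP => lt; apply: ni; exists i'.
  by rewrite leqNgt; apply/negP => lt; apply: ni'; exists i.
case=> [Hj|].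
  apply: (uniq _ _ _ Hj); apply: (@xgetPex _ 0%N [set j | least k j x]).
  by exists j.
case: eqP => // -> H; rewrite /sel xgetPN// => i /= Hi.
by apply: H; exists i.
Qed.

Let measurable_g k : measurable_fun setT (g_ k).
Proof.
have mS j : measurable [set x | sel k x = j].
  rewrite selE; apply: measurableU => //; case: eqP => // _.
  by apply: measurableC; exact: bigcupT_measurable.
rewrite (_ : setT = \bigcup_j ([set x | sel k x = j] `*` setT)); last first.
  by apply/seteqP; split => // -[x y] _; exists (sel k x).
apply/measurable_fun_bigcup => j; first exact: measurableX.
apply: (@eq_measurable_fun _ _ _ _ _ (st j \o snd)).
  by move=> -[x y]; rewrite inE => -[/= <- _].
apply: measurable_funTS; apply: measurableT_comp => //.
exact: measurable_rational_step.
Qed.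

(** Each [K x] is only assumed to have some density [f], with no regularity in [x]. The selected
    step functions are within a summable sequence of [L^1] distances of any such [f], hence converge
    to it almost everywhere, and their upper limit is jointly measurable and defined without
    reference to [f]. *)
Lemma kernel_density_finite : exists g : S * T -> \bar R,
  [/\ measurable_fun setT g, forall z, (0 <= g z)%E &
   forall x (f : T -> R), (K x setT < +oo)%E -> measurable_fun setT f -> (forall y, 0 <= f y) ->
     (forall B, measurable B -> K x B = \int[mu]_(y in B) (f y)%:E)%E ->
     forall B, measurable B -> (K x B = \int[mu]_(y in B) g (x, y))%E].
Proof.
pose g (z : S * T) : \bar R := maxe 0%E (limn_esup (fun k => (g_ k z)%:E)).
have mg : measurable_fun setT g.
  apply: measurable_maxe => //; apply: measurable_fun_limn_esup => k.
  by apply/measurable_EFinP; exact: measurable_g.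
exists g; split => // [z|x f Koo mf f0 Kf B mB]; first by rewrite le_max lexx.
have int_f : mu.-integrable setT (EFin \o f).
  apply/integrableP; split; first exact/measurable_EFinP.
  under eq_integral do rewrite /= ger0_norm//.
  by rewrite -Kf.
have r0 k : 0 < radius k by rewrite divr_gt0// ltr0n expn_gt0.
have goodk k : good k (sel k x) x.
  apply: leastP; have [s Hs] := rational_step_dense Aalg muoo mf int_f (r0 k).
  exists (pickle s) => i; rewrite /st pickleK/=.
  exact: (approx_set_of_L1 Koo muoo mf f0 Kf Hs).
have mgx k : measurable_fun setT (fun y => g_ k (x, y)).
  exact: (measurable_fun_pair2 x (measurable_g k)).
have L1 k : (\int[mu]_y `|f y - g_ k (x, y)|%:E <= (2 / (2 ^ (k + 1))%:R)%:E)%E.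
  have := L1_of_approx_set Koo muoo mf f0 Kf (goodk k).
  by rewrite /radius mul1r.
have mh k : measurable_fun setT (fun y => `|f y - g_ k (x, y)|%:E).
  by apply/measurable_EFinP; apply: measurableT_comp => //; exact: measurable_funB.
(* The sum of the errors is integrable, hence finite almost everywhere, and there its terms tend to
   [0]. *)
pose h y := (\sum_(k <oo) `|f y - g_ k (x, y)|%:E)%E.
have mh' : measurable_fun setT h.
  by apply: ge0_emeasurable_sum.
have h0 y : (0 <= h y)%E by apply: nneseries_ge0.
have inth : mu.-integrable setT h.
  apply/integrableP; split => //.
  under eq_integral do rewrite gee0_abs//.
  rewrite integral_nneseries//.
  apply: (@le_lt_trans _ _ (\sum_(k <oo) (2 / (2 ^ (k + 1))%:R)%:E)%E).
    by apply: lee_nneseries => // i _ _; exact: integral_ge0.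
  have := @cvg_geometric_eseries_half R 2 0 => /cvg_lim -> //.
  exact: ltry.
have ae_fin := integrable_ae measurableT inth.
rewrite Kf//; apply: ge0_ae_eq_integral => //.
- exact/measurable_EFinP/measurable_funTS.
- exact: measurable_funTS (measurable_fun_pair2 x mg).
- by move=> y _; rewrite lee_fin.
- by move=> y _; rewrite le_max lexx.
apply: filterS ae_fin => y /(_ I) hfin _.
have hoo : (h y < +oo)%E by rewrite -ge0_fin_numE.
have tail := nneseries_tail_cvg hoo (fun k _ => normr_ge0 (f y - g_ k (x, y))).
have cv : (g_ k (x, y))%:E @[k --> \oo] --> (f y)%:E.
  have : `|f y - g_ k (x, y)|%:E @[k --> \oo] --> 0%E.
    apply: (squeeze_cvge _ (cvg_cst _) tail).
    near=> k; rewrite lee_fin normr_ge0/=.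
    rewrite (nneseries_split k 1)//= addn1 big_nat1 leeDl//.
    exact: nneseries_ge0.
  move=> /fine_cvgP[_ /= H]; apply: cvg_EFin; first exact: nearW.
  apply/cvgrPdist_lt => e e0.
  move/cvgrPdist_lt : H => /(_ _ e0); apply: filterS => k /=.
  by rewrite sub0r normrN normr_id.
have -> : g (x, y) = maxe 0%E (f y)%:E.
  rewrite /g is_cvg_limn_esupE; last by apply/cvg_ex; exists (f y)%:E.
  by rewrite (cvg_lim _ cv).
by apply/esym/max_idPr; rewrite lee_fin.
Unshelve. all: by end_near. Qed.

End selection.
(** The space is cut into disjoint pieces of finite [mu]-measure; the densities obtained on the
    pieces are glued by indicators. *)
Lemma kernel_density {d' : measure_display} {S : measurableType d'}
    (K : S -> {measure set T -> \bar R})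
    (mu : {sigma_finite_measure set T -> \bar R}) :
  (forall B, measurable B -> measurable_fun setT (fun x => K x B)) ->
  exists g : S * T -> \bar R,
  [/\ measurable_fun setT g, forall z, (0 <= g z)%E &
   forall x (f : T -> R), (K x setT < +oo)%E ->
     measurable_fun setT f -> (forall y, 0 <= f y) ->
     (forall B, measurable B -> K x B = \int[mu]_(y in B) (f y)%:E)%E ->
     forall B, measurable B -> (K x B = \int[mu]_(y in B) g (x, y))%E].
Proof.
move=> mK; have [F TF mF] := sigma_finiteT mu.
pose D := seqDU F.
have mD n : measurable (D n).
  by apply: seqDU_measurable => k; have [] := mF k.
have muD n : (mu (D n) < +oo)%E.
  apply: le_lt_trans (mF n).2; apply: le_measure; rewrite ?inE//.
    by have [] := mF n.
  exact: subset_seqDU.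
have UD : \bigcup_n D n = setT by rewrite TF [RHS]seqDU_bigcup_eq.
pose mun n : {measure set T -> \bar R} := mrestr mu (mD n).
pose Kn n x : {measure set T -> \bar R} := mrestr (K x) (mD n).
have munoo n : (mun n setT < +oo)%E by rewrite (_ : mun n setT = mu (setT `&` D n))// setTI.
have mKn n B : measurable B -> measurable_fun setT (fun x => Kn n x B).
  by move=> mB; apply: mK; exact: measurableI.
pose g_ n := sval (cid (kernel_density_finite (munoo n) (mKn n))).
have g_P n := svalP (cid (kernel_density_finite (munoo n) (mKn n))).
pose g z := (\sum_(n <oo) (g_ n z * (\1_(D n) z.2)%:E))%E.
have mgD n : measurable_fun setT (fun z : S * T => (g_ n z * (\1_(D n) z.2)%:E)%E).
  have [mg _ _] := g_P n; apply: emeasurable_funM => //.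
  apply/measurable_EFinP.
  rewrite (_ : (fun z => _) = (\1_(D n) : T -> R) \o snd)//.
  by apply: measurableT_comp => //; exact: measurable_indic.
have gD0 n z : (0 <= g_ n z * (\1_(D n) z.2)%:E)%E.
  by have [_ g0 _] := g_P n; apply: mule_ge0; [exact: g0|rewrite lee_fin].
exists g; split.
- exact: ge0_emeasurable_sum.
- by move=> z; exact: nneseries_ge0.
move=> x f Koo mf f0 Kf B mB.
have mgDx n : measurable_fun setT (fun y : T => (g_ n (x, y) * (\1_(D n) y)%:E)%E).
  exact: (measurable_fun_pair2 x (mgD n)).
rewrite /g integral_nneseries//; last by move=> n; exact: measurable_funTS.
rewrite -[in LHS](setIT B) -UD setI_bigcupr measure_semi_bigcup//; last 3 first.
- by move=> n; exact: measurableI.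
- exact: trivIset_setIl (trivIset_seqDU F).
- by apply: bigcupT_measurable => n; exact: measurableI.
apply: eq_eseriesr => n _.
have [mg g0 gK] := g_P n.
have mBD : measurable (B `&` D n) by exact: measurableI.
have KnE C : measurable C -> Kn n x C = (\int[mun n]_(y in C) (f y)%:E)%E.
  move=> mC; have mCD : measurable (C `&` D n) by exact: measurableI.
  rewrite (_ : Kn n x C = K x (C `&` D n))// Kf// ge0_integral_mrestr//.
  exact/measurable_EFinP.
have Knoo : (Kn n x setT < +oo)%E.
  apply: le_lt_trans Koo; rewrite (_ : Kn n x setT = K x (setT `&` D n))// setTI.
  by apply: le_measure; rewrite ?inE.
have := gK x f Knoo mf f0 KnE B mB.
rewrite (_ : Kn n x B = K x (B `&` D n))// => ->; rewrite ge0_integral_mrestr//.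
- by rewrite integral_mkcondr epatch_indic.
- exact: (measurable_fun_pair2 x mg).
Qed.

End kernel_density.

(* These terms form a countable type and denote the elements of the algebra
   generated by a sequence of sets. *)
Inductive nand_term := Atom of nat | Nand of nand_term & nand_term.

Fixpoint nand_tree t : GenTree.tree nat := match t with
  | Atom n => GenTree.Leaf n
  | Nand t u => GenTree.Node 0%N [:: nand_tree t; nand_tree u]
  end.

Fixpoint tree_nand (t : GenTree.tree nat) : nand_term := match t with
  | GenTree.Leaf n => Atom n
  | GenTree.Node _ [:: t; u] => Nand (tree_nand t) (tree_nand u)
  | _ => Atom 0%N
  end.

Lemma nand_treeK : cancel nand_tree tree_nand.
Proof. by elim => //= t -> u ->. Qed.

Section countable_algebra_exists.
Context {d : measure_display} {T : measurableType d}.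
Variable B : nat -> set T.
Hypotheses (mB : forall i, measurable (B i))
  (genB : forall C : set T, measurable C -> <<s range B >> C).

Let Fixpoint interp t := match t with
  | Atom n => B n
  | Nand t u => ~` (interp t `&` interp u)
  end.

Lemma countable_algebra_exists : exists A, countable_algebra (T := T) A.
Proof.
pose term (n : nat) := tree_nand (odflt (GenTree.Leaf 0%N) (unpickle n)).
have termP t : exists n, term n = t.
  by exists (pickle (nand_tree t)); rewrite /term pickleK/= nand_treeK.
exists (interp \o term); split.
- move=> i /=; elim: (term i) => [n|t mt u mu] //=.
  by apply: measurableC; exact: measurableI.
- move=> i; have [n Hn] := termP (Nand (term i) (term i)).
  by exists n; rewrite /= Hn/= setIid.
- move=> i j.
  have [n Hn] := termP (Nand (Nand (term i) (term i)) (Nand (term j) (term j))).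
  by exists n; rewrite /= Hn/= !setIid setCI !setCK.
- move=> C /genB; apply: sub_smallest2r; first exact: smallest_sigma_algebra.
move=> _ [n _ <-]; have [k Hk] := termP (Atom n).
  by exists k => //=; rewrite Hk.
Qed.

End countable_algebra_exists.

(** * Borel sets and the distance on a separable metric space *)

Section separable_metric.
Context {R : realType} {M : pmetricType R}.

Lemma open_mdist_ball (x : M) (r : R) : open [set y | mdist x y < r].
Proof.
rewrite openE => y /= xy; apply/nbhs_ballP; exists (r - mdist x y) => /=.
  by rewrite subr_gt0.
move=> z; rewrite ballEmdist/= => yz.
by apply: le_lt_trans (metric_triangle x y z) _; rewrite -ltrBrDl.
Qed.

Lemma open_borel (U : set M) : open U -> measurable (U : set (borel M)).
Proof. by move=> oU; exact: sub_sigma_algebra. Qed.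

Hypothesis sepM : separable_space M.

Lemma dense_sequence : exists q : nat -> M,
  forall (x : M) (e : R), 0 < e -> exists n, mdist x (q n) < e.
Proof.
have [S /countable_injP[f finj] dS] := sepM.
exists (fun n => xget point [set x | S x /\ f x = n]) => x e e0.
have [y [xy Sy]] := dS [set y | mdist x y < e]
  ltac:(by exists x; rewrite /= mdistxx) (open_mdist_ball _ _).
exists (f y).
have [Sz fz] := @xgetPex _ point [set x | S x /\ f x = f y] (ex_intro _ y (conj Sy erefl)).
by rewrite (finj _ _ _ _ fz)// inE.
Qed.

Lemma borel_countable_algebra :
  exists A, countable_algebra (T := borel M) A.
Proof.
have [q Hq] := dense_sequence.
pose B (i : nat) : set M := if unpickle i is Some (n, k) then
  [set y | mdist (q n) y < (k.+1%:R)^-1] else set0.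
have oB i : open (B i).
  rewrite /B; case: unpickle => [[n k]|]; first exact: open_mdist_ball.
  exact: open0.
apply: (@countable_algebra_exists _ _ (B : nat -> set (borel M))).
  by move=> i; exact: open_borel.
apply: smallest_sub; first exact: smallest_sigma_algebra.
move=> U oU.
have -> : U = \bigcup_(i in [set i | B i `<=` U]) B i.
  apply/seteqP; split => [x Ux|x [i /= BU Bx]]; last exact: BU.
  have /nbhs_ballP[e /= e0 xeU] : nbhs x U by apply: open_nbhs_nbhs.
  have e20 : 0 < e / 2 by rewrite divr_gt0.
  have [k Hk] : exists k : nat, (k.+1%:R)^-1 < e / 2.
    exists (Num.truncn (e / 2)^-1); rewrite invf_plt ?posrE//.
    exact: truncnS_gt.
  have [n Hn] := Hq x k.+1%:R^-1 ltac:(by rewrite invr_gt0).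
  exists (pickle (n, k)); rewrite /= /B pickleK/=; last by rewrite metric_sym.
  move=> y /= qy; apply: xeU; rewrite ballEmdist/=.
  apply: le_lt_trans (metric_triangle x (q n) y) _.
  by rewrite (splitr e) ltrD// (lt_trans _ Hk).
rewrite bigcup_mkcond.
apply: sigma_algebra_bigcup => i; case: ifPn => _.
  by apply: sub_sigma_algebra; exists i.
by have [] := @smallest_sigma_algebra _ setT (range B).
Qed.

Lemma measurable_mdistr (x : M) : measurable_fun setT (fun y : borel M => mdist x y).
Proof.
move=> mT; apply: (measurability _ (RGenInftyO.measurableE R)) => //.
move=> /= _ [_ [a ->]] <-; rewrite setTI.
apply: open_borel; rewrite (_ : _ @^-1` _ = [set y | mdist x y < a]).
  exact: open_mdist_ball.
by apply/seteqP; split => y /=; rewrite in_itv.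
Qed.

(** Measurability is needed for the product of the Borel sigma-fields, so openness in the product
    space is not enough. By density, [mdist x y < a] iff [mdist (q n) x + mdist (q n) y < a] for
    some [n]. *)
Lemma measurable_mdist :
  measurable_fun setT (fun z : borel M * borel M => mdist z.1 z.2).
Proof.
have [q Hq] := dense_sequence.
move=> mT; apply: (measurability _ (RGenInftyO.measurableE R)) => //.
move=> /= _ [_ [a ->]] <-; rewrite setTI.
rewrite (_ : _ @^-1` _ = \bigcup_n
   (fun z => mdist (q n) z.1 + mdist (q n) z.2) @^-1` `]-oo, a[%classic).
  apply: bigcupT_measurable => n; rewrite -[X in measurable X]setTI.
  have mf : measurable_fun setT
      (fun z : borel M * borel M => mdist (q n) z.1 + mdist (q n) z.2).
    apply: measurable_funD.
      exact: (measurableT_comp (measurable_mdistr (q n)) measurable_fst).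
    exact: (measurableT_comp (measurable_mdistr (q n)) measurable_snd).
  by apply: mf.
apply/seteqP; split => -[x y] /=; rewrite in_itv/=.
  move=> xya; have e0 : 0 < (a - mdist x y) / 2 by rewrite divr_gt0// subr_gt0.
  have [n Hn] := Hq x _ e0; exists n => //=; rewrite in_itv/=.
  have := metric_triangle (q n) x y; rewrite (metric_sym (q n) x).
  lra.
move=> [n _ /=]; rewrite in_itv/=; apply: le_lt_trans.
by rewrite (metric_sym (q n) x) metric_triangle.
Qed.

End separable_metric.

Section one_point.
Context {M : ptopologicalType}.

Lemma measurable_some :
  measurable_fun setT (Some : borel M -> borel M^Delta).
Proof.
move=> mT; apply: (@measurability _ _ _ (borel M^Delta) _ _ (@open M^Delta) erefl) => //.
move=> _ [U oU <-]; rewrite setTI; apply: sub_sigma_algebra.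
have := @one_point_compactification_some_continuous M.
by move=> /continuousP/(_ U oU).
Qed.

Lemma measurable_some_image (A : set (borel M)) : measurable A ->
  measurable (Some @` A : set (borel M^Delta)).
Proof.
pose G : set (set M) := [set A | measurable (Some @` A : set (borel M^Delta))].
suff : <<s (@open M) >> `<=` G by apply.
have mT : G setT.
  apply: sub_sigma_algebra; apply: one_point_compactification_open_some.
  exact: openT.
apply: smallest_sub; last first.
  move=> U oU; apply: sub_sigma_algebra.
  exact: one_point_compactification_open_some.
split.
- by rewrite /G /= image_set0; exact: measurable0.
- move=> B GB; rewrite /G/=.
  rewrite (_ : Some @` (setT `\` B) = Some @` setT `\` Some @` B).
    exact: (@measurableD _ (borel M^Delta)).
  apply/seteqP; split => x /=.
    by move=> [y [_ nBy] <-]; split; [exists y|case=> z Bz [yz]; apply: nBy; rewrite -yz].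
  by move=> [[y _ <-] nBy]; exists y => //; split => // By; apply: nBy; exists y.
- move=> F GF; rewrite /G/= image_bigcup.
  exact: (@bigcupT_measurable _ (borel M^Delta)).
Qed.

End one_point.

(** * Paths on dyadic grids *)

Section real_path.
Context {R : realType} {M : pmetricType R}.
Implicit Types (Y : R -> M) (U : set M).

Lemma continuous_mdistP Y : continuous Y <->
  forall u e, 0 < e -> exists2 dl, 0 < dl &
    forall v, `|v - u| < dl -> mdist (Y u) (Y v) < e.
Proof.
split => [cY u e e0|H u].
  have : nbhs (Y u) (ball (Y u) e) by exact: nbhsx_ballx.
  move=> /(cY u)/nbhs_ballP[dl /= dl0 H]; exists dl => // v uv.
  have := H v; rewrite !ballEmdist/=; apply.
  by rewrite /mdist/= /ball/= distrC in uv *.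
move=> P /nbhs_ballP[e /= e0 eP]; have [dl dl0 Hdl] := H u e e0.
apply/nbhs_ballP; exists dl => //= v; rewrite /ball/= distrC => uv.
by apply: eP; rewrite ballEmdist; exact: Hdl.
Qed.

(** Dyadic subdivision. Level [m] sits inside level [m.+1] through the index [2 * j], which makes
    events tested on the grid monotone in [m]. *)
Definition grid (s t : R) (m j : nat) : R := s + (t - s) * (j%:R / 2 ^+ m).

Lemma grid_itv s t m j : s <= t -> (j <= 2 ^ m)%N ->
  s <= grid s t m j <= t.
Proof.
move=> st jm; have jm' : j%:R / 2 ^+ m <= 1 :> R.
  by rewrite ler_pdivrMr ?exprn_gt0// mul1r -natrX ler_nat.
rewrite /grid lerDl mulr_ge0 ?subr_ge0 ?divr_ge0 ?exprn_ge0//=.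
by rewrite -lerBrDl ler_piMr ?subr_ge0.
Qed.

Lemma grid_dense s t u dl : s <= u <= t -> 0 < dl ->
  exists m j, (j <= 2 ^ m)%N /\ `|grid s t m j - u| < dl.
Proof.
move=> /andP[su ut] dl0; have st : s <= t by exact: le_trans ut.
have [m Hm] : exists m : nat, t - s < dl * 2 ^+ m.
  exists (Num.truncn ((t - s) / dl)).+1.
  rewrite mulrC -ltr_pdivrMr//; apply: lt_trans (truncnS_gt _) _.
  by rewrite -natrX ltr_nat ltn_expl.
have p0 : 0 < 2 ^+ m :> R by rewrite exprn_gt0.
have [ts|ts] := eqVneq t s.
  exists 0%N, 0%N; split => //; rewrite /grid ts subrr mul0r addr0.
  have -> : u = s by apply/eqP; rewrite eq_le su -{1}ts ut.
  by rewrite subrr normr0.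
have {}ts : 0 < t - s by rewrite subr_gt0 lt_neqAle eq_sym ts.
pose x := (u - s) / (t - s) * 2 ^+ m.
have x0 : 0 <= x by rewrite mulr_ge0 ?divr_ge0 ?subr_ge0// ltW.
have x1 : x <= (2 ^ m)%:R.
  rewrite natrX ler_piMl// ?(ltW p0)// ler_pdivrMr// mul1r.
  by rewrite lerD2r.
pose j := Num.truncn x.
have /andP[jx xj] : j%:R <= x < j.+1%:R by exact: truncn_itv.
exists m, j; split.
  by rewrite -(ler_nat R) (le_trans jx).
rewrite /grid (_ : _ - u = - ((t - s) / 2 ^+ m * (x - j%:R))).
  rewrite normrN ger0_norm; last first.
    by rewrite mulr_ge0 ?divr_ge0 ?subr_ge0 ?(ltW ts) ?(ltW p0).
  apply: (@le_lt_trans _ _ ((t - s) / 2 ^+ m * 1)).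
    rewrite ler_pM2l ?divr_gt0// lerBlDr ltW//.
    by rewrite -natr1 addrC in xj.
  by rewrite mulr1 ltr_pdivrMr.
by rewrite /x; field; rewrite !gt_eqF.
Qed.

(** Points at distance at least [1 / (n + 1)] from the complement of [U]: closed sets, increasing in
    [n], that exhaust [U] when it is open. *)
Definition core U (n : nat) : set M :=
  [set x | [set y | mdist x y < n.+1%:R^-1] `<=` U].

Lemma core_sub U n : core U n `<=` U.
Proof. by move=> x; apply; rewrite /= mdistxx. Qed.

Lemma core_mono U n m : (n <= m)%N -> core U n `<=` core U m.
Proof.
move=> nm x Ux y /= xy; apply: Ux; apply: lt_le_trans xy _.
by rewrite lef_pV2 ?posrE// ler_nat.
Qed.

Lemma measurable_core U n : measurable (core U n : set (borel M)).
Proof.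
rewrite -[core U n]setCK; apply: measurableC; apply: open_borel.
rewrite (_ : ~` _ = \bigcup_(y in ~` U) [set x | mdist y x < n.+1%:R^-1]).
  by apply: bigcup_open => y _; exact: open_mdist_ball.
apply/seteqP; split => x /=.
  by move=> /existsNP[y /not_implyP[xy nUy]]; exists y => //=; rewrite metric_sym.
by move=> [y nUy yx] /(_ y); apply/not_implyP; split => //=; rewrite metric_sym.
Qed.

Lemma path_in_core Y U s t : continuous Y -> open U ->
  (forall u, s <= u <= t -> U (Y u)) ->
  exists n, forall u, s <= u <= t -> core U n (Y u).
Proof.
move=> /continuous_mdistP cY oU YU.
have /compact_near_coveringP cpt := @segment_compact R s t.
pose P (n : nat) (u : R) := s <= u <= t -> core U n (Y u).
suff [n _ Hn] : \forall n \near \oo, `[s, t] `<=` P n.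
  by exists n => u sut; apply: (Hn n (leqnn n)) => //=; rewrite in_itv.
apply: cpt => u /=; rewrite in_itv/= => sut.
have /nbhs_ballP[e /= e0 eU] : nbhs (Y u) U by apply: open_nbhs_nbhs; split => //; exact: YU.
have e20 : 0 < e / 2 by rewrite divr_gt0.
have [dl dl0 Hdl] := cY u _ e20.
exists ([set v | `|v - u| < dl], [set n | (n.+1%:R)^-1 < e / 2]).
  split => /=.
    apply/nbhs_ballP; exists dl => //= v; rewrite /ball/= distrC//.
  exists (Num.truncn (e / 2)^-1) => // n /= Hn.
  rewrite invf_plt ?posrE//; apply: lt_le_trans (truncnS_gt _) _.
  by rewrite ler_nat.
move=> [v n] /= [vu Hn] _ y /= vy; apply: eU; rewrite ballEmdist/=.
apply: le_lt_trans (metric_triangle _ (Y v) _) _.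
by rewrite (splitr e) ltrD// ?Hdl// (lt_trans vy).
Qed.

Lemma grid_in_core Y U n s t : continuous Y ->
  (forall m j, (j <= 2 ^ m)%N -> core U n (Y (grid s t m j))) ->
  forall u, s <= u <= t -> core U n (Y u).
Proof.
move=> /continuous_mdistP cY H u sut y /= uy.
have e0 : 0 < n.+1%:R^-1 - mdist (Y u) y by rewrite subr_gt0.
have [dl dl0 Hdl] := cY u _ e0.
have [m [j [jm Hj]]] := grid_dense sut dl0.
apply: (H m j jm) => /=; have := Hdl _ Hj.
have := metric_triangle (Y (grid s t m j)) (Y u) y.
rewrite (metric_sym _ (Y u)) => h1 h2; apply: le_lt_trans h1 _.
by rewrite -ltrBrDr.
Qed.

(** The distance to [y0] takes the middle value [(lo + hi) / 2] at some time, and by continuity it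
    stays strictly between [lo] and [hi] at all close times, one of which is on the grid. *)
Lemma grid_crossing Y (y0 : M) a b u0 lo hi : continuous Y ->
  a <= u0 <= b -> hi <= mdist y0 (Y u0) -> mdist y0 (Y b) <= lo -> lo < hi ->
  exists m j, (j <= 2 ^ m)%N /\ lo < mdist y0 (Y (grid a b m j)) < hi.
Proof.
move=> /continuous_mdistP cY /andP[au0 u0b] h1 h2 lohi.
pose f u := mdist y0 (Y u).
have fY u v : `|f u - f v| <= mdist (Y u) (Y v).
  have := metric_triangle y0 (Y u) (Y v).
  have := metric_triangle y0 (Y v) (Y u).
  rewrite /f (metric_sym (Y v)) ler_norml; lra.
have cf : continuous f.
  move=> u; apply/cvgrPdist_lt => e e0; have [dl dl0 Hdl] := cY u e e0.
  apply/nbhs_ballP; exists dl => //= v; rewrite /ball/= distrC => uv.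
  by apply: le_lt_trans (fY _ _) _; exact: Hdl.
pose mid := (lo + hi) / 2.
have [|v] := @IVT R f u0 b mid u0b (continuous_subspaceT cf).
  rewrite ge_min le_max; apply/andP; split; apply/orP; [right|left].
    by apply: le_trans h2 _; rewrite /mid; lra.
  by apply: le_trans _ h1; rewrite /mid; lra.
rewrite in_itv/= => /andP[u0v vb] fv.
have e0 : 0 < (hi - lo) / 2 by lra.
have [dl dl0 Hdl] := cY v _ e0.
have avb : a <= v <= b by rewrite vb (le_trans au0 u0v).
have [m [j [jm Hj]]] := grid_dense avb dl0.
exists m, j; split => //.
have := fY v (grid a b m j); have := Hdl _ Hj.
rewrite /f in fv *; rewrite fv /mid ler_norml; lra.
Qed.

End real_path.

Section process_path.
Context {R : realType} {M : pmetricType R} {d : measure_display}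
  {Omega : measurableType d}.
Variable H : hunt_process M Omega.
Notation X := (hunt_X H).

Lemma alive_before w t u : X t%:E w <> None -> 0 <= u -> u <= t ->
  X u%:E w <> None.
Proof.
move=> Xt u0 ut Xu; apply: Xt; apply: hunt_cemetery.
apply: (@le_trans _ _ u%:E); last by rewrite lee_fin.
by apply: ereal_inf_lbound; exists u.
Qed.

Lemma alive_lt_life_time w t : X t%:E w <> None -> (t%:E < life_time X w)%E.
Proof. by move=> Xt; rewrite ltNge; apply/negP => /hunt_cemetery. Qed.

(** Freezing the path before [0] and after [t], by clamping the time, gives a continuous path with
    values in [M] on the whole line. The default value [point] is never reached. *)
Lemma alive_path w t : continuous_path H w -> 0 <= t -> X t%:E w <> None ->
  exists2 Y : R -> M, continuous Y &
    forall u, 0 <= u <= t -> X u%:E w = Some (Y u).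
Proof.
move=> cw t0 Xt.
pose cl u : R := Num.max 0 (Num.min u t).
pose Y u := odflt point (X (cl u)%:E w).
have cl0 u : 0 <= cl u by rewrite le_max lexx.
have clt u : cl u <= t by rewrite ge_max t0 ge_min lexx orbT.
have clE u : 0 <= u <= t -> cl u = u.
  by move=> /andP[u0 ut]; rewrite /cl (min_idPl ut) (max_idPr u0).
have XY u : X (cl u)%:E w = Some (Y u).
  by have := alive_before Xt (cl0 u) (clt u); rewrite /Y; case: (X _ _).
have cldist u v : `|cl u - cl v| <= `|u - v|.
  rewrite /cl /Num.max /Num.min; do ! case: ifPn; rewrite -?leNgt => *;
  rewrite ler_norml; (have [|] := leP 0 (u - v) => ?;
   [rewrite ger0_norm//|rewrite ltr0_norm//]); lra.
have Dcl u : [set t : R | 0 <= t /\ (t%:E < life_time X w)%E] (cl u).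
  split => //; apply: alive_lt_life_time.
  by rewrite XY.
exists Y; last by move=> u ut; rewrite -XY clE.
apply/continuous_mdistP => u e e0.
have /one_point_compactification_some_nbhs N : nbhs (Y u) (ball (Y u) e).
  exact: nbhsx_ballx.
rewrite -XY in N.
have : nbhs_subspace (A := [set t : R | 0 <= t /\ (t%:E < life_time X w)%E]) (cl u)
  [set v | (Some @` ball (Y u) e) (X v%:E w)] := cw (cl u) _ N.
rewrite -nbhs_subspace_in// => /nbhs_ballP[dl /= dl0 Hdl].
exists dl => // v uv.
have /Hdl /(_ (Dcl v)) : ball (cl u) dl (cl v).
  by rewrite /ball/=; apply: le_lt_trans (cldist _ _) _; rewrite distrC.
by move=> [y]; rewrite ballEmdist/= XY => uy [<-].
Qed.

(** The inequality is strict because right-continuity keeps the path in the open set for some time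
    after [s]. *)
Lemma exit_time_gt w U s : open U -> 0 <= s ->
  (forall u, 0 <= u <= s -> (Some @` U) (X u%:E w)) ->
  (s%:E < exit_time X U w)%E.
Proof.
move=> oU s0 XU; have [x Ux xX] := XU s ltac:(by rewrite s0 lexx).
have : nbhs (X s%:E w) (Some @` U).
  rewrite -xX; apply: one_point_compactification_some_nbhs.
  exact: open_nbhs_nbhs.
move=> /(@hunt_right_continuous _ _ _ _ H w s s0)/nbhs_ballP[dl /= dl0 Hdl].
apply: (@lt_le_trans _ _ (s + dl)%:E); first by rewrite lte_fin ltrDl.
apply/ereal_infP => _ [u [u0 nXu] <-]; rewrite lee_fin leNgt; apply/negP => us.
apply: nXu; have [us'|su] := leP u s; first by apply: XU; rewrite u0.
by apply: Hdl; rewrite // /ball/= ltr_norml; lra.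
Qed.

Lemma exit_time_le w (B : set M) s u : 0 <= u -> u <= s ->
  ~ (Some @` B) (X u%:E w) -> (exit_time X B w <= s%:E)%E.
Proof.
move=> u0 us nX; apply: (@le_trans _ _ u%:E); last by rewrite lee_fin.
by apply: ereal_inf_lbound; exists u.
Qed.

(** The event [B] may be non-measurable, as events defined by exit times are; the completion is an
    outer measure, so monotonicity suffices once a null set is removed from [A]. *)
Lemma le_completed_prob x (A B : set Omega) (C : Omega -> Prop) :
  measurable A -> {ae hunt_P H (Some x), forall w, C w} ->
  (forall w, A w -> C w -> B w) -> (hunt_P H (Some x) A <= completed_prob H x B)%E.
Proof.
move=> mA [N [mN N0 CN]] AB.
rewrite (_ : hunt_P H (Some x) A = hunt_P H (Some x) (A `\` N)).
  rewrite -measurable_mu_extE; last exact: measurableD.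
  apply: le_mu_ext => w [Aw Nw]; apply: AB => //.
  by apply: contrapT => nC; apply: Nw; exact: CN.
rewrite -[X in _ = X]adde0; have mI : measurable (A `&` N) by exact: measurableI.
have mD : measurable (A `\` N) by exact: measurableD.
rewrite -[X in hunt_P H (Some x) X = _](setUIDK A N) measureU//.
  rewrite addeC; congr (_ + _)%E; apply/eqP; rewrite eq_le measure_ge0 andbT -N0.
  by apply: le_measure; rewrite ?inE.
by rewrite -subset0 => w [[_ ?] [_]].
Qed.

End process_path.

(** * The Markov property *)

Section mixture.
Local Open Scope ereal_scope.
Context {d d' : measure_display} {S : measurableType d} {T : measurableType d'}
  {R : realType}.
Variables (m : {measure set S -> \bar R}) (B : set S).
Hypothesis mB : measurable B.

Let mixture_nnsfun (l : S -> {measure set T -> \bar R}) (f : {nnsfun T >-> R}) :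
  (forall A, measurable A -> measurable_fun setT (fun x => l x A)) ->
  \int[m]_(x in B) \int[l x]_y (f y)%:E =
  \sum_(r \in range f) r%:E * \int[m]_(x in B) l x (f @^-1` [set r]).
Proof.
move=> ml.
transitivity (\int[m]_(x in B) \sum_(r \in range f) (r%:E * l x (f @^-1` [set r]))).
  apply: eq_integral => x _.
  under eq_integral do rewrite fimfunE -fsumEFin//.
  rewrite ge0_integral_fsum//; last 2 first.
  - by move=> r; exact/measurable_EFinP/measurableT_comp.
  - by move=> r z _; rewrite EFinM nnfun_muleindic_ge0.
  apply: eq_fsbigr => r _.
  rewrite (integralZl_indic _ (fun r => f @^-1` [set r]))//; last first.
    by move=> r0; rewrite preimage_nnfun0.
  by rewrite integral_indic// setIT.
rewrite ge0_integral_fsum//; last 2 first.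
- move=> r; apply: measurable_funeM; apply: measurable_funTS; exact: ml.
- move=> r x _; have := mulemu_ge0 (fun n => f @^-1` [set n]).
  by apply; exact: preimage_nnfun0.
apply: eq_fsbigr => r _.
have [r0|r0] := leP 0%R r.
  rewrite ge0_integralZl//.
  by apply: measurable_funTS; exact: ml.
rewrite (_ : (fun x => l x _) = cst 0); last first.
  by apply/funext => x; rewrite preimage_nnfun0// measure0.
rewrite integral0 mule0 integral0_eq// => x _.
by rewrite preimage_nnfun0// measure0 mule0.
Qed.

Let mixture_lim (l : S -> {measure set T -> \bar R}) (f : T -> \bar R)
    (mf : measurable_fun setT f) :
  (forall A, measurable A -> measurable_fun setT (fun x => l x A)) ->
  (forall y, 0 <= f y) ->
  \int[m]_(x in B) \int[l x]_y f y =
  lim (\int[m]_(x in B) \int[l x]_y (nnsfun_approx measurableT mf n y)%:E @[n --> \oo]).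
Proof.
move=> ml f0; pose f_ := nnsfun_approx measurableT mf.
have mf_ n : measurable_fun setT (fun y => (f_ n y)%:E).
  exact/measurable_EFinP.
have f_0 n y : 0 <= (f_ n y)%:E by rewrite lee_fin.
have ndf y : {homo (fun n => (f_ n y)%:E) : a b / (a <= b)%N >-> a <= b}.
  by move=> a b ab; rewrite lee_fin; exact/lefP/nd_nnsfun_approx.
rewrite -monotone_convergence//; last 3 first.
- move=> n; apply: measurable_funTS.
  exact: (@measurable_fun_integral_kernel _ _ _ _ _ l).
- by move=> n x _; exact: integral_ge0.
- by move=> x _ a b ab; apply: ge0_le_integral => // y _; exact: ndf.
apply: eq_integral => x _; rewrite -monotone_convergence//.
by apply: eq_integral => y _; apply/esym/cvg_lim => //; exact: cvg_nnsfun_approx.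
Qed.

(** Agreement on sets passes to simple functions by linearity and to nonnegative functions by
    monotone convergence. *)
Lemma eq_mixture (l1 l2 : S -> {measure set T -> \bar R}) (f : T -> \bar R) :
  (forall A, measurable A -> measurable_fun setT (fun x => l1 x A)) ->
  (forall A, measurable A -> measurable_fun setT (fun x => l2 x A)) ->
  (forall A, measurable A ->
     \int[m]_(x in B) l1 x A = \int[m]_(x in B) l2 x A) ->
  measurable_fun setT f -> (forall y, 0 <= f y) ->
  \int[m]_(x in B) \int[l1 x]_y f y = \int[m]_(x in B) \int[l2 x]_y f y.
Proof.
move=> ml1 ml2 l12 mf f0; rewrite !(mixture_lim mf)//.
apply: congr_lim; apply/funext => n; rewrite !mixture_nnsfun//.
by apply: eq_fsbigr => r _; rewrite l12.
Qed.

End mixture.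

Section markov.
Context {R : realType} {M : pmetricType R} {d : measure_display}
  {Omega : measurableType d}.
Variable H : hunt_process M Omega.
Notation X := (hunt_X H).
Notation P := (hunt_P H).
Local Open Scope ereal_scope.

Lemma measurable_hunt (t : R) (A : set (borel M^Delta)) : (0 <= t)%R ->
  measurable A -> measurable (X t%:E @^-1` A).
Proof.
move=> t0 mA; rewrite -[X in measurable X]setTI.
by apply: (hunt_measurable H); rewrite ?lee_fin.
Qed.

(** The singleton of the cemetery is measurable, so the value at [None] is irrelevant to
    measurability. *)
Lemma measurable_fun_option (f : M^Delta -> \bar R) :
  measurable_fun setT (fun x : borel M => f (Some x)) ->
  measurable_fun setT (f : borel M^Delta -> \bar R).
Proof.
move=> mf _ B mB; rewrite setTI.
have mS (C : set M^Delta) : C `<=` [set None] -> measurable (C : set (borel M^Delta)).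
  have mN : measurable ([set None] : set (borel M^Delta)).
    rewrite (_ : [set None] = ~` (Some @` [set: M])).
      apply: measurableC; apply: measurable_some_image; exact: measurableT.
    by apply/seteqP; split => [_ -> [y]//|[y|//] []]; exists y.
  move=> /subset_set1[]-> //; exact: measurable0.
rewrite (_ : f @^-1` B = (Some @` ((fun x => f (Some x)) @^-1` B)) `|`
    (f @^-1` B `&` [set None])).
  apply: measurableU; last by apply: mS; exact: subIsetr.
  by apply: measurable_some_image; rewrite -[X in measurable X]setTI; exact: mf.
apply/seteqP; split => [[x|]|x].
- by left; exists x.
- by right.
- by case=> [[y ? <-]|[]].
Qed.

(* [hunt_X] is only meaningful at nonnegative times; the absolute value makes
   [law] a measure for all [t : R]. *)
Definition law (t : R) (e : M^Delta) (A : set (borel M^Delta)) : \bar R :=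
  P e (X `|t|%:E @^-1` A).

Section law_measure.
Variables (t : R) (e : M^Delta).

Let law0 : law t e set0 = 0.
Proof. by rewrite /law preimage_set0 measure0. Qed.

Let law_ge0 A : 0 <= law t e A.
Proof. exact: measure_ge0. Qed.

Let law_sigma_additive : semi_sigma_additive (law t e).
Proof.
move=> F mF tF mUF; rewrite /law preimage_bigcup.
apply: measure_semi_sigma_additive.
- by move=> n; exact: measurable_hunt.
- apply/trivIsetP => /= i j _ _ ij; rewrite -preimage_setI.
  by move/trivIsetP : tF => /(_ _ _ _ _ ij) ->//; rewrite preimage_set0.
- by rewrite -preimage_bigcup; exact: measurable_hunt.
Qed.

HB.instance Definition _ := isMeasure.Build _ _ _ (law t e)
  law0 law_ge0 law_sigma_additive.

End law_measure.

Lemma lawT t e : law t e setT = 1.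
Proof. by rewrite /law preimage_setT probability_setT. Qed.

(** The kernel axiom covers subsets of [M] only. A set containing the cemetery is treated through
    its complement, the total mass being [1]. *)
Lemma measurable_law t (A : set (borel M^Delta)) : measurable A ->
  measurable_fun setT (fun e : borel M^Delta => law t e A).
Proof.
move=> mA; apply: measurable_fun_option.
pose A' : set M := Some @^-1` A.
have mA' : measurable (A' : set (borel M)).
  by rewrite -[X in measurable X]setTI; exact: measurable_some.
have h B : measurable (B : set (borel M)) ->
    measurable_fun setT (fun x : borel M => law t (Some x) (Some @` B)).
  by move=> mB; exact: (hunt_kernel H).
have [AN|AN] := pselect (A None).
  rewrite (_ : (fun x => _) = fun x : borel M => 1 - law t (Some x) (Some @` (~` A'))).
    apply: emeasurable_funB => //; apply: h; exact: measurableC.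
  apply/funext => x.
  have mCA : measurable (Some @` (~` A') : set (borel M^Delta)).
    by apply: measurable_some_image; exact: measurableC.
  rewrite (_ : A = ~` (Some @` (~` A'))); last first.
    apply/seteqP; split => [[y|] Ay|[y|] //].
    - by move=> [z nz [zy]]; apply: nz; rewrite zy.
    - by case.
    - by move=> Hy; apply: contrapT => nA; apply: Hy; exists y.
  rewrite /law preimage_setC probability_setC//.
  exact: (measurable_hunt (normr_ge0 t) mCA).
rewrite (_ : A = Some @` A'); first exact: h.
apply/seteqP; split => [[y|] Ay //|_ [y Ay <-]//].
by exists y.
Qed.

Lemma natural_filtration_sub s t : s <= t ->
  natural_filtration X s `<=` natural_filtration X t.
Proof.
move=> st; apply: sub_smallest2r; first exact: smallest_sigma_algebra.
move=> A [u [B [/andP[u0 us] mB] ->]].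
by exists u, B => //; split => //; rewrite u0 (le_trans us).
Qed.

Lemma natural_filtration_event (s t : R) (A : set (borel M^Delta)) :
  (0 <= s)%R -> (s <= t)%R -> measurable A ->
  natural_filtration X t%:E (X s%:E @^-1` A).
Proof.
move=> s0 st mA; apply: sub_sigma_algebra; exists s%:E, A => //.
by rewrite !lee_fin s0 st.
Qed.

Lemma natural_filtration_measurable t : natural_filtration X t `<=` measurable.
Proof.
apply: smallest_sub; first exact: sigma_algebra_measurable.
move=> A [u [B [/andP[u0 us] mB] ->]].
by rewrite -[X in measurable X]setTI; apply: (hunt_measurable H).
Qed.

Lemma natural_filtration_sigma t : sigma_algebra setT (natural_filtration X t).
Proof. exact: smallest_sigma_algebra. Qed.

Lemma natural_filtration_bigcup t (F : nat -> set Omega) :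
  (forall n, natural_filtration X t (F n)) ->
  natural_filtration X t (\bigcup_n F n).
Proof. by have [_ _] := natural_filtration_sigma t; apply. Qed.

Lemma natural_filtrationC t A : natural_filtration X t A ->
  natural_filtration X t (~` A).
Proof. by have [_ + _] := natural_filtration_sigma t; rewrite -setTD; apply. Qed.

Lemma natural_filtrationI t A B : natural_filtration X t A ->
  natural_filtration X t B -> natural_filtration X t (A `&` B).
Proof.
move=> /natural_filtrationC FA /natural_filtrationC FB.
rewrite -(setCK (A `&` B)) setCI; apply: natural_filtrationC.
rewrite -bigcup2E; apply: natural_filtration_bigcup => -[|[|n]] //=.
by have [] := natural_filtration_sigma t.
Qed.

(** The Markov property says that the Dirac masses at [X (t + s)] and the laws started at [X t] have
    the same mixture over [B]; [eq_mixture] then carries it from sets to functions. *)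
Lemma markov_integral (s t : R) (e : M^Delta) (B : set Omega)
    (f : M^Delta -> \bar R) :
  (0 <= s)%R -> (0 <= t)%R -> natural_filtration X t%:E B ->
  measurable_fun setT (f : borel M^Delta -> \bar R) -> (forall y, 0 <= f y) ->
  \int[P e]_(w in B) f (X (t + s)%:E w) =
  \int[P e]_(w in B) \int[law s (X t%:E w)]_y f y.
Proof.
move=> s0 t0 FB mf f0; have mB := natural_filtration_measurable FB.
have ts0 : (0 <= t + s)%R by rewrite addr_ge0.
transitivity (\int[P e]_(w in B) \int[\d_(X (t + s)%:E w : borel M^Delta)]_y f y).
  by apply: eq_integral => w _; rewrite integral_dirac// diracT mul1e.
apply: (@eq_mixture _ _ Omega (borel M^Delta) R (P e) B mB
  (fun w => \d_(X (t + s)%:E w : borel M^Delta)) (fun w => law s (X t%:E w))) => //.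
- move=> A mA; apply/measurable_EFinP.
  rewrite (_ : (fun x => _) = \1_(X (t + s)%:E @^-1` A)).
    by apply: measurable_indic; exact: measurable_hunt.
  by apply/funext => w; rewrite /= indicE.
- move=> A mA.
  have : measurable_fun setT (X t%:E : Omega -> borel M^Delta).
    by apply: (hunt_measurable H); rewrite lee_fin.
  exact: (measurableT_comp (measurable_law s mA)).
- move=> A mA; have := @hunt_markov _ _ _ _ H s t e A B s0 t0 mA FB.
  have -> : \int[P e]_(x in B) law s (X t%:E x) A =
      \int[P e]_(x in B) P (X t%:E x) (X s%:E @^-1` A).
    by apply: eq_integral => w _; rewrite /law ger0_norm.
  move=> <-.
  have mX : measurable (X (t + s)%:E @^-1` A) by exact: measurable_hunt.
  rewrite -EFinD setIC -integral_indic//.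
Qed.

End markov.

Section cylinder.
Context {R : realType} {M : pmetricType R} {d : measure_display}
  {Omega : measurableType d}.
Variable H : hunt_process M Omega.
Notation X := (hunt_X H).
Notation P := (hunt_P H).
Local Open Scope ereal_scope.

Section grid_events.
Variables (K A : set (borel M^Delta)).
Hypotheses (mK : measurable K) (mA : measurable A).

Fixpoint cylinder (t h : R) (n : nat) : set Omega := match n with
  | 0 => X t%:E @^-1` (K `&` A)
  | n'.+1 => X t%:E @^-1` K `&` cylinder (t + h) h n'
  end.

(** The probability of [cylinder 0 h n] from the starting point [e], written as an iterated integral
    so that its measurability in [e] is apparent. *)
Fixpoint cylinder_prob (h : R) (n : nat) (e : M^Delta) : \bar R := match n with
  | 0 => (\1_(K `&` A) e)%:E
  | n'.+1 => (\1_K e)%:E * \int[law H h e]_y cylinder_prob h n' y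
  end.

Lemma cylinderP t h n w : cylinder t h n w <->
  (forall j, (j <= n)%N -> K (X (t + h * j%:R)%:E w)) /\ A (X (t + h * n%:R)%:E w).
Proof.
elim: n t => [|n IH] t /=; rewrite ?mulr0 ?addr0.
  split=> [[Kt At]|[Kt At]]; last by split => //; have := Kt 0%N (leqnn 0); rewrite mulr0 addr0.
  by split => // j; rewrite leqn0 => /eqP ->; rewrite mulr0 addr0.
have E (k : nat) : (t + h + h * k%:R = t + h * k.+1%:R)%R.
  by rewrite -natr1; ring.
rewrite /= -E; split=> [[Kt /IH[Kn An]]|[Kn An]].
  split => // -[|j] jn; first by rewrite mulr0 addr0.
  by rewrite -E; exact: Kn.
split; first by have := Kn 0%N (leq0n _); rewrite mulr0 addr0.
by apply/IH; split => // j jn; rewrite E; exact: Kn.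
Qed.

Lemma measurable_cylinder t h n : (0 <= t)%R -> (0 <= h)%R ->
  measurable (cylinder t h n).
Proof.
move=> t0 h0; elim: n t t0 => [|n IH] t t0 /=.
  by apply: measurable_hunt => //; exact: measurableI.
by apply: measurableI; [exact: measurable_hunt|apply: IH; rewrite addr_ge0].
Qed.

Lemma cylinder_prob_ge0 h n e : 0 <= cylinder_prob h n e.
Proof.
elim: n e => [|n IH] e /=; first by rewrite lee_fin.
by apply: mule_ge0; [rewrite lee_fin|exact: integral_ge0].
Qed.

Lemma measurable_cylinder_prob h n :
  measurable_fun setT (cylinder_prob h n : borel M^Delta -> \bar R).
Proof.
elim: n => [|n IH] /=.
  by apply/measurable_EFinP; apply: measurable_indic; exact: measurableI.
apply: emeasurable_funM.
  by apply/measurable_EFinP; exact: measurable_indic.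
apply: (@measurable_fun_integral_kernel _ _ (borel M^Delta) (borel M^Delta) R (law H h)) => //.
- by move=> U; exact: measurable_law.
- exact: cylinder_prob_ge0.
Qed.

Lemma cylinder_prob_le1 h n e : cylinder_prob h n e <= 1.
Proof.
elim: n e => [|n IH] e /=; first by rewrite lee_fin indicE; case: (_ \in _).
have int1 : \int[law H h e]_y cylinder_prob h n y <= 1.
  apply: (@le_trans _ _ (\int[law H h e]_y 1)).
    apply: ge0_le_integral => //; [by move=> *; exact: cylinder_prob_ge0|
      exact: measurable_cylinder_prob].
  have -> : \int[law H h e]_y 1 = 1 * law H h e setT by exact: integral_cst.
  by rewrite lawT mule1.
apply: le_trans int1; rewrite -[leRHS]mul1e lee_wpmul2r//.
  by apply: integral_ge0 => y _; exact: cylinder_prob_ge0.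
by rewrite lee_fin indicE; case: (_ \in _).
Qed.

(** In the induction the condition at time [t] is moved into the past event, and the Markov property
    is used over a single step [h]. *)
Lemma cylinder_markov e t h n B : (0 <= t)%R -> (0 <= h)%R ->
  natural_filtration X t%:E B ->
  P e (B `&` cylinder t h n) = \int[P e]_(w in B) cylinder_prob h n (X t%:E w).
Proof.
move=> t0 h0; elim: n t t0 B => [|n IH] t t0 B FB /=;
  have mB := natural_filtration_measurable FB.
  have mKA : measurable (X t%:E @^-1` (K `&` A)).
    by apply: measurable_hunt => //; exact: measurableI.
  by rewrite setIC -integral_indic.
have FK : natural_filtration X t%:E (X t%:E @^-1` K).
  exact: natural_filtration_event.
rewrite setIA IH ?addr_ge0//; last first.
  apply: (@natural_filtration_sub _ _ _ _ _ t%:E); first by rewrite lee_fin lerDl.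
  exact: natural_filtrationI.
rewrite markov_integral//; last 3 first.
- exact: natural_filtrationI.
- exact: measurable_cylinder_prob.
- exact: cylinder_prob_ge0.
rewrite integral_mkcondr epatch_indic; apply: eq_integral => w _ /=.
by rewrite muleC.
Qed.

Lemma measurable_set1_borel (z : M) : measurable ([set z] : set (borel M)).
Proof.
rewrite (_ : [set z] = (fun y : borel M => mdist z y) @^-1` [set 0%R]).
  rewrite -[X in measurable X]setTI.
  by apply: measurable_mdistr => //; exact: measurable_set1.
apply/seteqP; split => y /=; first by move=> ->; rewrite mdistxx.
by move=> /mdist_positivity ->.
Qed.

Lemma measurable_set1_some (z : M) : measurable ([set Some z] : set (borel M^Delta)).
Proof.
rewrite -image_set1; apply: measurable_some_image; exact: measurable_set1_borel.
Qed.

Lemma cylinder_prob_start z h n : (0 <= h)%R ->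
  P (Some z) (cylinder 0 h n) = cylinder_prob h n (Some z).
Proof.
move=> h0; rewrite -(setTI (cylinder _ _ _)) cylinder_markov//; last first.
  rewrite -setC0; apply: natural_filtrationC.
  by have [] := natural_filtration_sigma H 0.
have mz := measurable_hunt H (lexx 0%R) (measurable_set1_some z).
rewrite (@ae_eq_integral _ _ _ _ _ (cst (cylinder_prob h n (Some z))))//.
- rewrite integral_cst//.
  rewrite -[RHS]mule1; congr (_ * _); exact: probability_setT.
- have m0 : measurable_fun setT (X 0%:E : Omega -> borel M^Delta).
    exact: (hunt_measurable H).
  exact: (measurableT_comp (measurable_cylinder_prob h n) m0).
- exists (~` (X 0%:E @^-1` [set Some z])); split.
  + exact: measurableC.
  + have := probability_setC (P (Some z)) mz.
    by rewrite hunt_normal subee.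
  + move=> w /= /not_implyP[_ Hw] Xw; apply: Hw; by rewrite Xw.
Qed.

Definition grid_event (t s : R) (m : nat) := cylinder t (s / 2 ^+ m) (2 ^ m).

Lemma grid_eventP t s m w : grid_event t s m w <->
  (forall j, (j <= 2 ^ m)%N -> K (X (grid t (t + s) m j)%:E w)) /\ A (X (t + s)%:E w).
Proof.
rewrite /grid_event cylinderP.
have E (j : nat) : (t + s / 2 ^+ m * j%:R = grid t (t + s) m j)%R.
  by rewrite /grid addrAC subrr add0r mulrAC mulrA.
have -> : (t + s / 2 ^+ m * (2 ^ m)%:R = t + s)%R.
  by rewrite natrX divfK// expf_neq0.
by split=> -[H1 H2]; split => // j jm; [rewrite -E|rewrite E]; exact: H1.
Qed.

Lemma grid_event_decr t s : {homo grid_event t s : m p / (m <= p)%N >-> (p <= m)%O}.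
Proof.
apply: (@homo_leq _ _ (fun a b : set Omega => (b <= a)%O)).
- by move=> x.
- by move=> y x z yx zy; exact: le_trans zy yx.
move=> m; apply/subsetPset => w /grid_eventP[Hg HA]; apply/grid_eventP; split => // j jm.
have -> : grid t (t + s) m j = grid t (t + s) m.+1 (2 * j).
  rewrite /grid natrM exprS; congr (_ + _ * _)%R.
  by field; rewrite expf_neq0.
by apply: Hg; rewrite expnS leq_mul2l.
Qed.

Lemma measurable_grid_event t s m : (0 <= t)%R -> (0 <= s)%R ->
  measurable (grid_event t s m).
Proof. by move=> t0 s0; apply: measurable_cylinder; rewrite ?divr_ge0 ?exprn_ge0. Qed.

(** The Markov property holds on each grid; the limit over grids is taken inside the integral by
    dominated convergence, and the limit at a point of [B] is the probability of the
    intersection. *)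
Lemma grid_event_markov_le e t s B (B0 : set M) kappa :
  (0 <= t)%R -> (0 <= s)%R -> natural_filtration X t%:E B ->
  B `<=` X t%:E @^-1` (Some @` B0) ->
  (forall z, B0 z -> P (Some z) (\bigcap_m grid_event 0 s m) <= kappa) ->
  P e (B `&` \bigcap_m grid_event t s m) <= kappa * P e B.
Proof.
move=> t0 s0 FB BB0 Hk; have mB := natural_filtration_measurable FB.
pose f m w := cylinder_prob (s / 2 ^+ m) (2 ^ m) (X t%:E w).
have mf m : measurable_fun setT (f m).
  have mX : measurable_fun setT (X t%:E : Omega -> borel M^Delta).
    exact: (hunt_measurable H).
  exact: (measurableT_comp (measurable_cylinder_prob _ _) mX).
have h0 m : (0 <= s / 2 ^+ m)%R by rewrite divr_ge0 ?exprn_ge0.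
have cvgf w : B w -> exists2 l, f m w @[m --> \oo] --> l & l <= kappa.
  move=> /BB0 [z B0z Xw]; exists (P (Some z) (\bigcap_m grid_event 0 s m)); last exact: Hk.
  have -> : (fun m => f m w) = P (Some z) \o grid_event 0 s.
    apply/funext => m; rewrite /f -Xw -cylinder_prob_start//.
  apply: nonincreasing_cvg_mu.
  - by rewrite (le_lt_trans (probability_le1 _ _)) ?ltry//; exact: measurable_grid_event.
  - by move=> i; exact: measurable_grid_event.
  - by apply: bigcapT_measurable => i; exact: measurable_grid_event.
  - exact: grid_event_decr.
(* Convergence is known on [B] only; the upper limit is defined and measurable everywhere. *)
pose L w := limn_esup (f ^~ w).
have mL : measurable_fun setT L by exact: measurable_fun_limn_esup.
have LE w : B w -> f m w @[m --> \oo] --> L w.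
  move=> /cvgf[l fl _]; rewrite /L is_cvg_limn_esupE; last by apply/cvg_ex; exists l.
  by rewrite (cvg_lim _ fl).
have Lk w : B w -> 0 <= L w <= kappa.
  move=> Bw; have [l fl lk] := cvgf w Bw.
  have -> : L w = l by apply: cvg_unique fl => //; exact: LE.
  rewrite lk andbT; apply: (cvge_ge _ fl); exact: nearW (fun m => cylinder_prob_ge0 _ _ _).
have fle1 m w : `|f m w| <= cst 1 w.
  by rewrite gee0_abs ?cylinder_prob_ge0//; exact: cylinder_prob_le1.
have [] := @dominated_convergence _ _ _ (P e) B mB f L (cst 1).
- by move=> m; exact: measurable_funTS.
- exact: measurable_funTS.
- by apply: nearW => w; exact: LE.
- exact: finite_measure_integrable_cst.
- by apply: nearW => w m _.
move=> _ _ cv.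
have mG m := measurable_grid_event m t0 s0.
apply: (@le_trans _ _ (\int[P e]_(w in B) L w)).
  rewrite -(cvg_lim _ cv)//; apply: lime_ge; first by apply/cvg_ex; eexists; exact: cv.
  apply: nearW => m /=; rewrite /f -cylinder_markov//.
  apply: le_measure; rewrite ?inE.
  - by apply: measurableI => //; apply: bigcapT_measurable.
  - by apply: measurableI => //; exact: mG.
  - by apply: setIS; exact: bigcap_inf.
rewrite -integral_cst//; apply: ge0_le_integral => //.
- by move=> w /Lk/andP[].
- exact: measurable_funTS.
- by move=> w /Lk/andP[].
Qed.

End grid_events.
End cylinder.

(** * Approaching a point along shrinking balls *)

Section chain.
Context {R : realType} {M : pmetricType R} {d : measure_display}
  {Omega : measurableType d}.
Variable H : hunt_process M Omega.
Notation X := (hunt_X H).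
Notation P := (hunt_P H).
Variables (N : set (borel M)) (U : set M).
Hypotheses (mN : measurable N) (oU : open U)
  (avoidN : forall x, ~ N x -> {ae P (Some x), forall w, avoids H N w})
  (contN : forall x, ~ N x -> {ae P (Some x), forall w, continuous_path H w}).
Local Open Scope ereal_scope.

Section stay.
Variable A : set (borel M).
Hypothesis mA : measurable A.

Let mcore n : measurable (Some @` core U n : set (borel M^Delta)).
Proof. by apply: measurable_some_image; exact: measurable_core. Qed.

Let mSA : measurable (Some @` A : set (borel M^Delta)).
Proof. exact: measurable_some_image. Qed.

(* A continuous path stays in the open set [U] during a compact time interval iff
   for some [n] it stays in the closed set [core U n], which can be tested at
   dyadic times. *)
Definition stay (t s : R) : set Omega :=
  \bigcup_n \bigcap_m grid_event H (Some @` core U n) (Some @` A) t s m.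

Let measurable_stay_n t s n : (0 <= t)%R -> (0 <= s)%R ->
  measurable (\bigcap_m grid_event H (Some @` core U n) (Some @` A) t s m).
Proof.
move=> t0 s0; apply: bigcapT_measurable => m; exact: measurable_grid_event.
Qed.

Lemma measurable_stay t s : (0 <= t)%R -> (0 <= s)%R -> measurable (stay t s).
Proof. by move=> t0 s0; apply: bigcupT_measurable => n; exact: measurable_stay_n. Qed.

Lemma stayP t s w : (0 <= t)%R -> (0 <= s)%R -> continuous_path H w ->
  (Some @` A) (X (t + s)%:E w) ->
  (forall u, (t <= u <= t + s)%R -> (Some @` U) (X u%:E w)) -> stay t s w.
Proof.
move=> t0 s0 cw XA XU; have ts0 : (0 <= t + s)%R by rewrite addr_ge0.
have [|Y cY XY] := @alive_path _ _ _ _ H w (t + s)%R cw ts0.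
  by case: XA => y _ <-.
have XY' u : (t <= u <= t + s)%R -> X u%:E w = Some (Y u).
  by move=> /andP[tu ut]; apply: XY; rewrite ut (le_trans t0).
have YU u : (t <= u <= t + s)%R -> U (Y u).
  by move=> tu; have [y Uy] := XU u tu; rewrite XY'// => -[<-].
have [n Hn] := path_in_core cY oU YU.
exists n => // m _; apply/grid_eventP; split => // j jm.
have tts : (t <= t + s)%R by rewrite lerDl.
have gt := grid_itv tts jm; rewrite XY'//.
by exists (Y (grid t (t + s) m j)) => //; exact: Hn.
Qed.

Lemma stay_start_le z s n : (0 <= s)%R -> ~ N z ->
  P (Some z) (\bigcap_m grid_event H (Some @` core U n) (Some @` A) 0 s m) <=
  killed_transition H U s z A.
Proof.
move=> s0 Nz; apply: (le_completed_prob (C := continuous_path H)).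
- exact: measurable_stay_n.
- exact: contN.
move=> w Gw cw; have := Gw 0%N I.
move=> /grid_eventP[_]; rewrite add0r => XA.
have [|Y cY XY] := @alive_path _ _ _ _ H w s cw s0.
  by case: XA => y _ <-.
split => //; apply: exit_time_gt => // u us.
exists (Y u); last by rewrite XY.
apply: (@core_sub _ _ _ n).
apply: (grid_in_core cY _ us) => m j jm.
have /grid_eventP[+ _] := Gw m I; move=> /(_ j jm); rewrite add0r.
by rewrite XY ?grid_itv// => -[y Uy [<-]].
Qed.

Lemma stay_markov_le e t s B (B0 : set M) kappa :
  (0 <= t)%R -> (0 <= s)%R -> natural_filtration X t%:E B ->
  B `<=` X t%:E @^-1` (Some @` B0) ->
  (forall z, B0 z -> ~ N z /\ killed_transition H U s z A <= kappa) ->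
  P e (B `&` stay t s) <= kappa * P e B.
Proof.
move=> t0 s0 FB BB0 Hk; have mB := natural_filtration_measurable FB.
rewrite setI_bigcupr.
have mI n : measurable (B `&` \bigcap_m grid_event H (Some @` core U n) (Some @` A) t s m).
  by apply: measurableI => //; exact: measurable_stay_n.
have cv := @nondecreasing_cvg_mu _ _ _ (P e) _ mI (bigcupT_measurable _ mI) _.
rewrite -(cvg_lim _ (cv _))//; last first.
  move=> n p np; apply/subsetPset; apply: setIS => w Hw m _.
  have /grid_eventP[Hg HA] := Hw m I; apply/grid_eventP; split => // j jm.
  by have [y Uy <-] := Hg j jm; exists y => //; exact: (core_mono np).
apply: lime_le.
  apply/cvg_ex; eexists; apply: cv.
  move=> n p np; apply/subsetPset; apply: setIS => w Hw m _.
  have /grid_eventP[Hg HA] := Hw m I; apply/grid_eventP; split => // j jm.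
  by have [y Uy <-] := Hg j jm; exists y => //; exact: (core_mono np).
apply: nearW => n /=; apply: (@grid_event_markov_le _ _ _ _ _ _ _ _ _ _ _ _ _ B0) => //.
move=> z B0z; have [Nz Kz] := Hk z B0z.
by apply: le_trans (stay_start_le n s0 Nz) Kz.
Qed.

End stay.

Section crossing.
Variables (y0 : M) (a b lo sg hi : R).
Hypotheses (a0 : (0 <= a)%R) (ab : (a <= b)%R).

Let shell : set (borel M) := [set z | (sg < mdist y0 z < hi)%R] `\` N.
Let target : set (borel M) := [set z | (mdist y0 z < lo)%R] `\` N.

(* A continuous path from the outside of the shell into [target] visits the open
   shell at a dyadic time. *)
Definition crossing : set Omega :=
  X b%:E @^-1` (Some @` target) `&`
  \bigcup_m \bigcup_(j < (2 ^ m).+1) X (grid a b m j)%:E @^-1` (Some @` shell).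

Let mdist_lt r : measurable ([set z | (mdist y0 z < r)%R] : set (borel M)).
Proof. by apply: open_borel; exact: open_mdist_ball. Qed.

Let measurable_shell : measurable shell.
Proof.
apply: measurableD => //.
rewrite (_ : [set z | _] = (fun z : borel M => mdist y0 z) @^-1` `]sg, hi[%classic).
  by rewrite -[X in measurable X]setTI; exact: measurable_mdistr.
by apply/seteqP; split => z /=; rewrite in_itv.
Qed.

Let measurable_target : measurable target.
Proof. by apply: measurableD. Qed.

Let grid_ge0 m j : (j < (2 ^ m).+1)%N -> (0 <= grid a b m j <= b)%R.
Proof.
by rewrite ltnS => jm; have /andP[h1 h2] := grid_itv ab jm; rewrite h2 (le_trans a0).
Qed.

Lemma natural_filtration_crossing : natural_filtration X b%:E crossing.
Proof.
have b0 : (0 <= b)%R by exact: le_trans ab.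
apply: natural_filtrationI.
  by apply: natural_filtration_event => //; exact: measurable_some_image.
apply: natural_filtration_bigcup => m; rewrite bigcup_mkcond.
apply: natural_filtration_bigcup => j; case: ifPn => [|_].
  rewrite inE => /= /grid_ge0/andP[g0 gb].
  by apply: natural_filtration_event => //; exact: measurable_some_image.
by have [] := natural_filtration_sigma H b%:E.
Qed.

Lemma crossing_sub : crossing `<=` X b%:E @^-1` (Some @` target).
Proof. exact: subIsetl. Qed.

(** On a fixed grid the event is split by the first visit to the shell, which belongs to the
    filtration of that time. The Markov property gives [kappa] times the probability of each first
    visit, and these sum to at most [1]; a plain union bound would lose the number of grid points.
    The bound survives refinement since the events increase with the level. *)
Lemma crossing_le e (kappa : R) : (0 <= kappa)%R ->
  (forall (z : M) (u : R), shell z -> (0 <= u <= b - a)%R ->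
     P (Some z) (X u%:E @^-1` (Some @` target)) <= kappa%:E) ->
  P e crossing <= kappa%:E.
Proof.
move=> k0 Hk; have b0 : (0 <= b)%R by exact: le_trans ab.
have mSs := measurable_some_image measurable_shell.
have mSt := measurable_some_image measurable_target.
pose G m j : set Omega := if (j < (2 ^ m).+1)%N then
  X (grid a b m j)%:E @^-1` (Some @` shell) else set0.
have VE m : \bigcup_(j < (2 ^ m).+1) X (grid a b m j)%:E @^-1` (Some @` shell) =
    \bigcup_j G m j.
  rewrite bigcup_mkcond; apply: eq_bigcupr => j _.
  by rewrite /G mem_setE.
have mC : measurable (X b%:E @^-1` (Some @` target)) by exact: measurable_hunt.
have FG m j : (j < (2 ^ m).+1)%N -> natural_filtration X (grid a b m j)%:E (G m j).
  move=> jm; rewrite /G jm; have /andP[g0 _] := grid_ge0 jm.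
  exact: natural_filtration_event.
have mG m j : measurable (G m j).
  have [jm|jm] := boolP (j < (2 ^ m).+1)%N.
    exact: (natural_filtration_measurable (FG m j jm)).
  by rewrite /G (negbTE jm).
have level m : P e (X b%:E @^-1` (Some @` target) `&` \bigcup_j G m j) <= kappa%:E.
  rewrite seqDU_bigcup_eq setI_bigcupr.
  have mS j : measurable (seqDU (G m) j) by exact: seqDU_measurable.
  rewrite measure_semi_bigcup//; last 3 first.
  - by move=> j; exact: measurableI.
  - exact: trivIset_setIl (trivIset_seqDU _).
  - by apply: bigcupT_measurable => j; exact: measurableI.
  apply: (@le_trans _ _ (\sum_(j <oo) kappa%:E * P e (seqDU (G m) j))).
    apply: lee_nneseries => // j _.
    have [jm|jm] := boolP (j < (2 ^ m).+1)%N; last first.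
      by rewrite /seqDU /G (negbTE jm) set0D setI0 measure0 mule_ge0.
    have /andP[g0 gb] := grid_ge0 jm.
    have Fj : natural_filtration X (grid a b m j)%:E (seqDU (G m) j).
      rewrite /seqDU setDE; apply: natural_filtrationI; first exact: FG.
      apply: natural_filtrationC; rewrite -bigcup_mkord bigcup_mkcond.
      apply: natural_filtration_bigcup => i; case: ifPn => [|_].
        rewrite inE /= => ij; apply: natural_filtration_sub (FG _ _ (ltn_trans ij jm)).
        rewrite lee_fin /grid lerD2l ler_wpM2l ?subr_ge0//.
        by rewrite ler_pM2r ?invr_gt0 ?exprn_gt0// ler_nat ltnW.
      by have [] := natural_filtration_sigma H (grid a b m j)%:E.
    have s0 : (0 <= b - grid a b m j)%R by rewrite subr_ge0.
    rewrite [leLHS](_ : _ = \int[P e]_(w in seqDU (G m) j)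
        P (X (grid a b m j)%:E w) (X (b - grid a b m j)%:E @^-1` (Some @` target))); last first.
      have := @hunt_markov _ _ _ _ H _ _ e _ _ s0 g0 mSt Fj.
      by rewrite setIC -EFinD addrC subrK.
    rewrite -integral_cst//; apply: ge0_le_integral => //.
    + have mXg : measurable_fun setT (X (grid a b m j)%:E : Omega -> borel M^Delta).
        by apply: (hunt_measurable H); rewrite lee_fin.
      apply: measurable_funTS.
      have := measurableT_comp (measurable_law H (b - grid a b m j) mSt) mXg.
      by rewrite /law (ger0_norm s0).
    + move=> w [+ _]; rewrite /G jm => -[z sz <-]; apply: Hk => //.
      rewrite s0 lerD2l lerN2; have jm' : (j <= 2 ^ m)%N by rewrite -ltnS.
      by have /andP[] := grid_itv ab jm'.
  rewrite nneseriesZl//.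
  rewrite -measure_semi_bigcup//; last exact: bigcupT_measurable.
  rewrite -[leRHS]mule1 lee_wpmul2l//; apply: probability_le1.
  exact: bigcupT_measurable.
rewrite /crossing; under eq_bigcupr do rewrite VE.
rewrite setI_bigcupr.
have mI m : measurable (X b%:E @^-1` (Some @` target) `&` \bigcup_j G m j).
  by apply: measurableI => //; exact: bigcupT_measurable.
have hom : {homo (fun m => X b%:E @^-1` (Some @` target) `&` \bigcup_j G m j) :
    m p / (m <= p)%N >-> (m <= p)%O}.
  apply: homo_leq => [A //|B A C|m]; first exact: le_trans.
  apply/subsetPset; apply: setIS; rewrite -!VE => w [j /= jm Xj].
  exists (2 * j)%N => /=; first by rewrite ltnS expnS leq_mul2l/= -ltnS.
  rewrite (_ : grid a b m.+1 (2 * j) = grid a b m j)//.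
  rewrite /grid natrM exprS; congr (_ + _ * _)%R.
  by field; rewrite expf_neq0.
have cv := @nondecreasing_cvg_mu _ _ _ (P e) _ mI (bigcupT_measurable _ mI) hom.
rewrite -(cvg_lim _ cv)//; apply: lime_le; first by apply/cvg_ex; eexists; exact: cv.
by apply: nearW => m; exact: level.
Qed.

End crossing.

End chain.

Section chain_bound.
Context {R : realType} {M : pmetricType R} {d : measure_display}
  {Omega : measurableType d}.
Variable H : hunt_process M Omega.
Notation X := (hunt_X H).
Notation P := (hunt_P H).
Variables (N : set (borel M)) (U : set M).
Hypotheses (mN : measurable N) (oU : open U)
  (avoidN : forall x, ~ N x -> {ae P (Some x), forall w, avoids H N w})
  (contN : forall x, ~ N x -> {ae P (Some x), forall w, continuous_path H w}).
Local Open Scope ereal_scope.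

Lemma le_measure_ae x (A B : set Omega) (C : Omega -> Prop) :
  measurable A -> measurable B -> {ae P (Some x), forall w, C w} ->
  (forall w, A w -> C w -> B w) -> P (Some x) A <= P (Some x) B.
Proof.
move=> mA mB aeC AB; apply: le_trans (le_completed_prob mA aeC AB) _.
by rewrite /completed_prob /completed_measure_extension measurable_mu_extE.
Qed.

Variables (x y0 : M) (t : R) (s_ rho sg : nat -> R) (rhoo : R) (A Z : set (borel M)).
Hypotheses (Nx : ~ N x) (s_gt0 : forall k, (0 < s_ k)%R)
  (s_decr : forall k, (s_ k.+1 <= s_ k)%R) (s_t : (s_ 0%N <= t)%R)
  (s_cvg0 : forall e : R, (0 < e)%R -> exists k, (s_ k < e)%R).
Hypotheses (rho_sg : forall k, (rho k.+1 <= sg k)%R)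
  (sg_rho : forall k, (sg k < rho k)%R) (rhoo_rho : forall k, (rhoo <= rho k)%R)
  (rho0U : forall z, (mdist y0 z < rho 0%N)%R -> U z).
Hypotheses (mZ : measurable Z)
  (startZ : {ae P (Some x), forall w z, X (t - s_ 0%N)%:E w = Some z -> Z z}).
Hypotheses (mA : measurable A) (A_rhoo : forall z, A z -> (mdist y0 z < rhoo)%R).

Let t_ k : R := (t - s_ k)%R.

Let s_le0 k : (s_ k <= s_ 0%N)%R.
Proof. by elim: k => // k; apply: le_trans. Qed.

Let t_ge0 k : (0 <= t_ k)%R.
Proof. by rewrite subr_ge0 (le_trans (s_le0 k)). Qed.

Let t_incr k : (t_ k <= t_ k.+1)%R.
Proof. by rewrite lerD2l lerN2. Qed.

Let rho_le0 k : (rho k <= rho 0%N)%R.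
Proof.
by elim: k => // k; apply: le_trans; apply: le_trans (rho_sg k) (ltW (sg_rho k)).
Qed.

Let ts k : (t_ k + s_ k = t)%R. Proof. by rewrite /t_ subrK. Qed.

Let near_set r : set (borel M) := [set z | (mdist y0 z < r)%R] `\` N.

(** [Z] carries what is known about the position at the initial time [t - s_ 0]: it is [[set x]]
    when this time is [0] and [setT] otherwise. *)
Let start : set Omega :=
  X (t_ 0)%:E @^-1` (Some @` (near_set (rho 0%N) `&` Z)).
Let cross k : set Omega :=
  crossing H N y0 (t_ k) (t_ k.+1) (rho k.+1) (sg k) (rho k).

(** Continuity at time [t], where the path is strictly within [rhoo], provides an index with [G]. At
    the least index [k.+1], failure of [G k] means being far at time [t_ k] or leaving [U] later; as
    [U] contains the ball of radius [rho k], both give a time before [t_ k.+1] at distance at least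
    [rho k], and the path then comes back through the shell. *)
Let chain_cover w : avoids H N w -> continuous_path H w ->
  (forall z, X (t_ 0%N)%:E w = Some z -> Z z) ->
  (Some @` A) (X t%:E w) ->
  (start `&` stay H U A (t_ 0%N) (s_ 0%N)) w \/
  exists k, (cross k `&` stay H U A (t_ k.+1) (s_ k.+1)) w.
Proof.
move=> aw cw ZX XA; have t0 : (0 <= t)%R by rewrite (le_trans _ s_t)// ltW.
have [|Y cY XY] := @alive_path _ _ _ _ H w t cw t0; first by case: XA => y _ <-.
have XY' k u : (t_ k <= u <= t)%R -> X u%:E w = Some (Y u).
  by move=> /andP[tu ut]; apply: XY; rewrite ut (le_trans (t_ge0 k)).
have t_t k : (t_ k <= t)%R by rewrite lerBlDr lerDl ltW.
have tt k : (t_ k <= t_ k <= t)%R by rewrite lexx t_t.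
have NY u : (0 <= u <= t)%R -> ~ N (Y u).
  move=> ut NYu; have /andP[u0 _] := ut; apply: (aw u u0).
  by exists (Y u) => //; rewrite XY.
have AY : A (Y t).
  by have [y Ay] := XA; rewrite XY ?t0 ?lexx// => -[<-].
pose G k := (mdist y0 (Y (t_ k)) < rho k)%R /\
  forall u, (t_ k <= u <= t)%R -> U (Y u).
have GP k : G k -> (X (t_ k)%:E @^-1` (Some @` near_set (rho k))) w /\
    stay H U A (t_ k) (s_ k) w.
  move=> [Gk Uk]; split.
    exists (Y (t_ k)); last by rewrite (XY' k).
    by split => //; apply: NY; rewrite t_ge0 t_t.
  apply: stayP => //; first exact: ltW.
    by rewrite ts.
  rewrite ts => u tu; exists (Y u); first exact: Uk.
  by rewrite (XY' k).
have [k0 Gk0] : exists k, G k.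
  pose e := (rhoo - mdist y0 (Y t))%R.
  have e0 : (0 < e)%R by rewrite subr_gt0; exact: A_rhoo.
  have [dl dl0 Hdl] := (continuous_mdistP Y).1 cY t e e0.
  have [k sk] := s_cvg0 dl0; exists k.
  have close u : (t_ k <= u <= t)%R -> (mdist y0 (Y u) < rhoo)%R.
    move=> /andP[tu ut]; apply: le_lt_trans (metric_triangle _ (Y t) _) _.
    rewrite -ltrBrDl; apply: Hdl; rewrite ler0_norm ?subr_le0//.
    by move: tu sk; rewrite /t_; lra.
  split; first exact: lt_le_trans (close _ (tt k)) _.
  move=> u tu; apply: rho0U; apply: lt_le_trans (close _ tu) _.
  exact: rhoo_rho.
have ex : exists k, asbool (G k) by exists k0; apply/asboolP.
have [k /asboolP Gk kmin] := ex_minnP ex.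
case: k Gk kmin => [|k] Gk kmin.
  left; have [[z nz Xz] st0] := GP _ Gk; split => //; exists z => //.
  by split => //; apply: ZX; rewrite -Xz.
right; exists k; have [Xk stk] := GP _ Gk; split => //; split => //.
have nG : ~ G k by move=> /asboolT/kmin; rewrite ltnn.
have [u0 u0P far] : exists2 u, (t_ k <= u <= t_ k.+1)%R &
    (rho k <= mdist y0 (Y u))%R.
  have [h|h] := leP (rho k) (mdist y0 (Y (t_ k))).
    by exists (t_ k) => //; rewrite lexx t_incr.
  have : ~ forall u, (t_ k <= u <= t)%R -> U (Y u) by move=> h'; apply: nG.
  move=> /existsNP[u /not_implyP[/andP[tu ut] nU]]; exists u.
    rewrite tu leNgt; apply/negP => h'; apply: nU; apply: Gk.2.
    by rewrite (ltW h').
  rewrite leNgt; apply/negP => h'; apply: nU; apply: rho0U.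
  exact: lt_le_trans h' (rho_le0 k).
have close : (mdist y0 (Y (t_ k.+1)) <= sg k)%R.
  by apply: le_trans (ltW Gk.1) (rho_sg k).
have [m [j [jm Hj]]] := grid_crossing cY u0P far close (sg_rho k).
exists m => //; exists j => /=; first by rewrite ltnS.
have /andP[gl gr] := grid_itv (t_incr k) jm.
have gt : (t_ k <= grid (t_ k) (t_ k.+1) m j <= t)%R.
  by rewrite gl (le_trans gr).
exists (Y (grid (t_ k) (t_ k.+1) m j)); last by rewrite (XY' k).
split => //; apply: NY; rewrite (le_trans (t_ge0 k) gl).
by have /andP[] := gt.
Qed.

(* On [X_t \in A], let [k] be the first index such that [X_(t - s_k)] is in the
   ball of radius [rho k] and the path stays in [U] during [[t - s_k, t]]. For
   [k > 0] the path crosses the shell between [sg k.-1] and [rho k.-1] during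
   [[t - s_(k-1), t - s_k]]. *)
Lemma chain_bound (kappa : nat -> \bar R) (pi : nat -> R) :
  (forall k, 0 <= kappa k) -> (forall k, 0 <= pi k)%R ->
  (forall k z, (mdist y0 z < rho k)%R -> ~ N z -> (k = 0%N -> Z z) ->
     killed_transition H U (s_ k) z A <= kappa k) ->
  (forall k z u, (sg k < mdist y0 z < rho k)%R -> ~ N z ->
     (0 <= u <= s_ k)%R ->
     P (Some z) (X u%:E @^-1` (Some @` near_set (rho k.+1))) <= (pi k)%:E) ->
  P (Some x) (X t%:E @^-1` (Some @` A)) <=
  kappa 0%N *
    P (Some x) (X (t - s_ 0%N)%:E @^-1` (Some @` (near_set (rho 0%N) `&` Z))) +
  \sum_(k <oo) kappa k.+1 * (pi k)%:E.
Proof.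
move=> kap0 pi0 Hkap Hpi.
have s0 k : (0 <= s_ k)%R by exact: ltW.
have t0 : (0 <= t)%R by rewrite (le_trans _ s_t).
have mnear r : measurable (near_set r).
  apply: measurableD => //; apply: open_borel; exact: open_mdist_ball.
have Fstart : natural_filtration X (t_ 0%N)%:E start.
  apply: natural_filtration_event => //; apply: measurable_some_image.
  exact: measurableI.
have Fcross k : natural_filtration X (t_ k.+1)%:E (cross k).
  exact: natural_filtration_crossing.
have mS k : measurable (cross k `&` stay H U A (t_ k.+1) (s_ k.+1)).
  apply: measurableI; first exact: natural_filtration_measurable (Fcross k).
  exact: measurable_stay.
have mS0 : measurable (start `&` stay H U A (t_ 0%N) (s_ 0%N)).
  apply: measurableI; first exact: natural_filtration_measurable Fstart.
  exact: measurable_stay.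
have mSk : measurable (\bigcup_k (cross k `&` stay H U A (t_ k.+1) (s_ k.+1))).
  exact: bigcupT_measurable.
have aeC : {ae P (Some x), forall w, (avoids H N w /\ continuous_path H w) /\
    forall z, X (t_ 0%N)%:E w = Some z -> Z z}.
  exact: filterI (filterI (avoidN Nx) (contN Nx)) startZ.
apply: (@le_trans _ _ (P (Some x) ((start `&` stay H U A (t_ 0%N) (s_ 0%N)) `|`
    \bigcup_k (cross k `&` stay H U A (t_ k.+1) (s_ k.+1))))).
  apply: le_measure_ae aeC _.
  - by apply: measurable_hunt => //; exact: measurable_some_image.
  - exact: measurableU.
  - move=> w Xw [[aw cw] ZX]; have [h|[k h]] := chain_cover aw cw ZX Xw; first by left.
    by right; exists k.
apply: le_trans (measureU2 (P (Some x)) mS0 mSk) _; apply: leeD.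
  apply: (stay_markov_le oU contN mA _ (B0 := near_set (rho 0%N) `&` Z)) => //.
  by move=> z [[zr Nz] Zz]; split => //; exact: Hkap.
apply: (@le_trans _ _ (\sum_(k <oo) P (Some x) (cross k `&` stay H U A (t_ k.+1) (s_ k.+1)))).
  exact: measure_sigma_subadditive.
apply: lee_nneseries => // k _.
apply: (@le_trans _ _ (kappa k.+1 * P (Some x) (cross k))).
  apply: (stay_markov_le oU contN mA _ (B0 := near_set (rho k.+1))) => //.
    exact: crossing_sub.
  by move=> z [zr Nz]; split => //; exact: Hkap.
apply: lee_wpmul2l => //; apply: crossing_le => // z u [zs Nz] u0.
apply: Hpi => //; have /andP[-> h] := u0; apply: (le_trans h).
by have := s0 k.+1; rewrite /t_; lra.
Qed.

End chain_bound.

(** * Joint measurability of the transition function *)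

Section clipped_distance.
Context {R : realType} {M : pmetricType R}.
Variable G : set M.

Let dist_set (x : M) : set R := [set 1] `|` [set mdist x y | y in ~` G].

(** The value [1] is included so that the infimum is over a nonempty set even when [G] is the whole
    space. *)
Definition clipped_distance (x : M) : R := inf (dist_set x).

Let dist_set_ge0 x : lbound (dist_set x) 0.
Proof. by move=> _ [->//|[y _ <-]]; exact: mdist_ge0. Qed.

Let has_inf_dist_set x : has_inf (dist_set x).
Proof. by split; [exists 1; left|exists 0; exact: dist_set_ge0]. Qed.

Lemma clipped_distance_ge0 x : 0 <= clipped_distance x.
Proof. by apply: lb_le_inf; [case: (has_inf_dist_set x)|exact: dist_set_ge0]. Qed.

Lemma clipped_distance_lipschitz x z :
  clipped_distance x <= clipped_distance z + mdist x z.
Proof.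
rewrite -lerBlDr; apply: lb_le_inf; first by case: (has_inf_dist_set z).
have lb v : dist_set x v -> clipped_distance x <= v.
  by move=> dv; apply: ge_inf => //; exists 0; exact: dist_set_ge0.
move=> _ [->|[y nGy <-]]; rewrite lerBlDr.
  by apply: (@le_trans _ _ 1); [apply: lb; left|rewrite lerDl mdist_ge0].
apply: (@le_trans _ _ (mdist x y)); first by apply: lb; right; exists y.
by rewrite addrC metric_triangle.
Qed.

Lemma clipped_distance_eq0 x : ~ G x -> clipped_distance x = 0.
Proof.
move=> nGx; apply/eqP; rewrite eq_le clipped_distance_ge0 andbT.
apply: ge_inf; first by exists 0; exact: dist_set_ge0.
by right; exists x => //; rewrite mdistxx.
Qed.

Lemma clipped_distance_gt0 x : open G -> G x -> 0 < clipped_distance x.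
Proof.
move=> oG Gx; have /nbhs_ballP[e /= e0 eG] : nbhs x G by apply: open_nbhs_nbhs.
apply: (@lt_le_trans _ _ (Num.min 1 e)); first by rewrite lt_min ltr01.
apply: lb_le_inf; first by case: (has_inf_dist_set x).
move=> _ [->|[y nGy <-]]; first by rewrite ge_min lexx.
rewrite ge_min; apply/orP; right; rewrite leNgt; apply/negP => xy.
by apply: nGy; apply: eG; rewrite ballEmdist.
Qed.

Lemma continuous_clipped_distance : continuous clipped_distance.
Proof.
move=> x; apply/cvgrPdist_lt => e e0; apply/nbhs_ballP; exists e => //= z.
rewrite ballEmdist/= => xz; apply: le_lt_trans xz.
have := clipped_distance_lipschitz x z; have := clipped_distance_lipschitz z x.
by rewrite (metric_sym z x) ler_norml; lra.
Qed.

End clipped_distance.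

Section joint_measurability.
Context {R : realType} {M : pmetricType R} {d : measure_display}
  {Omega : measurableType d}.
Variable H : hunt_process M Omega.
Notation X := (hunt_X H).
Notation P := (hunt_P H).

(* Joint measurability in [(t, x)] is clear at the discretized times [tau n t],
   which decrease to [`|t|], and passes to the limit by right-continuity. *)
Let tau (n : nat) (t : R) : R := (Num.truncn (n.+1%:R * `|t|)).+1%:R / n.+1%:R.

Let tau_gt n t : `|t| < tau n t.
Proof. by rewrite /tau ltr_pdivlMr// mulrC truncnS_gt. Qed.

Let tau_le n t : tau n t <= `|t| + n.+1%:R^-1.
Proof.
rewrite /tau ler_pdivrMr// mulrDl mulVf// -natr1 lerD2r mulrC.
by rewrite truncn_le// mulr_ge0.
Qed.

Section test_function.
Variable g : M -> R.
Hypotheses (g0 : forall x, 0 <= g x) (g1 : forall x, g x <= 1)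
  (cg : continuous g).

Let mg : measurable_fun setT (g : borel M -> R).
Proof.
move=> _; apply: (measurability _ (RGenOpens.measurableE R)) => //.
move=> _ [_ [a [b ->]] <-]; rewrite setTI; apply: open_borel.
by move/continuousP : cg; apply; exact: interval_open.
Qed.

Let ext (e : M^Delta) : \bar R := if e is Some x then (g x)%:E else 0%E.

Let mext : measurable_fun setT (ext : borel M^Delta -> \bar R).
Proof. by apply: measurable_fun_option; exact/measurable_EFinP. Qed.

Let ext0 e : (0 <= ext e)%E.
Proof. by case: e => [x|] /=; rewrite ?lee_fin. Qed.

Let ext1 e : (`|ext e| <= 1)%E.
Proof. by rewrite gee0_abs//; case: e => [x|] /=; rewrite ?lee_fin. Qed.

Let mX t : 0 <= t -> measurable_fun setT (X t%:E : Omega -> borel M^Delta).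
Proof. by move=> t0; apply: (hunt_measurable H); rewrite lee_fin. Qed.

Let integral_law t e : (\int[law H t e]_y ext y = \int[P e]_w ext (X `|t|%:E w))%E.
Proof.
transitivity (\int[P e]_w \int[law H t e]_y ext y)%E.
  by rewrite integral_cst// -[LHS]mule1; congr (_ * _)%E; exact/esym/probability_setT.
transitivity (\int[P e]_w \int[\d_(X `|t|%:E w : borel M^Delta)]_y ext y)%E; last first.
  by apply: eq_integral => w _; rewrite integral_dirac// diracT mul1e.
have mXA (A : set (borel M^Delta)) : measurable A -> measurable (X `|t|%:E @^-1` A).
  by move=> mA; exact: measurable_hunt.
apply/esym; apply: (@eq_mixture _ _ Omega (borel M^Delta) R (P e) setT measurableT
  (fun w => \d_(X `|t|%:E w : borel M^Delta)) (fun=> law H t e)) => //.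
- move=> A mA; apply/measurable_EFinP.
  rewrite (_ : (fun x => _) = \1_(X `|t|%:E @^-1` A)).
    by apply: measurable_indic; exact: mXA.
  by apply/funext => w; rewrite /= indicE.
- move=> A mA; transitivity (P e (X `|t|%:E @^-1` A)).
    have := @integral_indic _ _ _ (P e) setT measurableT _ (mXA A mA).
    by rewrite setIT.
  by rewrite integral_cst// -[LHS]mule1; congr (_ * _)%E; exact/esym/probability_setT.
Qed.

Let measurable_grid_law n : measurable_fun setT
  (fun z : R * borel M => (\int[law H (tau n z.1) (Some z.2)]_y ext y)%E).
Proof.
pose D j : set (R * borel M) := [set t : R | Num.truncn (n.+1%:R * `|t|) = j] `*` setT.
have mt j : measurable [set t : R | Num.truncn (n.+1%:R * `|t|) = j].
  rewrite (_ : [set t | _] = (fun t : R => n.+1%:R * `|t|) @^-1` `[j%:R, j.+1%:R[%classic).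
    rewrite -[X in measurable X]setTI.
    have mf : measurable_fun setT (fun t : R => n.+1%:R * `|t|).
      by apply: measurable_funM => //; exact: measurableT_comp.
    exact: mf.
  apply/seteqP; split => t /=; rewrite in_itv/=.
    by move=> <-; apply: truncn_itv; rewrite mulr_ge0.
  by move=> h; apply/eqP; rewrite truncn_eq// mulr_ge0.
rewrite (_ : setT = \bigcup_j D j); last first.
  by apply/seteqP; split => // -[t x] _; exists (Num.truncn (n.+1%:R * `|t|)).
apply/measurable_fun_bigcup => j; first exact: measurableX.
have mI : measurable_fun setT (fun e : borel M^Delta =>
    (\int[law H (j.+1%:R / n.+1%:R) e]_y ext y)%E).
  apply: (@measurable_fun_integral_kernel _ _ (borel M^Delta) (borel M^Delta) R (law H _)) => //.
  by move=> U; exact: measurable_law.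
have mS : measurable_fun setT (fun z : R * borel M => Some z.2 : borel M^Delta).
  exact: (measurableT_comp measurable_some measurable_snd).
apply: (@eq_measurable_fun _ _ _ _ _
  (fun z : R * borel M => (\int[law H (j.+1%:R / n.+1%:R) (Some z.2)]_y ext y)%E)).
  by move=> [t x]; rewrite inE => -[/= ht _]; rewrite /tau ht.
apply: measurable_funTS; exact: (measurableT_comp mI mS).
Qed.

(** The extension of [g] by [0] may be discontinuous at the cemetery. This does no harm: a path that
    is there at time [|t|] stays there, and elsewhere the path is in the open subspace [M]. *)
Let ext_right_continuous w t : ext (X (tau n t)%:E w) @[n --> \oo] --> ext (X `|t|%:E w).
Proof.
case Xt : (X `|t|%:E w) => [x|].
  have N e : 0 < e -> \forall n \near \oo, (Some @` ball x e) (X (tau n t)%:E w).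
    move=> e0; have : nbhs (X `|t|%:E w) (Some @` ball x e).
      rewrite Xt; apply: one_point_compactification_some_nbhs.
      exact: nbhsx_ballx.
    move=> /(@hunt_right_continuous _ _ _ _ H w `|t| (normr_ge0 t))/nbhs_ballP[dl /= dl0 Hdl].
    exists (Num.truncn dl^-1) => // n /= Hn; apply: Hdl; last exact: tau_gt.
    rewrite /ball/= distrC ger0_norm ?subr_ge0 ?(ltW (tau_gt n t))// ltrBlDl.
    apply: le_lt_trans (tau_le n t) _; rewrite ltrD2l invf_plt ?posrE//.
    by apply: lt_le_trans (truncnS_gt _) _; rewrite ler_nat.
  rewrite (_ : ext (Some x) = (g x)%:E)//.
  have gN e : 0 < e -> \forall n \near \oo,
      exists2 y, X (tau n t)%:E w = Some y & `|g x - g y| < e.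
    move=> e0; have : g z @[z --> x] --> g x by exact: cg.
    move=> /cvgrPdist_lt/(_ e e0)/nbhs_ballP[r /= r0 Hr].
    apply: filterS (N _ r0) => n [y xy Xy]; exists y => //.
    exact: Hr.
  apply/fine_cvgP; split.
    by apply: filterS (gN 1 ltr01) => n [y -> _].
  apply/cvgrPdist_lt => e e0.
  by apply: filterS (gN e e0) => n [y /= -> ].
have -> : (fun n => ext (X (tau n t)%:E w)) = cst 0%E.
  apply/funext => n; suff -> : X (tau n t)%:E w = None by [].
  apply: contrapT => Xn; move: Xt.
  exact: alive_before Xn (normr_ge0 t) (ltW (tau_gt n t)).
exact: cvg_cst.
Qed.

Lemma measurable_law_test : measurable_fun setT
  (fun z : R * borel M => (\int[law H z.1 (Some z.2)]_y ext y)%E).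
Proof.
apply: (emeasurable_fun_cvg (fun n (z : R * borel M) =>
   (\int[law H (tau n z.1) (Some z.2)]_y ext y)%E)) => //.
move=> [t x] _ /=.
have tau0 n : 0 <= tau n t by rewrite ltW// (le_lt_trans _ (tau_gt n t)).
rewrite integral_law; under eq_fun do rewrite integral_law ger0_norm//.
have [] := @dominated_convergence _ Omega R (P (Some x)) setT measurableT
  (fun n w => ext (X (tau n t)%:E w)) (fun w => ext (X `|t|%:E w)) (cst 1%E).
- by move=> n; exact: (measurableT_comp mext (mX (tau0 n))).
- exact: (measurableT_comp mext (mX (normr_ge0 t))).
- by apply: nearW => w _; exact: ext_right_continuous.
- exact: finite_measure_integrable_cst.
- by apply: nearW => w n _; exact: ext1.
by move=> _ _.
Qed.

End test_function.

(** The indicator of [G] is the limit of the continuous functions [g k], multiples of the distance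
    to the complement cut at [1]. *)
Let measurable_law_open (G : set M) : open G -> measurable_fun setT
  (fun z : R * borel M => law H z.1 (Some z.2) (Some @` G)).
Proof.
move=> oG; pose g (k : nat) x := Num.min 1 (k%:R * clipped_distance G x).
have g0 k x : 0 <= g k x.
  by rewrite le_min ler01 mulr_ge0// clipped_distance_ge0.
have g1 k x : g k x <= 1 by rewrite ge_min lexx.
have cg k : continuous (g k).
  move=> x; apply/cvgrPdist_lt => e e0.
  have e'0 : 0 < e / k.+1%:R by rewrite divr_gt0.
  have := @continuous_clipped_distance _ _ G x.
  move=> /cvgrPdist_lt/(_ _ e'0); apply: filterS => y.
  rewrite ltr_pdivlMr// => h; apply: le_lt_trans h.
  have : `|k%:R * clipped_distance G x - k%:R * clipped_distance G y| <=
      `|clipped_distance G x - clipped_distance G y| * k.+1%:R.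
    by rewrite -mulrBr normrM mulrC ler_wpM2l// ger0_norm// ler_nat.
  apply: le_trans; rewrite /g /Num.min; set p := k%:R * _; set q := k%:R * _.
  case: ifPn => hp; case: ifPn => hq; rewrite -?leNgt in hp hq; rewrite ?subrr ?normr0 ?lexx//;
    (have [pq|pq] := leP 0 (p - q); [rewrite [leRHS]ger0_norm//|rewrite [leRHS]ltr0_norm//]);
    rewrite ler_norml; lra.
have mSG : measurable (Some @` G : set (borel M^Delta)).
  by apply: measurable_some_image; exact: open_borel.
pose e_ k (e : M^Delta) : \bar R := if e is Some x then (g k x)%:E else 0%E.
apply: (emeasurable_fun_cvg (fun k (z : R * borel M) =>
   (\int[law H z.1 (Some z.2)]_y e_ k y)%E)) => //.
  by move=> k; exact: measurable_law_test.
move=> [t x] _ /=.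
have -> : law H t (Some x) (Some @` G) =
    (\int[law H t (Some x)]_y (\1_(Some @` G : set (borel M^Delta)) y)%:E)%E.
  by rewrite integral_indic// setIT.
have me k : measurable_fun setT (e_ k : borel M^Delta -> \bar R).
  apply: measurable_fun_option; apply/measurable_EFinP.
  move=> _; apply: (measurability _ (RGenOpens.measurableE R)) => //.
  move=> _ [_ [a [b ->]] <-]; rewrite setTI; apply: open_borel.
  by move/continuousP : (cg k); apply; exact: interval_open.
have [] := @dominated_convergence _ (borel M^Delta) R (law H t (Some x)) setT measurableT
  e_ (fun y => (\1_(Some @` G : set (borel M^Delta)) y)%:E) (cst 1%E).
- by move=> k; exact: me.
- by apply/measurable_EFinP; exact: measurable_indic.
- apply: nearW => -[y|] _; last first.
    rewrite (_ : \1__ None = 0) ?indicE ?memNset//; last by case.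
    exact: cvg_cst.
  have [Gy|nGy] := pselect (G y); last first.
    rewrite indicE memNset/=; last by move=> [z Gz [zy]]; apply: nGy; rewrite -zy.
    rewrite (_ : (fun k => _) = cst 0%E); first exact: cvg_cst.
    by apply/funext => k; rewrite /= /g clipped_distance_eq0// mulr0 min_r.
  rewrite indicE mem_set/=; last by exists y.
  apply: cvg_near_cst; exists (Num.truncn (clipped_distance G y)^-1).+1 => // k /= Hk.
  have d0 := clipped_distance_gt0 oG Gy.
  rewrite /g min_l// -ler_pdivrMr// mul1r ltW//.
  by apply: lt_le_trans (truncnS_gt _) _; rewrite ler_nat.
- apply/integrableP; split => //.
  rewrite (_ : (\int[_]_x _)%E = (1 * law H t (Some x) setT)%E); last first.
    by rewrite -integral_cst//; apply: eq_integral => y _; rewrite gee0_abs.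
  by rewrite lawT mule1 ltry.
- apply: nearW => -[y|] k _; last by rewrite /e_ abse0.
  by rewrite /e_ lee_fin ger0_norm.
by move=> _ _.
Qed.

Lemma measurable_joint_law (A : set (borel M)) : measurable A ->
  measurable_fun setT
    (fun z : R * borel M => law H z.1 (Some z.2) (Some @` A)).
Proof.
pose D : set (set (borel M)) := [set A : set (borel M) | measurable A /\ measurable_fun setT
    (fun z : R * borel M => law H z.1 (Some z.2) (Some @` A))].
suff DA : <<s (@open M) >> `<=` D by move=> /DA[].
apply: (@lambda_system_subset _ (@open M)) => //.
- by move=> B C; exact: openI.
- split => //.
  + by split; [exact: measurableT|apply: measurable_law_open; exact: openT].
  + move=> B C CB [mB HB] [mC HC]; split; first exact: measurableD.
    rewrite (_ : (fun z => _) = (fun z => law H z.1 (Some z.2) (Some @` B) -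
        law H z.1 (Some z.2) (Some @` C))%E); first exact: emeasurable_funB.
    apply/funext => z.
    rewrite (_ : Some @` (B `\` C) = Some @` B `\` Some @` C); last first.
      apply/seteqP; split => x /=.
        by move=> [y [By nCy] <-]; split; [exists y|case=> u Cu [uy]; apply: nCy; rewrite -uy].
      by move=> [[y By <-] nCy]; exists y => //; split => // Cy; apply: nCy; exists y.
    rewrite measureD; [|exact: measurable_some_image|exact: measurable_some_image|].
    + by rewrite setIidr//; exact: image_subset.
    + apply: le_lt_trans (_ : law H z.1 (Some z.2) setT < +oo)%E.
        by apply: le_measure; rewrite ?inE//; exact: measurable_some_image.
      by rewrite lawT ltry.
  + move=> F ndF DF; split; first by apply: bigcupT_measurable => n; have [] := DF n.
    have mSF n : measurable (Some @` F n : set (borel M^Delta)).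
      by apply: measurable_some_image; have [] := DF n.
    apply: (emeasurable_fun_cvg (fun n (z : R * borel M) =>
      law H z.1 (Some z.2) (Some @` F n))) => //; first by move=> n; have [] := DF n.
    move=> z _; rewrite image_bigcup; apply: nondecreasing_cvg_mu => //.
      exact: bigcupT_measurable.
    move=> n m nm; apply/subsetPset; apply: image_subset.
    by apply/subsetPset; exact: ndF.
- by move=> G oG; split; [exact: open_borel|exact: measurable_law_open].
Qed.

End joint_measurability.

(** * Truncated densities *)

Section density_tools.
Context {dd : measure_display} {T : measurableType dd} {R : realType}.
Local Open Scope ereal_scope.

Lemma radon_nikodym_real (nu : {measure set T -> \bar R})
    (mu : {sigma_finite_measure set T -> \bar R}) :
  nu setT < +oo ->
  (forall A, measurable A -> mu A = 0 -> nu A = 0) ->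
  exists f : T -> R, [/\ measurable_fun setT f, forall y, (0 <= f y)%R &
    forall A, measurable A -> nu A = \int[mu]_(y in A) (f y)%:E].
Proof.
move=> nuT numu.
have E A : measurable A -> mfrestr measurableT nuT A = nu A.
  by move=> mA; rewrite /mfrestr /mrestr/= setIT.
have dom : mfrestr measurableT nuT `<< mu.
  apply/null_content_dominatesP => A mA mA0; rewrite E//; exact: numu.
have [f [f0 ffin intf fE]] := radon_nikodym_sigma_finite dom.
exists (fine \o f); split.
- apply: measurableT_comp => //; exact: measurable_int intf.
- by move=> y; rewrite fine_ge0.
move=> A mA; rewrite -E// fE//; apply: eq_integral => y _.
by rewrite /= fineK.
Qed.

(** On the set where [h < f] the integral of [f] is at most that of [h] by hypothesis and at least
    it pointwise, so replacing [f] by [h] there changes nothing. No finiteness is used. *)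
Lemma integral_mine (mu : {measure set T -> \bar R}) (f h : T -> \bar R)
    (A : set T) :
  measurable A -> measurable_fun A f -> measurable_fun A h ->
  (forall y, A y -> 0 <= f y) -> (forall y, A y -> 0 <= h y) ->
  (forall E, measurable E -> E `<=` A ->
    \int[mu]_(y in E) f y <= \int[mu]_(y in E) h y) ->
  \int[mu]_(y in A) mine (f y) (h y) = \int[mu]_(y in A) f y.
Proof.
move=> mA mf mh f0 h0 fh; pose E := A `&` [set y | h y < f y].
have mE : measurable E by exact: emeasurable_fun_lt.
pose G := A `\` E; have mG : measurable G by exact: measurableD.
have AE : A = G `|` E by rewrite setUC setDUK//; exact: subIsetl.
have GE : [disjoint G & E] by rewrite disj_set2E setDKI.
have EA : E `<=` A by exact: subIsetl.
have GA : G `<=` A by exact: subDsetl.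
have mmin : measurable_fun A (fun y => mine (f y) (h y)) by exact: measurable_mine.
have min0 y : A y -> 0 <= mine (f y) (h y).
  by move=> Ay; rewrite le_min f0// h0.
have -> : \int[mu]_(y in A) f y = \int[mu]_(y in G) f y + \int[mu]_(y in E) f y.
  by rewrite {1}AE ge0_integral_setU -?AE.
have -> : \int[mu]_(y in A) mine (f y) (h y) =
    \int[mu]_(y in G) mine (f y) (h y) + \int[mu]_(y in E) mine (f y) (h y).
  by rewrite {1}AE ge0_integral_setU -?AE.
congr (_ + _).
  apply: eq_integral => y; rewrite inE => -[Ay nEy]; apply/min_idPl.
  by rewrite leNgt; apply/negP => hf; apply: nEy.
have -> : \int[mu]_(y in E) mine (f y) (h y) = \int[mu]_(y in E) h y.
  by apply: eq_integral => y; rewrite inE => -[Ay hf]; apply/min_idPr/ltW.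
apply/eqP; rewrite eq_le fh// andbT; apply: ge0_le_integral => //.
- by move=> y /EA; exact: h0.
- exact: measurable_funS mh.
- exact: measurable_funS mf.
- by move=> y [_ /ltW].
Qed.

End density_tools.

Section local_bound.
Context {R : realType} {M : pmetricType R}.
Hypothesis sepM : separable_space M.
Local Open Scope ereal_scope.

Lemma le_integral_of_local (nu : {measure set (borel M) -> \bar R})
    (mu : {measure set (borel M) -> \bar R}) (V : set (borel M))
    (h : borel M -> \bar R) (del : R) :
  (0 < del)%R -> measurable V -> measurable_fun V h -> (forall w, V w -> 0 <= h w) ->
  (forall y0 (A : set (borel M)), V y0 -> measurable A -> A `<=` V ->
     (forall z, A z -> (mdist y0 z < del)%R) -> nu A <= \int[mu]_(w in A) h w) ->
  forall A, measurable A -> A `<=` V -> nu A <= \int[mu]_(w in A) h w.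
Proof.
move=> del0 mV mh h0 loc A mA AV; have [q Hq] := dense_sequence sepM.
pose B n : set (borel M) := A `&` [set z | (mdist (q n) z < del / 2)%R].
have mB n : measurable (B n).
  by apply: measurableI => //; apply: open_borel; exact: open_mdist_ball.
have AB : A = \bigcup_n seqDU B n.
  rewrite -seqDU_bigcup_eq; apply/seteqP; split => [z Az|z [n _ []//]].
  have [n hn] := Hq z (del / 2)%R (divr_gt0 del0 (ltr0n _ 2)).
  by exists n => //; split => //=; rewrite metric_sym.
have mD n : measurable (seqDU B n) by exact: seqDU_measurable.
have tD : trivIset setT (seqDU B) by exact: trivIset_seqDU.
have DA n : seqDU B n `<=` A by move=> z /(subset_seqDU (A := B))[].
have -> : nu A = \sum_(n <oo) nu (seqDU B n).
  rewrite {1}AB measure_semi_bigcup// -?AB//.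
have -> : \int[mu]_(w in A) h w = \sum_(n <oo) \int[mu]_(w in seqDU B n) h w.
  rewrite {1}AB ge0_integral_bigcup//.
  - by rewrite -AB; exact: measurable_funS mh.
  - by rewrite -AB => w /AV; exact: h0.
apply: lee_nneseries => // n _.
(* The centres [q n] need not lie in [V]. Any point of [V] within [del / 2] of the centre serves
   instead, and if there is none the piece is empty. *)
have [[y0 [Vy0 y0q]]|none] := pselect (exists y0, V y0 /\ (mdist (q n) y0 < del / 2)%R).
  apply: (loc y0) => //; first by move=> z /DA/AV.
  move=> z /(subset_seqDU (A := B))[_ /= zq].
  have := metric_triangle y0 (q n) z; rewrite (metric_sym y0 (q n)) => tri.
  by apply: le_lt_trans tri _; rewrite (splitr del) ltrD.
rewrite (_ : seqDU B n = set0) ?measure0 ?integral_set0//.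
rewrite -subset0 => z Dz; apply: none; exists z; split; first exact: AV (DA _ _ Dz).
by have [] := subset_seqDU Dz.
Qed.

Lemma open_inner_set (U : set M) (r : R) : open (inner_set U r).
Proof.
rewrite openE => x; rewrite /inner_set/= => rx.
have [e [e0 he]] : exists e : R, (0 < e)%R /\ forall y, ~ U y -> (r + e <= mdist x y)%R.
  have [s rs sx] : exists2 s : R, (r < s)%R & s%:E <= ereal_inf [set (mdist x y)%:E | y in ~` U].
    case: (ereal_inf _) rx => [s| |]//=; first by rewrite lte_fin => rs; exists s.
    by move=> _; exists (r + 1)%R; rewrite ?leey// ltrDl.
  exists (s - r)%R; rewrite subr_gt0; split => // y Uy.
  rewrite addrC subrK -lee_fin; apply: le_trans sx _.
  by apply: ereal_inf_lbound; exists y.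
apply/nbhs_ballP; exists (e / 2)%R; first by rewrite /= divr_gt0.
move=> z; rewrite ballEmdist/= => xz.
apply: (@lt_le_trans _ _ (r + e / 2)%:E); first by rewrite lte_fin ltrDl divr_gt0.
apply: le_ereal_inf_tmp => _ [y Uy <-]; rewrite lee_fin.
by have := metric_triangle x z y; have := he y Uy; move: xz; lra.
Qed.

Lemma inner_setP (U : set M) (r : R) y z :
  inner_set U r y -> (mdist y z <= r)%R -> U z.
Proof.
rewrite /inner_set/= => ry yz; apply: contrapT => Uz.
move: ry; rewrite ltNge => /negP; apply.
apply: le_trans (_ : (mdist y z)%:E <= _); last by rewrite lee_fin.
by apply: ereal_inf_lbound; exists z.
Qed.

End local_bound.

Section subkernel.
Context {R : realType} {M : pmetricType R} {d : measure_display}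
  {Omega : measurableType d}.
Variables (H : hunt_process M Omega) (V : set (borel M)).
Hypothesis mV : measurable V.
Local Open Scope ereal_scope.

(** Intersecting with [V] gives a measure on all of [M], and the pair of time and starting point is
    the kernel parameter, so that the density is measurable in time as well. *)
Definition restricted_law (z : R * borel M) (A : set (borel M)) : \bar R :=
  law H z.1 (Some z.2) (Some @` (A `&` V)).

Section measure.
Variable z : R * borel M.

Let law0 : restricted_law z set0 = 0.
Proof. by rewrite /restricted_law set0I image_set0 measure0. Qed.

Let law_ge0 A : 0 <= restricted_law z A.
Proof. exact: measure_ge0. Qed.

Let law_sigma_additive : semi_sigma_additive (restricted_law z).
Proof.
move=> F mF tF mUF; rewrite /restricted_law setI_bigcupl image_bigcup.
apply: measure_semi_sigma_additive.
- by move=> n; apply: measurable_some_image; exact: measurableI.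
- apply/trivIsetP => /= i j _ _ ij.
  move/trivIsetP : tF => /(_ _ _ I I ij) Fij.
  rewrite -subset0 => _ [[y [Fiy _] <-] [y' [Fjy' _] [yy']]].
  suff : (F i `&` F j) y by rewrite Fij.
  by split => //; rewrite -yy'.
- rewrite -image_bigcup -setI_bigcupl; apply: measurable_some_image.
  exact: measurableI.
Qed.

HB.instance Definition _ := isMeasure.Build _ _ _ (restricted_law z)
  law0 law_ge0 law_sigma_additive.

End measure.

Lemma restricted_law_fin z : restricted_law z setT < +oo.
Proof.
apply: le_lt_trans (ltry 1); apply: probability_le1; apply: measurable_hunt => //.
by apply: measurable_some_image; exact: measurableI.
Qed.

Lemma restricted_lawE (t : R) (x : M) A : (0 <= t)%R -> A `<=` V ->
  restricted_law (t, x) A = transition H t x A.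
Proof.
by move=> t0 AV; rewrite /restricted_law /law /transition/= ger0_norm// setIidl.
Qed.

Lemma transition_le_of_local (sepM : separable_space M)
    (mu : {measure set (borel M) -> \bar R}) (h : borel M -> \bar R) (del t : R)
    (x : M) :
  (0 < del)%R -> (0 <= t)%R -> measurable_fun V h -> (forall w, V w -> 0 <= h w) ->
  (forall y0 (A : set (borel M)), V y0 -> measurable A -> A `<=` V ->
     (forall z, A z -> (mdist y0 z < del)%R) ->
     transition H t x A <= \int[mu]_(w in A) h w) ->
  forall A, measurable A -> A `<=` V -> transition H t x A <= \int[mu]_(w in A) h w.
Proof.
move=> del0 t0 mh h0 loc A mA AV; rewrite -restricted_lawE//.
apply: (le_integral_of_local sepM (nu := restricted_law (t, x)) del0 mV) => //.
move=> y0 A' Vy0 mA' AV' Ad.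
suff : restricted_law (t, x) A' <= \int[mu]_(w in A') h w by [].
rewrite restricted_lawE//; exact: (loc y0).
Qed.

(* A kernel density dominated by [h] off null sets is truncated at [h]. *)
Lemma transition_density (sepM : separable_space M)
    (mu : {sigma_finite_measure set (borel M) -> \bar R})
    (N : set (borel M)) (h : R -> M -> M -> R) :
  let D := [set z : R * borel M * borel M | [/\ (0 < z.1.1)%R, ~ N z.1.2 & V z.2]] in
  measurable D -> measurable_fun D (fun z => h z.1.1 z.1.2 z.2) ->
  (forall t x w, (0 < t)%R -> ~ N x -> V w -> (0 <= h t x w)%R) ->
  (forall t x (A : set (borel M)), (0 < t)%R -> ~ N x -> measurable A -> A `<=` V ->
     transition H t x A <= \int[mu]_(w in A) (h t x w)%:E) ->
  exists p : R -> M -> M -> R,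
  [/\ measurable_fun D (fun z => p z.1.1 z.1.2 z.2),
      (forall t x y, (0 < t)%R -> ~ N x -> V y -> (0 <= p t x y)%R),
      (forall t x (A : set (borel M)), (0 < t)%R -> ~ N x ->
         measurable A -> A `<=` V ->
         (transition H t x A = \int[mu]_(y in A) (p t x y)%:E)%E)
    & forall t x y, (0 < t)%R -> ~ N x -> V y -> (p t x y <= h t x y)%R].
Proof.
move=> D mD mh h0 le_h.
have hsec t x (A : set (borel M)) : (0 < t)%R -> ~ N x -> measurable A -> A `<=` V ->
    measurable_fun A (fun w : borel M => (h t x w)%:E).
  move=> t0 Nx mA AV; apply/measurable_EFinP.
  have mp : measurable_fun A (fun w : borel M => ((t : R, x : borel M), w)).
    exact: measurable_funTS (measurable_pair1 _).
  by apply: (measurable_comp mD _ mh mp) => _ [w /AV Vw <-].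
have [Al cA] := borel_countable_algebra sepM.
have mK B : measurable B -> measurable_fun setT (fun z => restricted_law z B).
  by move=> mB; apply: measurable_joint_law => //; exact: measurableI.
have [g [mg g0 gE]] := kernel_density cA mu mK.
have KE t x A : (0 < t)%R -> ~ N x -> measurable A -> A `<=` V ->
    transition H t x A = \int[mu]_(y in A) g ((t, x), y).
  move=> t0 Nx mA AV; rewrite -restricted_lawE ?(ltW t0)//.
  have [|f [mf f0 fE]] := @radon_nikodym_real _ _ _ (restricted_law (t, x)) mu
    (restricted_law_fin _).
    move=> B mB muB; apply/eqP; rewrite eq_le measure_ge0 andbT.
    have BVV : B `&` V `<=` V by exact: subIsetr.
    suff : restricted_law (t, x) (B `&` V) <= 0.
      by rewrite /restricted_law -setIA setIid.
    rewrite restricted_lawE ?(ltW t0)//; have mBV := measurableI _ _ mB mV.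
    apply: (le_trans (le_h _ _ _ t0 Nx mBV BVV)).
    rewrite null_set_integral//; first exact: hsec.
    exact: subset_measure0 muB.
  by have := gE (t, x) f (restricted_law_fin _) mf f0 fE A mA.
pose p t x y := fine (mine (g ((t, x), y)) (h t x y)%:E).
have pE t x y : (0 < t)%R -> ~ N x -> V y ->
    (p t x y)%:E = mine (g ((t, x), y)) (h t x y)%:E.
  move=> t0 Nx Vy; rewrite /p fineK// ge0_fin_numE.
    by rewrite gt_min ltry orbT.
  by rewrite le_min g0 lee_fin h0.
exists p; split.
- apply: measurableT_comp => //; apply: measurable_mine.
    by apply: measurable_funTS; apply: eq_measurable_fun mg => -[[]].
  exact/measurable_EFinP.
- by move=> t x y t0 Nx Vy; rewrite -lee_fin pE// le_min g0 lee_fin h0.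
- move=> t x A t0 Nx mA AV; rewrite KE//.
  transitivity (\int[mu]_(y in A) mine (g ((t, x), y)) (h t x y)%:E); last first.
    by apply: eq_integral => y; rewrite inE => /AV Vy; rewrite pE.
  rewrite (integral_mine mA)//.
  + apply: measurable_funTS; exact: (measurableT_comp mg (measurable_pair1 _)).
  + exact: hsec.
  + by move=> y /AV Vy; rewrite lee_fin h0.
  + move=> E mE EA; have EV : E `<=` V by exact: subset_trans AV.
    by rewrite -KE// le_h.
- by move=> t x y t0 Nx Vy; rewrite -lee_fin pE// ge_min lexx orbT.
Qed.

End subkernel.

(** * Heat kernel bounds *)

Section heat_kernel_bound.
Context {R : realType} {M : pmetricType R} {d : measure_display}
  {Omega : measurableType d}.
Variables (H : hunt_process M Omega) (mu : {sigma_finite_measure set (borel M) -> \bar R}).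
Notation X := (hunt_X H).
Notation P := (hunt_P H).
Variables (cPsi beta1 beta2 cF alphaF c gamma eps R0 : R).
Hypotheses (cPsi_gt0 : 0 < cPsi) (beta1_gt1 : 1 < beta1)
  (beta12 : beta1 <= beta2) (cF_gt0 : 0 < cF) (alphaF_gt0 : 0 < alphaF)
  (c_gt0 : 0 < c) (gamma_gt0 : 0 < gamma) (eps_gt0 : 0 < eps) (eps_lt1 : eps < 1)
  (R0_gt0 : 0 < R0).
Variables (N : set (borel M)) (U : set M) (Psi : R -> R) (F : R -> M -> M -> R).
Hypotheses (mN : measurable N) (oU : open U)
  (avoidN : forall x, ~ N x -> {ae P (Some x), forall w, avoids H N w})
  (contN : forall x, ~ N x -> {ae P (Some x), forall w, continuous_path H w}).
Hypothesis gPsi : gauge cPsi beta1 beta2 Psi.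
Hypothesis F_gt0 : forall t x y, 0 < t <= Psi R0 -> U x -> U y -> 0 < F t x y.
Hypothesis mFjoint : measurable_fun
  [set z : R * borel M * borel M | [/\ 0 < z.1.1 <= Psi R0, U z.1.2 & U z.2]]
  (fun z => F z.1.1 z.1.2 z.2).
Hypothesis killed_le : forall t x (A : set (borel M)), 0 < t < Psi R0 ->
  U x -> ~ N x -> measurable A -> A `<=` U ->
  (killed_transition H U t x A <= \int[mu]_(y in A) (F t x y)%:E)%E.
Hypothesis exit_le : forall x r t, U x -> ~ N x -> 0 < r < R0 ->
  ball x r `<=` U -> 0 < t ->
  (completed_prob H x [set w | exit_time X (ball x r) w <= t%:E]
     <= (c * expR (- Phi Psi (gamma * r) t))%:E)%E.

Notation b := (gauge_ratio cPsi beta2).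
(** The rate [3 / 10] is the relative width of the shells. The rates decrease from [3 / 10] to
    [1 / 4] and then to the final [1 / 5]; each gap can absorb a power of [Psi D / t], and the
    second can alternatively pay for replacing [D] by [mdist x w]. *)
Let kappa1 := 3 / 10 * (gamma * eps).
Let kappa2 := 4^-1 * (gamma * eps).
Variables (C0 C1 C2 CV : R).
Hypotheses (C1_gt0 : 0 < C1) (C2_gt0 : 0 < C2) (CV_gt0 : 0 < CV).
Hypothesis Phi_sum : forall D t, 0 < D -> 0 < t -> t <= C0 * Psi D ->
  forall j : nat, ((b^-1) `^ alphaF) ^+ j *
    expR (- Phi Psi (10^-1 ^+ j * (kappa1 * D)) (b ^+ j * t)) <=
  C1 * 2^-1 ^+ j * expR (- Phi Psi (kappa1 * D) t).
Hypothesis Phi_power : forall D t, 0 < D -> 0 < t -> t <= C0 * Psi D ->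
  (Psi D / t) `^ alphaF * expR (- Phi Psi (kappa1 * D) t) <=
  C2 * expR (- Phi Psi (kappa2 * D) t).

(** The [2] is the sum of the powers of one half, [C1] sums the chain, [C2] absorbs the power of
    [Psi D / s0], and [CV / b] compares [V / s_ k.+1] with [Psi D / s_ k]. *)
Definition offdiag_const : R := 2 * c * cF * (CV / b) `^ alphaF * C1 * C2.

Let b_gt0 : 0 < b. Proof. exact: gauge_ratio_gt0. Qed.

Let b_le : b <= 10^-1. Proof. exact: (gauge_ratio_le cPsi beta1_gt1 beta12). Qed.

Lemma offdiag_const_gt0 : 0 < offdiag_const.
Proof. by rewrite /offdiag_const !mulr_gt0// powR_gt0// divr_gt0. Qed.

Let Psi_gt0 r : 0 < r -> 0 < Psi r. Proof. by have [h _ _] := gPsi; exact: h. Qed.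

Let mU : measurable (U : set (borel M)). Proof. exact: open_borel. Qed.

Let measurable_domain_F : measurable
  [set z : R * borel M * borel M | [/\ 0 < z.1.1 <= Psi R0, U z.1.2 & U z.2]].
Proof.
rewrite (_ : [set z | _] = ((`]0, Psi R0] `*` U) `*` U)%classic).
  by apply: measurableX => //; apply: measurableX => //; exact: measurable_itv.
apply/seteqP; split => -[[t x] y]/=; rewrite in_itv/=; first by case.
by move=> [[? ?] ?].
Qed.

Let mF t x : 0 < t <= Psi R0 -> U x ->
  measurable_fun (U : set (borel M)) (fun y : borel M => F t x y).
Proof.
move=> tR Ux; have mp : measurable_fun (U : set (borel M))
    (fun w : borel M => ((t, x : borel M), w)).
  exact: measurable_funTS (measurable_pair1 _).
by apply: (measurable_comp measurable_domain_F _ mFjoint mp) => _ [w Uw <-].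
Qed.

(** * The general estimate at a free length scale *)

Section offdiag.
Variables (x y0 : M) (t s0 D V : R) (kap0 : \bar R) (g : borel M -> R)
  (A Z : set (borel M)).
Hypotheses (Nx : ~ N x) (s0_gt0 : 0 < s0) (s0_lt : s0 < Psi R0) (s0_le : s0 <= t)
  (D_gt0 : 0 < D) (D_le : D <= R0) (s0D : s0 <= C0 * Psi D)
  (y0U : forall z, mdist y0 z <= eps * R0 -> U z)
  (mA : measurable A) (Ay0 : forall z, A z -> mdist y0 z < eps * D / 20)
  (mg : measurable_fun A g) (g0 : forall w, A w -> 0 <= g w)
  (V0 : 0 <= V) (VD : V <= CV * Psi D)
  (Fg : forall s z w, 0 < s <= s0 -> mdist y0 z < eps * D / 2 -> A w ->
     F s z w <= cF * (V / s) `^ alphaF * g w)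
  (mZ : measurable Z)
  (startZ : {ae P (Some x), forall w z, X (t - s0)%:E w = Some z -> Z z})
  (kap0_ge0 : (0 <= kap0)%E)
  (killed_kap0 : forall z, mdist y0 z < eps * D / 2 -> ~ N z -> Z z ->
     (killed_transition H U s0 z A <= kap0)%E).

(* At time [t - s_ k] the path is compared with the ball of radius [rho k] about
   [y0]; the shell between [sg k = rho k.+1 + r_ k] and [rho k] cannot be left
   towards the ball of radius [rho k.+1] without travelling the distance [r_ k]. *)
Let e := eps * D.
Let s_ (k : nat) : R := s0 * b ^+ k.
(** The radii decrease from [e / 2] to [e / 20], the radius of a ball containing [A]. Consecutive
    ones differ by [81 / 200 * e * 10^-1 ^+ k], which leaves room for a jump of length [r_ k]. *)
Let rho (k : nat) : R := e * (20^-1 + 9 / 20 * 10^-1 ^+ k).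
Let r_ (k : nat) : R := 3 / 10 * e * 10^-1 ^+ k.
Let sg (k : nat) : R := rho k.+1 + r_ k.

Let e_gt0 : 0 < e. Proof. by rewrite mulr_gt0. Qed.

Let p10 (k : nat) : 0 < (10^-1 : R) ^+ k <= 1.
Proof. by rewrite exprn_gt0//= exprn_ile1//; lra. Qed.

Let rho0 : rho 0%N = e / 2.
Proof. by rewrite /rho expr0; field. Qed.

Let rho_le k : rho k <= e / 2.
Proof.
rewrite /rho; have /andP[_ h] := p10 k.
have : e * (20^-1 + 9 / 20 * 10^-1 ^+ k) <= e * (20^-1 + 9 / 20 * 1).
  by rewrite ler_pM2l//; lra.
lra.
Qed.

Let rhoS k : rho k.+1 = e * (20^-1 + 9 / 200 * 10^-1 ^+ k).
Proof. by rewrite /rho exprS; field. Qed.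

Let y0_e z : mdist y0 z <= e -> U z.
Proof.
by move=> h; apply: y0U; apply: (le_trans h); rewrite /e ler_pM2l.
Qed.

Let A_U : A `<=` U.
Proof.
move=> z /Ay0 h; apply: y0_e; apply: (le_trans (ltW h)).
by rewrite -/e ler_pdivrMr// ler_peMr ?ler1n// ltW.
Qed.

Let s_gt0 k : 0 < s_ k. Proof. by rewrite mulr_gt0// exprn_gt0. Qed.

Let s_le k : s_ k <= s0.
Proof.
rewrite /s_ ger_pMr// exprn_ile1//; first exact: ltW.
by apply: le_trans b_le _; lra.
Qed.

Let I := (\int[mu]_(w in A) (g w)%:E)%E.

Let I_ge0 : (0 <= I)%E.
Proof. by apply: integral_ge0 => w Aw; rewrite lee_fin g0. Qed.

Let kap (k : nat) : \bar R := if k is k'.+1 then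
  ((cF * (V / s_ k) `^ alphaF)%:E * I)%E else kap0.

Let pi (k : nat) : R := c * expR (- Phi Psi (gamma * r_ k) (s_ k)).

Let killed_kap k z : mdist y0 z < rho k -> ~ N z -> (k = 0%N -> Z z) ->
  (killed_transition H U (s_ k) z A <= kap k)%E.
Proof.
case: k => [|k] zr Nz Zz.
  rewrite /s_ expr0 mulr1; apply: killed_kap0 => //; last exact: Zz.
  by rewrite rho0 /e in zr.
have zU : U z.
  apply: y0_e; apply: (le_trans (ltW zr)); apply: (le_trans (rho_le _)).
  by rewrite ler_pdivrMr// ler_peMr ?ler1n// ltW.
have sk : 0 < s_ k.+1 < Psi R0 by rewrite s_gt0 (le_lt_trans (s_le _)).
apply: le_trans (killed_le sk zU Nz mA A_U) _.
rewrite /kap /I -ge0_integralZl//; last 2 first.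
- by apply/measurable_EFinP.
- by rewrite lee_fin mulr_ge0 ?powR_ge0// ltW.
have sk' : 0 < s_ k.+1 <= Psi R0 by have /andP[-> /ltW] := sk.
apply: ge0_le_integral => //.
- by move=> w /A_U Uw; rewrite lee_fin ltW// F_gt0.
- apply/measurable_EFinP; apply: measurable_funS (mF sk' zU) => //.
- by apply: measurable_funeM; apply/measurable_EFinP.
- move=> w Aw; rewrite -EFinM lee_fin; apply: Fg => //.
    by rewrite s_gt0 s_le.
  by apply: lt_le_trans zr _; rewrite rho_le.
Qed.

(** A point of the shell is at distance more than [r_ k] from the ball of radius [rho k.+1], so
    reaching that ball means leaving [ball z (r_ k)]. This ball lies in [U] because
    [e / 2 + 3 / 10 * e < e]. *)
Let crossing_pi k z u : sg k < mdist y0 z < rho k -> ~ N z -> 0 <= u <= s_ k ->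
  (P (Some z) (X u%:E @^-1`
     (Some @` ([set z | (mdist y0 z < rho k.+1)%R] `\` N))) <= (pi k)%:E)%E.
Proof.
move=> /andP[sz zr] Nz /andP[u0 us].
have /andP[p0 p1] := p10 k.
have rk0 : 0 < r_ k by rewrite !mulr_gt0.
have rke : r_ k <= 3 / 10 * e.
  by rewrite /r_ ger_pMr// mulr_gt0.
have eR : e < R0.
  by apply: le_lt_trans (_ : eps * R0 < R0); rewrite ?ler_pM2l// gtr_pMl.
have rkR : 0 < r_ k < R0.
  by rewrite rk0/=; apply: le_lt_trans rke _; move: e_gt0 eR; lra.
have zU : U z.
  by apply: y0_e; move: (rho_le k) zr e_gt0; lra.
have ballU : ball z (r_ k) `<=` U.
  move=> y; rewrite ballEmdist/= => zy; apply: y0_e.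
  by have := metric_triangle y0 z y; move: (rho_le k) zr e_gt0 rke zy; lra.
apply: le_trans (exit_le zU Nz rkR ballU (s_gt0 k)).
apply: (le_completed_prob (C := fun=> True)).
- apply: measurable_hunt => //; apply: measurable_some_image.
  by apply: measurableD => //; apply: open_borel; exact: open_mdist_ball.
- exact: aeW.
move=> w [y [/= yr Ny] Xy] _; apply: (exit_time_le u0 us).
move=> [y' zy']; rewrite -Xy => -[yy']; move: zy'; rewrite yy' ballEmdist/= => zy.
have := metric_triangle y0 y z; rewrite (metric_sym y z).
by move: sz yr zy; rewrite /sg; lra.
Qed.

(** The killed kernel runs for [s_ k.+1] while the crossing takes [s_ k]; the shift costs one factor
    [b]. The remaining growth [b^-1] to the power [alphaF * k] is beaten by [Phi_sum], and
    [Phi_power] removes the power of [Psi D / s0]. *)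
Let kap_pi k : (kap k.+1 * (pi k)%:E <=
  (c * cF * (CV / b) `^ alphaF * C1 * C2 * expR (- Phi Psi (kappa2 * D) s0) *
   2^-1 ^+ k)%:E * I)%E.
Proof.
rewrite /kap muleAC -EFinM lee_wpmul2r// lee_fin.
have PD0 := Psi_gt0 D_gt0.
have h1 : (V / s_ k.+1) `^ alphaF <=
    (CV / b) `^ alphaF * (Psi D / s0) `^ alphaF * ((b^-1) `^ alphaF) ^+ k.
  rewrite -powR_exprn ?invr_ge0 ?(ltW b_gt0)//.
  rewrite -!powRM ?mulr_ge0 ?exprn_ge0 ?invr_ge0 ?(ltW b_gt0) ?(ltW CV_gt0)
    ?(ltW PD0) ?(ltW s0_gt0)//.
  rewrite ge0_ler_powR ?nnegrE ?(ltW alphaF_gt0)//.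
  - by rewrite divr_ge0// ltW.
  - by rewrite !mulr_ge0 ?exprn_ge0 ?invr_ge0 ?(ltW b_gt0) ?(ltW CV_gt0)
    ?(ltW PD0) ?(ltW s0_gt0).
  rewrite ler_pdivrMr//; apply: le_trans VD _.
  rewrite /s_ exprS exprVn le_eqVlt; apply/orP; left; apply/eqP.
  by field; rewrite !gt_eqF ?exprn_gt0.
have h2 := Phi_sum D_gt0 s0_gt0 s0D k.
have h3 := Phi_power D_gt0 s0_gt0 s0D.
have -> : pi k = c * expR (- Phi Psi (10^-1 ^+ k * (kappa1 * D)) (b ^+ k * s0)).
  have -> : 10^-1 ^+ k * (kappa1 * D) = gamma * r_ k.
    by rewrite /r_ /kappa1 /e; move: (10^-1 ^+ k) => q; ring.
  by rewrite /pi /s_ (mulrC (b ^+ k)).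
set ex := expR (- Phi Psi (10^-1 ^+ k * _) _) in h2 *.
set Lk := (b^-1 `^ alphaF) ^+ k in h1 h2 *.
set E1 := expR (- Phi Psi (kappa1 * D) s0) in h2 h3 *.
set E2 := expR (- Phi Psi (kappa2 * D) s0) in h3 *.
set p := (CV / b) `^ alphaF in h1 *; set q := (Psi D / s0) `^ alphaF in h1 h3 *.
have p0 : 0 <= p by exact: powR_ge0.
have q0 : 0 <= q by exact: powR_ge0.
have ex0 : 0 <= ex by exact: expR_ge0.
apply: (@le_trans _ _ (cF * (p * q * Lk) * (c * ex))).
  by rewrite ler_wpM2r ?mulr_ge0 ?(ltW c_gt0)// ler_wpM2l// ltW.
apply: (@le_trans _ _ (cF * c * p * q * (C1 * 2^-1 ^+ k * E1))).
  rewrite [leLHS](_ : _ = cF * c * p * q * (Lk * ex)); last by ring.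
  by rewrite ler_wpM2l// !mulr_ge0 ?(ltW c_gt0) ?(ltW cF_gt0).
rewrite [leLHS](_ : _ = cF * c * p * C1 * 2^-1 ^+ k * (q * E1)); last by ring.
rewrite [leRHS](_ : _ = cF * c * p * C1 * 2^-1 ^+ k * (C2 * E2)); last by ring.
by rewrite ler_wpM2l// !mulr_ge0 ?exprn_ge0 ?(ltW c_gt0) ?(ltW cF_gt0) ?(ltW C1_gt0).
Qed.

(** The function [g] is the reference to which all values of [F] are compared. The first term covers
    paths already close to [y0] at time [t - s0]; it vanishes with [kap0] when [Z] excludes such a
    position. *)
Lemma offdiag_bound : (P (Some x) (X t%:E @^-1` (Some @` A)) <=
  kap0 * P (Some x) (X (t - s0)%:E @^-1`
    (Some @` (([set z | (mdist y0 z < eps * D / 2)%R] `\` N) `&` Z))) +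
  (offdiag_const * expR (- Phi Psi (kappa2 * D) s0))%:E * \int[mu]_(w in A) (g w)%:E)%E.
Proof.
have kap_ge0 k : (0 <= kap k)%E.
  by case: k => //= k; rewrite mule_ge0// lee_fin mulr_ge0 ?powR_ge0// ltW.
have s00 : s_ 0%N = s0 by rewrite /s_ expr0 mulr1.
have bound : (P (Some x) (X t%:E @^-1` (Some @` A)) <=
    kap 0%N * P (Some x) (X (t - s_ 0%N)%:E @^-1`
      (Some @` (([set z | (mdist y0 z < rho 0%N)%R] `\` N) `&` Z))) +
    \sum_(k <oo) kap k.+1 * (pi k)%:E)%E.
  apply: (chain_bound mN oU avoidN contN Nx s_gt0 _ _ _ _ _ _ _ mZ _ mA _
     kap_ge0 _ killed_kap crossing_pi (rhoo := e / 20)).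
  - move=> k; rewrite /s_ exprS mulrCA ger_pMl ?mulr_gt0 ?exprn_gt0//.
    by apply: le_trans b_le _; lra.
  - by rewrite s00.
  - move=> dl dl0; have /cvgrPdist_lt : b ^+ k @[k --> \oo] --> (0 : R).
      apply: cvg_expr; rewrite ger0_norm ?(ltW b_gt0)//.
      by apply: le_lt_trans b_le _; lra.
    move=> /(_ (dl / s0) (divr_gt0 dl0 s0_gt0))[k _ /(_ k (leqnn k))]/=.
    rewrite sub0r normrN ger0_norm ?exprn_ge0 ?(ltW b_gt0)// ltr_pdivlMr// => h.
    by exists k; rewrite /s_ mulrC.
  - move=> k; rewrite /sg lerDl; have /andP[h _] := p10 k.
    by apply/ltW; rewrite /r_ mulr_gt0// mulr_gt0.
  - move=> k; rewrite /sg rhoS /rho /r_.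
    have : 0 < e * 10^-1 ^+ k by have /andP[h _] := p10 k; rewrite mulr_gt0.
    lra.
  - move=> k; rewrite /rho ler_pM2l// lerDl.
    by have /andP[h _] := p10 k; rewrite mulr_ge0// ltW.
  - move=> z; rewrite rho0 => h; apply: y0_e.
    by move: h e_gt0; lra.
  - by rewrite s00.
  - by move=> z /Ay0.
  - by move=> k; rewrite mulr_ge0 ?expR_ge0// ltW.
apply: (le_trans bound); rewrite s00 rho0; apply: leeD => //.
apply: (@le_trans _ _ (\sum_(k <oo) (c * cF * (CV / b) `^ alphaF * C1 * C2 *
    expR (- Phi Psi (kappa2 * D) s0) * 2^-1 ^+ k)%:E * I)%E).
  apply: lee_nneseries => [k _ _|k _]; last exact: kap_pi.
  by rewrite mule_ge0// lee_fin mulr_ge0 ?expR_ge0// ltW.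
set K := c * cF * _ * C1 * C2 * _.
have K0 : 0 < K by rewrite /K !mulr_gt0 ?powR_gt0 ?expR_gt0// divr_gt0.
have -> : offdiag_const * expR (- Phi Psi (kappa2 * D) s0) = 2 * K.
  by rewrite /offdiag_const /K; ring.
have sum2 : (\sum_(k <oo) (K * 2^-1 ^+ k)%:E = (2 * K)%:E)%E.
  have := @cvg_geometric_eseries_half R (2 * K) 0 => /cvg_lim.
  rewrite expr0 divr1 => <- //; apply: eq_eseriesr => k _; congr EFin.
  by rewrite addn1 natrX exprVn exprS; field; rewrite expf_neq0.
(* A constant is pulled out of the series only when it is finite; for an infinite integral the
   right-hand side is infinite. *)
have [Ioo|Ioo] := eqVneq I +oo%E.
  by rewrite -/I Ioo gt0_muley ?leey// lte_fin mulr_gt0.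
have fI : I \is a fin_num by rewrite ge0_fin_numE// ltey.
rewrite -/I -(fineK fI) [in leRHS]muleC.
under eq_eseriesr do rewrite muleC.
by rewrite nneseriesZl ?sum2// => k _; rewrite lee_fin mulr_ge0 ?exprn_ge0// ltW.
Qed.

End offdiag.

(** * From the general estimate to the separate regimes *)

Hypothesis F_scale : forall t x y s z w, 0 < t <= Psi R0 -> U x -> U y ->
  0 < s <= Psi R0 -> U z -> U w -> s <= t ->
  F s z w / F t x y <=
  cF * (Num.max (Num.max t (Psi (mdist x z))) (Psi (mdist y w)) / s) `^ alphaF.
Hypotheses (diamU : forall x y, U x -> U y -> mdist x y <= R0) (Psi0 : Psi 0 = 0).
Variables (C4 B : R).
Hypotheses (C4_gt0 : 0 < C4) (C0_ge : Num.max 1 cPsi <= C0)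
  (CV_ge : Num.max 1 cPsi * (1 + cPsi * 2 `^ beta2) <= CV).
Hypothesis Phi_final : forall D t, 0 < D -> 0 < t -> t <= C0 * Psi D ->
  (Psi D / t) `^ alphaF * expR (- Phi Psi (kappa2 * D) t) <=
  C4 * expR (- Phi Psi (5^-1 * eps * gamma * D) t).
Hypothesis Phi_near : forall D, 0 < D ->
  Phi Psi (2 * (5^-1 * eps * gamma) * D) (Psi D) <= B.

Let K := Num.max 1 cPsi.
Let gammaeps := 5^-1 * eps * gamma.

Let K_ge1 : 1 <= K. Proof. by rewrite le_max lexx. Qed.

Let K_gt0 : 0 < K. Proof. exact: lt_le_trans ltr01 K_ge1. Qed.

Let gammaeps_gt0 : 0 < gammaeps.
Proof. by rewrite /gammaeps !mulr_gt0. Qed.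

Let Psi_mono r r' : 0 <= r -> r <= r' -> 0 < r' -> Psi r <= K * Psi r'.
Proof.
rewrite le_eqVlt => /orP[/eqP <- _ r'0|r0 rr' r'0].
  by rewrite Psi0 mulr_ge0// ltW// Psi_gt0.
apply: le_trans (gauge_quasi_monotone cPsi_gt0 beta1_gt1 gPsi r0 rr') _.
by rewrite ler_pM2r ?Psi_gt0// le_max lexx orbT.
Qed.

Let F_le t x y s z w V : 0 < t <= Psi R0 -> U x -> U y -> 0 < s <= t ->
  U z -> U w -> t <= V -> Psi (mdist x z) <= V -> Psi (mdist y w) <= V ->
  F s z w <= cF * (V / s) `^ alphaF * F t x y.
Proof.
move=> tR Ux Uy /andP[s0 st] Uz Uw tV xzV ywV.
have sR : 0 < s <= Psi R0 by rewrite s0 (le_trans st)//; case/andP: tR.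
rewrite -ler_pdivrMr ?F_gt0//; apply: (le_trans (F_scale tR Ux Uy sR Uz Uw st)).
rewrite ler_pM2l// ge0_ler_powR ?nnegrE ?(ltW alphaF_gt0)//.
- apply: divr_ge0; last exact: ltW.
  by rewrite !le_max (le_trans (ltW s0) st).
- by rewrite divr_ge0 ?(ltW s0)// (le_trans _ tV)// (le_trans (ltW s0)).
- by rewrite ler_pM2r ?invr_gt0// !ge_max tV xzV ywV.
Qed.

Let PsiR0_gt0 : 0 < Psi R0. Proof. exact: Psi_gt0. Qed.

Let F_le_diam t x y s z w : 0 < t <= Psi R0 -> U x -> U y -> 0 < s <= t ->
  U z -> U w -> F s z w <= cF * (K * Psi R0 / s) `^ alphaF * F t x y.
Proof.
move=> tR Ux Uy st Uz Uw; apply: F_le => //.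
- by have /andP[_ h] := tR; apply: (le_trans h); rewrite ler_peMl// ltW.
- by apply: Psi_mono => //; rewrite ?mdist_ge0 ?diamU.
- by apply: Psi_mono => //; rewrite ?mdist_ge0 ?diamU.
Qed.

Let KCV D : 0 < D -> K * Psi D <= CV * Psi D.
Proof.
move=> D0; rewrite ler_pM2r ?Psi_gt0//; apply: le_trans CV_ge.
by rewrite ler_peMr ?(ltW K_gt0)// lerDl mulr_ge0 ?powR_ge0// ltW.
Qed.

Let Phi0 rho t : 0 <= rho -> 0 < t -> 0 <= Phi Psi rho t.
Proof. exact: (Phi_ge0 cPsi_gt0 beta1_gt1 gPsi). Qed.

Let Phi_le_mono rho rho' t : 0 <= rho -> rho <= rho' -> 0 < t ->
  Phi Psi rho t <= Phi Psi rho' t.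
Proof.
by move=> r0 rr t0; apply: (Phi_mono cPsi_gt0 beta1_gt1 gPsi).
Qed.

Let P_le1 x y0 r t (Z : set (borel M)) : 0 <= t -> measurable Z ->
  (P (Some x) (X t%:E @^-1`
    (Some @` (([set z | (mdist y0 z < r)%R] `\` N) `&` Z))) <= 1)%E.
Proof.
move=> t0 mZ; apply: probability_le1; apply: measurable_hunt => //.
apply: measurable_some_image; apply: measurableI => //.
by apply: measurableD => //; apply: open_borel; exact: open_mdist_ball.
Qed.

Let start_at (x : M) (t : R) :
  {ae P (Some x), forall w z, X (t - t)%:E w = Some z -> [set x] z}.
Proof.
have mx := measurable_hunt H (lexx 0) (measurable_set1_some x).
exists (~` (X 0%:E @^-1` [set Some x])); split.
- exact: measurableC.
- by have := probability_setC (P (Some x)) mx; rewrite hunt_normal subee.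
- move=> w /= h0 /= Xx; apply: h0 => z; rewrite subrr => Xz.
  by move: Xz; rewrite Xx => -[].
Qed.


Notation C3 := offdiag_const.

Let C3_gt0 : 0 < C3. Proof. exact: offdiag_const_gt0. Qed.

Let inner (y0 : M) := forall z, mdist y0 z <= eps * R0 -> U z.

Let inner_U y0 : inner y0 -> U y0.
Proof. by apply; rewrite mdistxx mulr_ge0// ltW. Qed.

Let small_sub (y0 : M) (del : R) (A : set M) : inner y0 -> del <= eps * R0 ->
  (forall z, A z -> mdist y0 z < del) -> A `<=` U.
Proof. by move=> iy dl Ad z /Ad h; apply: iy; rewrite (ltW (lt_le_trans h dl)). Qed.

Let mF_sub t y (A : set (borel M)) : 0 < t <= Psi R0 -> U y -> measurable A ->
  A `<=` U -> measurable_fun A (fun w : borel M => F t y w).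
Proof.
by move=> tR Uy mA AU; exact: measurable_funS (mF tR Uy).
Qed.

Let KC0 D t : 0 < D -> t <= K * Psi D -> t <= C0 * Psi D.
Proof. by move=> D0 h; apply: (le_trans h); rewrite ler_pM2r ?Psi_gt0. Qed.

Let near_U y0 D z : inner y0 -> 0 < D -> D <= R0 -> mdist y0 z < eps * D / 2 ->
  U z.
Proof.
move=> iy D0 DR h; apply: iy; apply: (le_trans (ltW h)).
rewrite ler_pdivrMr// (le_trans (_ : _ <= eps * R0))// ?ler_pM2l//.
by rewrite ler_peMr ?ler1n// mulr_ge0// ltW.
Qed.

Let mFPhi t x (A : set (borel M)) : 0 < t <= Psi R0 -> U x -> measurable A ->
  A `<=` U -> measurable_fun A (fun w : borel M =>
    F t x w * expR (- Phi Psi (gammaeps * mdist x w) t)).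
Proof.
move=> tR Ux mA AU; apply: measurable_funM; first exact: mF_sub.
apply: measurableT_comp => //; apply: measurableT_comp => //.
have t0 : 0 < t by case/andP: tR.
have mrt : measurable_fun A (fun w : borel M => (gammaeps * mdist x w, t)).
  apply: (measurable_funS measurableT) => //.
  apply: measurable_fun_pair => //.
  by apply: measurable_funM => //; exact: measurable_mdistr.
have := measurable_comp measurable_domain_Phi _ (measurable_Phi cPsi_gt0 beta1_gt1 gPsi) mrt; apply.
move=> _ [w _ <-] /=; split => //.
by rewrite mulr_ge0 ?mdist_ge0 ?(ltW gammaeps_gt0).
Qed.

(** The scale is [R0] and the initial time is [0], so the first term is the killed kernel started at
    [x] itself. All of [A] is within [2 * d0] of [x], where the exponential is at least [expR (- B)]
    by [Phi_near]. *)
Lemma bound_near_diagonal x y0 t d0 (A : set (borel M)) :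
  U x -> ~ N x -> 0 < t < Psi R0 -> 0 < d0 -> Psi d0 = t -> mdist x y0 <= d0 ->
  inner y0 -> measurable A -> (forall z, A z -> mdist y0 z < eps * R0 / 20) ->
  (forall z, A z -> mdist y0 z <= d0) ->
  (P (Some x) (X t%:E @^-1` (Some @` A)) <=
   \int[mu]_(w in A) ((1 + C3) * expR B *
      (F t x w * expR (- Phi Psi (gammaeps * mdist x w) t)))%:E)%E.
Proof.
move=> Ux Nx /andP[t0 tR] d00 Pd0 xy0 iy mA Ay0 Ad0.
have tR' : 0 < t <= Psi R0 by rewrite t0 ltW.
have AU : A `<=` U.
  apply: (small_sub iy _ Ay0); rewrite ler_pdivrMr// ler_peMr ?ler1n//.
  by rewrite mulr_ge0// ltW.
have mFA := mF_sub tR' Ux mA AU.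
have I0 : (0 <= \int[mu]_(w in A) (F t x w)%:E)%E.
  by apply: integral_ge0 => w /AU Uw; rewrite lee_fin ltW ?F_gt0.
apply: (@le_trans _ _ (\int[mu]_(w in A) ((1 + C3) * F t x w)%:E)%E).
  under [leRHS]eq_integral do rewrite EFinM.
  rewrite ge0_integralZl//; last 3 first.
  - exact/measurable_EFinP.
  - by move=> w /AU Uw; rewrite lee_fin ltW ?F_gt0.
  - by rewrite lee_fin addr_ge0// ltW.
  rewrite EFinD ge0_muleDl ?lee_fin ?(ltW C3_gt0)// mul1e.
  apply: le_trans.
    apply: (@offdiag_bound x y0 t t R0 (K * Psi R0)
      (\int[mu]_(w in A) (F t x w)%:E)%E (fun w => F t x w) A [set x]) => //.
  - by apply: KC0 => //; rewrite (le_trans (ltW tR))// ler_peMl// ltW.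
  - by move=> w /AU Uw; rewrite ltW ?F_gt0.
  - by rewrite mulr_ge0// ltW.
  - exact: KCV.
  - move=> s z w /andP[s0 st] y0z /AU Uw; apply: F_le_diam => //.
      by rewrite s0.
    exact: near_U y0z.
  - exact: measurable_set1_borel.
  - by move=> z _ _ ->; apply: killed_le => //; rewrite t0.
  apply: leeD.
    rewrite -[leRHS]mule1; apply: lee_wpmul2l => //; apply: P_le1.
      by rewrite subrr.
    exact: measurable_set1_borel.
  apply: lee_wpmul2r => //; rewrite lee_fin ler_piMr ?(ltW C3_gt0)//.
  by rewrite expR_le1 oppr_le0 Phi0// mulr_ge0 ?(ltW R0_gt0)// !mulr_ge0// ltW.
apply: ge0_le_integral => //.
- by move=> w /AU Uw; rewrite lee_fin mulr_ge0 ?(ltW (F_gt0 _ _ _))// addr_ge0// ltW.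
- by apply/measurable_EFinP; apply: measurable_funM.
- apply/measurable_EFinP; apply: measurable_funM => //; exact: mFPhi.
move=> w Aw; have Uw := AU _ Aw; rewrite lee_fin -mulrA ler_wpM2l ?addr_ge0 ?(ltW C3_gt0)//.
rewrite mulrCA ler_peMr ?(ltW (F_gt0 _ _ _))// -expRD.
apply: le_trans (expR_ge1Dx _); rewrite lerDl subr_ge0.
apply: le_trans (Phi_near d00); rewrite Pd0; apply: Phi_le_mono => //.
  by rewrite mulr_ge0 ?mdist_ge0// ltW.
have : mdist x w <= 2 * d0.
  by have := metric_triangle x y0 w; have := Ad0 _ Aw; move: xy0; lra.
rewrite -(ler_pM2l gammaeps_gt0) /gammaeps; lra.
Qed.


(** With the scale [D] equal to the distance of [x] and [y0], the starting point is outside the ball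
    of radius [eps * D / 2], so [kap0] can be [0]. Points of [A] are within [5 / 4 * D] of [x], and
    [5 / 4] times the final rate is [kappa2]. *)
Lemma bound_off_diagonal x y0 t d0 (A : set (borel M)) :
  U x -> ~ N x -> 0 < t < Psi R0 -> 0 < d0 -> Psi d0 = t -> d0 < mdist x y0 ->
  inner y0 -> measurable A -> (forall z, A z -> mdist y0 z < eps * d0 / 20) ->
  (P (Some x) (X t%:E @^-1` (Some @` A)) <=
   \int[mu]_(w in A) (C3 *
      (F t x w * expR (- Phi Psi (gammaeps * mdist x w) t)))%:E)%E.
Proof.
move=> Ux Nx /andP[t0 tR] d00 Pd0 xy0 iy mA Ay0.
have tR' : 0 < t <= Psi R0 by rewrite t0 ltW.
set D := mdist x y0 in xy0.
have D0 : 0 < D by exact: lt_trans xy0.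
have DR : D <= R0 by apply: diamU => //; exact: inner_U.
have Ay0' z : A z -> mdist y0 z < eps * D / 20.
  by move=> /Ay0 h; apply: (lt_trans h); rewrite ltr_pM2r// ltr_pM2l.
have eDR : eps * D <= eps * R0 by rewrite ler_pM2l.
have eD0 : 0 < eps * D by rewrite mulr_gt0.
have eDD : eps * D < D by rewrite gtr_pMl.
have AU : A `<=` U.
  by apply: (small_sub iy _ Ay0'); lra.
have mFA := mF_sub tR' Ux mA AU.
have F0 w : A w -> 0 <= F t x w by move=> /AU Uw; rewrite ltW ?F_gt0.
have tKD : t <= K * Psi D by rewrite -Pd0; apply: Psi_mono => //; exact: ltW.
apply: le_trans.
  apply: (@offdiag_bound x y0 t t D (CV * Psi D) 0%E (fun w => F t x w) A [set x]) => //.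
  - exact: KC0.
  - by rewrite mulr_ge0// ltW// Psi_gt0.
  - move=> s z w /andP[s0 st] y0z /AU Uw.
    have Uz := near_U iy D0 DR y0z.
    apply: F_le => //.
    + by rewrite s0.
    + exact: le_trans tKD (KCV D0).
    + have xz : mdist x z <= 2 * D.
        by have := metric_triangle x y0 z; rewrite -/D; move: y0z; lra.
      have D20 : 0 < 2 * D by rewrite mulr_gt0.
      apply: le_trans (Psi_mono (mdist_ge0 _ _) xz D20) _.
      apply: (@le_trans _ _ (K * (cPsi * 2 `^ beta2 * Psi D))).
        rewrite ler_pM2l//; have [_ _ h] := gPsi.
        have D2 : D <= 2 * D by rewrite ler_peMl ?(ltW D0)// ler1n.
        have /andP[_] := h D (2 * D) D0 D2.
        by rewrite ler_pdivrMr ?Psi_gt0// mulfK ?gt_eqF.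
      rewrite mulrA ler_pM2r ?Psi_gt0//; apply: le_trans CV_ge.
      by rewrite ler_pM2l// lerDr.
    + by rewrite mdistxx Psi0 mulr_ge0// ltW// Psi_gt0.
  - exact: measurable_set1_borel.
  - move=> z y0z _ zx; exfalso; move: y0z; rewrite zx metric_sym -/D; lra.
rewrite mul0e add0e.
under [leRHS]eq_integral do rewrite EFinM.
rewrite ge0_integralZl//; last 3 first.
- by apply/measurable_EFinP; exact: mFPhi.
- by move=> w Aw; rewrite lee_fin mulr_ge0 ?F0.
- by rewrite lee_fin ltW.
rewrite EFinM -muleA lee_pmul2l ?lte_fin// -ge0_integralZl//; last exact/measurable_EFinP.
apply: ge0_le_integral => //.
- by move=> w Aw; rewrite lee_fin mulr_ge0 ?F0.
- by apply: measurable_funeM; exact/measurable_EFinP.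
- by apply/measurable_EFinP; exact: mFPhi.
move=> w Aw; rewrite -EFinM lee_fin mulrC ler_wpM2l ?F0// ler_expR lerN2.
apply: Phi_le_mono => //; first by rewrite mulr_ge0 ?mdist_ge0 ?(ltW gammaeps_gt0).
rewrite /gammaeps /kappa2.
have : mdist x w <= 5 / 4 * D.
  by have := metric_triangle x y0 w; rewrite -/D; have := Ay0' w Aw; lra.
rewrite -(ler_pM2l gammaeps_gt0) /gammaeps; lra.
Qed.

(* For [x] outside [U] and for large times the bound is stated with [F] at a
   fixed pair [(x1, x1)]; it is compared with the infimum of [F] afterwards. *)
Lemma bound_outside x x1 y0 t (A : set (borel M)) :
  ~ U x -> ~ N x -> U x1 -> 0 < t < Psi R0 ->
  inner y0 -> measurable A -> (forall z, A z -> mdist y0 z < eps * R0 / 20) ->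
  (P (Some x) (X t%:E @^-1` (Some @` A)) <=
   \int[mu]_(w in A) (C3 * expR (- Phi Psi (kappa2 * R0) t) *
      F (Num.min (2 * t) (Psi R0)) x1 x1)%:E)%E.
Proof.
move=> Ux Nx Ux1 /andP[t0 tR] iy mA Ay0.
set T := Num.min _ _.
have TR : 0 < T <= Psi R0 by rewrite lt_min PsiR0_gt0 mulr_gt0//= ge_min lexx orbT.
have tT : t <= T by rewrite le_min (ltW tR) ler_peMl ?(ltW t0)// ler1n.
have FT0 : 0 < F T x1 x1 by exact: F_gt0.
have AU : A `<=` U.
  apply: (small_sub iy _ Ay0); rewrite ler_pdivrMr// ler_peMr ?ler1n//.
  by rewrite mulr_ge0// ltW.
apply: le_trans.
  apply: (@offdiag_bound x y0 t t R0 (K * Psi R0) 0%E (fun=> F T x1 x1) A [set x]) => //.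
  - by apply: KC0 => //; rewrite (le_trans (ltW tR))// ler_peMl// ltW.
  - by move=> w _; exact: ltW.
  - by rewrite mulr_ge0// ltW.
  - exact: KCV.
  - move=> s z w /andP[s0 st] y0z /AU Uw; apply: F_le_diam => //.
      by rewrite s0 (le_trans st).
    exact: near_U y0z.
  - exact: measurable_set1_borel.
  - by move=> z y0z _ zx; exfalso; apply: Ux; rewrite -zx; exact: near_U y0z.
rewrite mul0e add0e -ge0_integralZl//.
- by move=> w _; rewrite lee_fin ltW.
- by rewrite lee_fin mulr_ge0 ?expR_ge0// ltW.
Qed.

Lemma bound_large_time x x1 y0 t (A : set (borel M)) :
  ~ N x -> U x1 -> Psi R0 <= t ->
  inner y0 -> measurable A -> (forall z, A z -> mdist y0 z < eps * R0 / 20) ->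
  (P (Some x) (X t%:E @^-1` (Some @` A)) <=
   \int[mu]_(w in A) ((cF * (2 * K) `^ alphaF + C3) * F (Psi R0) x1 x1)%:E)%E.
Proof.
move=> Nx Ux1 tR iy mA Ay0.
have FT0 : 0 < F (Psi R0) x1 x1 by rewrite F_gt0// PsiR0_gt0 lexx.
have AU : A `<=` U.
  apply: (small_sub iy _ Ay0); rewrite ler_pdivrMr// ler_peMr ?ler1n//.
  by rewrite mulr_ge0// ltW.
set s0 := Psi R0 / 2.
have s00 : 0 < s0 by rewrite divr_gt0.
have s0R : s0 < Psi R0 by rewrite /s0; move: PsiR0_gt0; lra.
have RR : 0 < Psi R0 <= Psi R0 by rewrite PsiR0_gt0 lexx.
have K2 : K * Psi R0 / s0 = 2 * K by rewrite /s0; field; rewrite gt_eqF.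
have cK0 : 0 <= cF * (2 * K) `^ alphaF by rewrite mulr_ge0 ?powR_ge0// ltW.
have int0 : (0 <= \int[mu]_(w in A) (F (Psi R0) x1 x1)%:E)%E.
  by apply: integral_ge0 => w _; rewrite lee_fin ltW.
apply: le_trans.
  apply: (@offdiag_bound x y0 t s0 R0 (K * Psi R0)
    ((cF * (2 * K) `^ alphaF)%:E * \int[mu]_(w in A) (F (Psi R0) x1 x1)%:E)%E
    (fun=> F (Psi R0) x1 x1) A setT) => //.
  - by rewrite (le_trans (ltW s0R)).
  - by apply: KC0 => //; rewrite (le_trans (ltW s0R))// ler_peMl// ltW.
  - by move=> w _; exact: ltW.
  - by rewrite mulr_ge0// ltW.
  - exact: KCV.
  - move=> s z w /andP[s0' st] y0z /AU Uw; apply: F_le_diam => //.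
      by rewrite s0' (le_trans st)// ltW.
    exact: near_U y0z.
  - exact: aeW.
  - by rewrite mule_ge0.
  - move=> z y0z Nz _; have Uz : U z by exact: near_U y0z.
    have s0R' : 0 < s0 <= Psi R0 by rewrite s00 ltW.
    apply: (@le_trans _ _ (\int[mu]_(y in A) (F s0 z y)%:E)%E).
      by apply: killed_le => //; rewrite s00.
    rewrite -ge0_integralZl//.
    apply: ge0_le_integral => //.
    + by move=> w /AU Uw; rewrite lee_fin ltW ?F_gt0.
    + by apply/measurable_EFinP; exact: mF_sub.
    + by move=> w /AU Uw; rewrite -EFinM lee_fin -K2; apply: F_le_diam; rewrite // s00 ltW.
    by move=> w _; rewrite lee_fin ltW.
under [leRHS]eq_integral do rewrite EFinM EFinD.
rewrite ge0_integralZl//; last first.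
  by rewrite -EFinD lee_fin addr_ge0// ltW.
  by move=> w _; rewrite lee_fin ltW.
rewrite ge0_muleDl ?lee_fin ?(ltW C3_gt0)//; apply: leeD.
  rewrite -[leRHS]mule1; apply: lee_wpmul2l => //; first by rewrite mule_ge0.
  by apply: P_le1 => //; rewrite subr_ge0 (le_trans (ltW s0R)).
apply: lee_wpmul2r => //; rewrite lee_fin ler_piMr ?(ltW C3_gt0)//.
by rewrite expR_le1 oppr_le0 Phi0// !mulr_ge0// ltW.
Qed.

(** * The measurable majorant *)

Hypothesis B_ge0 : 0 <= B.

Notation V := (inner_set U (eps * R0)).
Let C5 := (1 + C3) * expR B.
Let C6 := cF * (2 * K) `^ alphaF + C3.

Let C5_gt0 : 0 < C5. Proof. by rewrite mulr_gt0 ?expR_gt0// addr_gt0. Qed.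

Let C6_gt0 : 0 < C6. Proof. by rewrite ltr_wpDl// mulr_ge0 ?powR_ge0// ltW. Qed.

Let C3_le : C3 <= C5.
Proof.
apply: (@le_trans _ _ (1 + C3)); first by rewrite lerDr.
rewrite ler_peMr//; first by rewrite addr_ge0// ltW.
by apply: le_trans (expR_ge1Dx _); rewrite lerDl.
Qed.

Let inner_V y0 : V y0 -> inner y0.
Proof. by move=> Vy z; exact: inner_setP. Qed.

Let V_U : V `<=` U. Proof. by move=> y /inner_V/inner_U. Qed.

(** An infimum over uncountably many pairs gives no direct measurability in [t]; evaluating [F] at
    the fixed pair [(x1, x1)] does. *)
Definition majorant (x1 : M) (t : R) (x w : M) : R :=
  if t < Psi R0 then
    if `[< U x >] then
      C5 * (F t x w * expR (- Phi Psi (gammaeps * mdist x w) t))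
    else C3 * expR (- Phi Psi (kappa2 * R0) t) *
      F (Num.min (2 * t) (Psi R0)) x1 x1
  else C6 * F (Psi R0) x1 x1.

Let min_range t : 0 < t -> 0 < Num.min (2 * t) (Psi R0) <= Psi R0.
Proof. by move=> t0; rewrite lt_min PsiR0_gt0 mulr_gt0//= ge_min lexx orbT. Qed.

Let range_R0 : 0 < Psi R0 <= Psi R0. Proof. by rewrite PsiR0_gt0 lexx. Qed.

Lemma majorant_ge0 x1 t x w : U x1 -> 0 < t -> U w -> 0 <= majorant x1 t x w.
Proof.
move=> Ux1 t0 Uw; rewrite /majorant; case: ifPn => tR.
  case: asboolP => Ux.
    have := F_gt0 (t := t) (x := x) (y := w); rewrite t0 (ltW tR) => /(_ isT Ux Uw) F0.
    by rewrite mulr_ge0 ?(ltW C5_gt0)// mulr_ge0 ?expR_ge0// ltW.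
  apply: mulr_ge0; first by rewrite mulr_ge0 ?expR_ge0 ?(ltW C3_gt0).
  by apply/ltW/F_gt0 => //; exact: min_range.
by rewrite mulr_ge0 ?(ltW C6_gt0)//; apply/ltW/F_gt0.
Qed.

(** The radius [del] may depend on [t], through [d0], but not on [y0]: this suffices to pass to
    arbitrary sets for fixed [(t, x)]. The minimum with [R0] lets the near and the far estimates
    apply to the same small sets. *)
Lemma majorant_local x1 t x : U x1 -> 0 < t -> ~ N x -> exists2 del, 0 < del &
  forall y0 (A : set (borel M)), V y0 -> measurable A -> A `<=` V ->
    (forall z, A z -> mdist y0 z < del) ->
    (transition H t x A <= \int[mu]_(w in A) (majorant x1 t x w)%:E)%E.
Proof.
move=> Ux1 t0 Nx; rewrite /majorant; case: ltP => tR; last first.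
  exists (eps * R0 / 20); first by rewrite !mulr_gt0.
  move=> y0 A Vy0 mA AV Ad; exact: bound_large_time (inner_V Vy0) mA Ad.
have tR' : 0 < t < Psi R0 by rewrite t0.
case: asboolP => Ux; last first.
  exists (eps * R0 / 20); first by rewrite !mulr_gt0.
  move=> y0 A Vy0 mA AV Ad; exact: bound_outside (inner_V Vy0) mA Ad.
have [_ /(_ t t0)[d0 d00 Pd0] _] := gPsi.
have e0 D : 0 < D -> eps * D / 20 <= D.
  move=> D0; have : eps * D < D by rewrite gtr_pMl.
  lra.
have eL D : Num.min d0 R0 <= D -> eps * Num.min d0 R0 / 20 <= eps * D / 20.
  by move=> h; rewrite ler_pM2r// ler_pM2l.
exists (eps * Num.min d0 R0 / 20).
  by rewrite !mulr_gt0// lt_min d00.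
move=> y0 A Vy0 mA AV Ad; have iy := inner_V Vy0.
have Ad0 z : A z -> mdist y0 z < eps * d0 / 20.
  by move=> /Ad h; apply: (lt_le_trans h); rewrite eL// ge_min lexx.
have AdR z : A z -> mdist y0 z < eps * R0 / 20.
  by move=> /Ad h; apply: (lt_le_trans h); rewrite eL// ge_min lexx orbT.
have [xy0|xy0] := leP (mdist x y0) d0.
  apply: bound_near_diagonal xy0 iy mA AdR _ => // z /Ad0 h.
  exact: le_trans (ltW h) (e0 _ d00).
apply: (le_trans (bound_off_diagonal Ux Nx tR' d00 Pd0 xy0 iy mA Ad0)).
have tR'' : 0 < t <= Psi R0 by rewrite t0 ltW.
have AU : A `<=` U by move=> z /AV/V_U.
have mm := mFPhi tR'' Ux mA AU.
have FP0 w : A w -> 0 <= F t x w * expR (- Phi Psi (gammaeps * mdist x w) t).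
  by move=> /AU Uw; rewrite mulr_ge0 ?expR_ge0// ltW// F_gt0.
apply: ge0_le_integral => //.
- by move=> w Aw; rewrite lee_fin mulr_ge0 ?FP0// ltW.
- by apply/measurable_EFinP; exact: measurable_funM.
- by apply/measurable_EFinP; exact: measurable_funM.
- by move=> w Aw; rewrite lee_fin ler_wpM2r// FP0.
Qed.

(* The gap between the rates [kappa2] and [gammaeps] absorbs the factor
   [(Psi R0 / t) `^ alphaF] lost in replacing [F] at [(x1, x1)] by [F] at an
   arbitrary pair. *)
Lemma majorant_le_outside x1 t x w x' y' : U x1 -> 0 < t < Psi R0 -> ~ U x ->
  U x' -> U y' ->
  majorant x1 t x w <= C3 * cF * K `^ alphaF * C4 *
    F (Num.min (2 * t) (Psi R0)) x' y' * expR (- Phi Psi (gammaeps * R0) t).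
Proof.
move=> Ux1 /andP[t0 tR] Ux Ux' Uy'; rewrite /majorant tR; case: asboolP => // _.
set T := Num.min _ _; have /andP[T0 TR] := min_range t0.
have tT : t <= T by rewrite le_min (ltW tR) ler_peMl ?(ltW t0)// ler1n.
have F1 : F T x1 x1 <= cF * (K * Psi R0 / T) `^ alphaF * F T x' y'.
  by apply: F_le_diam => //; rewrite T0 ?TR ?lexx.
have F' : 0 < F T x' y' by rewrite F_gt0// T0.
have hT : (K * Psi R0 / T) `^ alphaF <= K `^ alphaF * (Psi R0 / t) `^ alphaF.
  rewrite -powRM ?(ltW K_gt0) ?divr_ge0 ?(ltW PsiR0_gt0) ?(ltW t0)//.
  rewrite ge0_ler_powR ?nnegrE ?(ltW alphaF_gt0)//.
  - by rewrite divr_ge0 ?(ltW T0)// mulr_ge0 ?(ltW K_gt0)// ltW.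
  - by rewrite mulr_ge0 ?(ltW K_gt0)// divr_ge0// ltW.
  - by rewrite -mulrA ler_pM2l// ler_pM2l// lef_pV2 ?posrE.
have tC : t <= C0 * Psi R0.
  by apply: KC0 => //; rewrite (le_trans (ltW tR))// ler_peMl// ltW.
have h := Phi_final R0_gt0 t0 tC; rewrite -/gammaeps in h.
set E1 := expR _ in h *; set E2 := expR _ in h *.
have E10 : 0 <= E1 by exact: expR_ge0.
set q := (Psi R0 / t) `^ alphaF in h hT.
apply: (@le_trans _ _ (C3 * E1 * (cF * (K `^ alphaF * q) * F T x' y'))).
  apply: ler_wpM2l; first by rewrite mulr_ge0 ?(ltW C3_gt0).
  apply: (le_trans F1).
  by rewrite ler_pM2r// ler_pM2l.
rewrite [leLHS](_ : _ = C3 * cF * K `^ alphaF * F T x' y' * (q * E1)); last by ring.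
rewrite [leRHS](_ : _ = C3 * cF * K `^ alphaF * F T x' y' * (C4 * E2)); last by ring.
by rewrite ler_wpM2l// !mulr_ge0 ?powR_ge0 ?(ltW F') ?(ltW C3_gt0)// ltW.
Qed.

Lemma majorant_le_large_time x1 t x w x' y' : U x1 -> Psi R0 <= t ->
  U x' -> U y' ->
  majorant x1 t x w <= C6 * cF * K `^ alphaF * F (Psi R0) x' y'.
Proof.
move=> Ux1 tR Ux' Uy'; rewrite /majorant ltNge tR/=.
rewrite -!mulrA ler_pM2l// mulrA -[X in X `^ _](mulfK (lt0r_neq0 PsiR0_gt0)).
exact: F_le_diam.
Qed.

Let measurable_V : measurable (V : set (borel M)).
Proof. by apply: open_borel; exact: open_inner_set. Qed.

Let D := [set z : R * borel M * borel M | [/\ 0 < z.1.1, ~ N z.1.2 & V z.2]].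

Let measurable_D : measurable D.
Proof.
rewrite (_ : D = ((`]0, +oo[ `*` ~` N) `*` V)%classic).
  apply: measurableX => //; apply: measurableX; first exact: measurable_itv.
  exact: measurableC.
apply/seteqP; split => -[[t x] y]/=; rewrite in_itv/= andbT; first by case.
by move=> [[? ?] ?].
Qed.

Lemma measurable_majorant x1 : separable_space M -> U x1 ->
  measurable_fun D (fun z => majorant x1 z.1.1 z.1.2 z.2).
Proof.
move=> sepM Ux1.
pose W := (R * borel M * borel M)%type.
have mt : measurable_fun setT (fun z : W => z.1.1) by exact: measurableT_comp.
have mx : measurable_fun setT (fun z : W => z.1.2) by exact: measurableT_comp.
have mUx S : measurable_fun S (fun z : W => `[< U z.1.2 >]).
  apply: measurable_funTS; apply: (measurable_fun_bool true).
  have := mx measurableT _ mU; rewrite setTI; congr (measurable _).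
  by rewrite setTI; apply/seteqP; split => z /= /asboolP.
have mPhi S (f : W -> R) : measurable S -> measurable_fun setT f ->
    (forall z, S z -> 0 <= f z /\ 0 < z.1.1) ->
    measurable_fun S (fun z => expR (- Phi Psi (f z) z.1.1)).
  move=> mS mf f0; apply: measurableT_comp => //; apply: measurableT_comp => //.
  have mp := measurable_funTS (measurable_fun_pair mf mt) (D := S).
  have := measurable_comp measurable_domain_Phi _ (measurable_Phi cPsi_gt0 beta1_gt1 gPsi) mp; apply.
  by move=> _ [z Sz <-]; exact: f0.
have mlt S : measurable_fun S (fun z : W => z.1.1 < Psi R0).
  by apply: measurable_fun_ltr => //; exact: measurable_funTS.
have mDt b : measurable (D `&` (fun z : W => z.1.1 < Psi R0) @^-1` [set b]).
  exact: (mlt D).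
have mDU b : measurable (D `&` (fun z : W => z.1.1 < Psi R0) @^-1` [set true]
    `&` (fun z : W => `[< U z.1.2 >]) @^-1` [set b]).
  exact: (mUx (D `&` _)).
apply: measurable_fun_if => //; apply: measurable_fun_if => //.
- apply: measurable_funM => //; apply: measurable_funM.
    apply: measurable_funS mFjoint => //.
    move=> z [[[t0 _ Vz] /= tR] Ux]; split => /=; last exact: V_U.
      by rewrite t0 ltW.
    exact/asboolP.
  apply: mPhi => //.
    apply: measurable_funM => //.
    have mp : measurable_fun setT (fun z : W => (z.1.2, z.2)).
      exact: measurable_fun_pair.
    exact: (measurableT_comp (measurable_mdist sepM) mp).
  by move=> z [[[t0 _ _] _] _]; rewrite mulr_ge0 ?mdist_ge0 ?(ltW gammaeps_gt0).
apply: measurable_funM.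
  apply: measurable_funM => //; apply: mPhi => //.
  by move=> z [[[t0 _ _] _] _]; rewrite !mulr_ge0 ?(ltW R0_gt0)// ltW.
have mp : measurable_fun setT
    (fun z : W => ((Num.min (2 * z.1.1) (Psi R0), x1 : borel M), x1 : borel M)).
  apply: measurable_fun_pair => //; apply: measurable_fun_pair => //.
  by apply: measurable_minr => //; exact: measurable_funM.
apply: (measurable_comp measurable_domain_F _ mFjoint (measurable_funTS mp)).
by move=> _ [z [[[t0 _ _] _] _] <-]; split => //=; exact: min_range.
Qed.

Definition heat_kernel_const : R :=
  C5 + C3 * cF * K `^ alphaF * C4 + C6 * cF * K `^ alphaF.

Let K_powR_gt0 : 0 < K `^ alphaF. Proof. exact: powR_gt0. Qed.

Let Cb_gt0 : 0 < C3 * cF * K `^ alphaF * C4.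
Proof. by do 3 rewrite mulr_gt0//. Qed.

Let Cc_gt0 : 0 < C6 * cF * K `^ alphaF.
Proof. by do 2 rewrite mulr_gt0//. Qed.

Lemma heat_kernel_const_gt0 : 0 < heat_kernel_const.
Proof. by rewrite /heat_kernel_const !addr_gt0. Qed.

Let infF s := inf [set F s x y | x in U & y in U].

Let le_infF s v a : U !=set0 -> 0 < s <= Psi R0 -> 0 < a -> a <= heat_kernel_const ->
  (forall x y, U x -> U y -> v <= a * F s x y) -> v <= heat_kernel_const * infF s.
Proof.
move=> [x1 Ux1] sR a0 aC Fv.
have lbF : v / a <= infF s.
  apply: lb_le_inf; first by exists (F s x1 x1), x1 => //; exists x1.
  by move=> _ [x Ux [y Uy <-]]; rewrite ler_pdivrMr// mulrC Fv.
have inf0 : 0 <= infF s.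
  apply: lb_le_inf; first by exists (F s x1 x1), x1 => //; exists x1.
  by move=> _ [x Ux [y Uy <-]]; rewrite ltW// F_gt0.
by rewrite (le_trans (_ : _ <= a * infF s))// ?ler_wpM2r// mulrC -ler_pdivrMr.
Qed.

Lemma heat_kernel_exists : separable_space M -> U !=set0 ->
  exists p : R -> M -> M -> R,
  [/\ measurable_fun D (fun z => p z.1.1 z.1.2 z.2),
      (forall t x y, 0 < t -> ~ N x -> V y -> 0 <= p t x y),
      (forall t x (A : set (borel M)), 0 < t -> ~ N x ->
         measurable A -> A `<=` V ->
         (transition H t x A = \int[mu]_(y in A) (p t x y)%:E)%E)
    & forall t x y, 0 < t -> ~ N x -> V y ->
      [/\ t < Psi R0 -> U x ->
            p t x y <= heat_kernel_const * F t x y *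
                       expR (- Phi Psi (gammaeps * mdist x y) t),
          t < Psi R0 -> ~ U x ->
            p t x y <= heat_kernel_const * infF (Num.min (2 * t) (Psi R0)) *
                       expR (- Phi Psi (gammaeps * R0) t)
        & Psi R0 <= t -> p t x y <= heat_kernel_const * infF (Psi R0)]].
Proof.
move=> sepM Une; have [x1 Ux1] := Une.
have mh := measurable_majorant sepM Ux1.
have h0 t x w : 0 < t -> ~ N x -> V w -> 0 <= majorant x1 t x w.
  by move=> t0 _ /V_U; exact: majorant_ge0.
have msec t x : 0 < t -> ~ N x ->
    measurable_fun (V : set (borel M)) (fun w : borel M => majorant x1 t x w).
  move=> t0 Nx; have mp : measurable_fun (V : set (borel M))
      (fun w : borel M => ((t, x : borel M), w)).
    exact: measurable_funTS (measurable_pair1 _).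
  by apply: (measurable_comp measurable_D _ mh mp) => _ [w Vw <-].
have le_h t x (A : set (borel M)) : 0 < t -> ~ N x -> measurable A -> A `<=` V ->
    (transition H t x A <= \int[mu]_(w in A) (majorant x1 t x w)%:E)%E.
  move=> t0 Nx mA AV; have [del del0 loc] := majorant_local Ux1 t0 Nx.
  apply: (transition_le_of_local measurable_V sepM del0 (ltW t0)) => //.
  - by apply/measurable_EFinP; exact: msec.
  - by move=> w Vw; rewrite lee_fin h0.
have [p [mp p0 pE p_le]] :=
  transition_density measurable_V sepM measurable_D mh h0 le_h.
exists p; split => // t x y t0 Nx Vy; have Uy := V_U Vy.
have ple := p_le t x y t0 Nx Vy; split => tR.
- move=> Ux; apply: (le_trans ple); rewrite /majorant tR; case: asboolP => // _.
  have F0 : 0 < F t x y by rewrite F_gt0// t0 ltW.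
  rewrite mulrA ler_wpM2r ?expR_ge0// ler_pM2r//.
  by rewrite /heat_kernel_const -addrA lerDl addr_ge0// ltW.
- move=> Ux; set E := expR _; have E0 : 0 < E by exact: expR_gt0.
  rewrite -ler_pdivrMr//; apply: (le_infF Une (min_range t0) Cb_gt0).
    by rewrite /heat_kernel_const -addrA addrCA lerDl addr_ge0// ltW.
  move=> x' y' Ux' Uy'; rewrite ler_pdivrMr//; apply: (le_trans ple).
  by apply: majorant_le_outside => //; rewrite t0.
- apply: (le_infF Une range_R0 Cc_gt0).
    by rewrite /heat_kernel_const lerDr addr_ge0// ltW.
  move=> x' y' Ux' Uy'; apply: (le_trans ple).
  exact: majorant_le_large_time.
Qed.

End heat_kernel_bound.

(** * Assembling the hypotheses and the constants *)

Lemma gauge_of_homeomorphism {R : realType} (cPsi beta1 beta2 : R) (Psi : R -> R) :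
  0 < cPsi -> homeomorphism_on [set r : R | 0 <= r] [set r : R | 0 <= r] Psi ->
  (forall rho rho', 0 < rho -> rho <= rho' ->
     cPsi^-1 * (rho' / rho) `^ beta1 <= Psi rho' / Psi rho
       <= cPsi * (rho' / rho) `^ beta2) ->
  gauge cPsi beta1 beta2 Psi /\ Psi 0 = 0.
Proof.
move=> cPsi0 [g [[PsiA gB _ gK] _]] PsiB.
have P0 r : 0 < r -> 0 < Psi r.
  move=> r0; rewrite lt_neqAle (PsiA _ (ltW r0)) andbT; apply/eqP => Pr0.
  (* Division by zero yields [0], so if [Psi r] vanished the scaling bound at equal radii would say
     that [cPsi^-1] is at most [0]. *)
  have /andP[+ _] := PsiB r r r0 (lexx r).
  rewrite -Pr0 invr0 mulr0 divff ?gt_eqF// powR1 mulr1 leNgt.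
  by rewrite invr_gt0 cPsi0.
have Psi_g t : 0 <= t -> Psi (g t) = t by move=> t0; apply: gK; rewrite inE.
have Psi0 : Psi 0 = 0.
  have := Psi_g 0 (lexx 0); have := gB 0 (lexx 0).
  rewrite /= le_eqVlt => /orP[/eqP <-//|/P0 + Pg].
  by rewrite Pg ltxx.
split => //; split => // t t0; exists (g t); last exact/Psi_g/ltW.
have := gB t (ltW t0); rewrite /= le_eqVlt => /orP[/eqP g0|//].
by have := t0; rewrite -(Psi_g t (ltW t0)) -g0 Psi0 ltxx.
Qed.

Lemma mdist_le_diam {R : realType} {M : metricType R} (U : set M) (r : R) x y :
  (diam U <= r%:E)%E -> U x -> U y -> mdist x y <= r.
Proof.
rewrite /diam ge_max => /andP[_ h] Ux Uy; rewrite -lee_fin; apply: le_trans h.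
by apply: ereal_sup_ubound; exists x => //; exists y.
Qed.

Theorem theorem6p2 (R : realType) (cPsi beta1 beta2 cF alphaF c gamma eps : R)
    (hcPsi : 0 < cPsi) (hbeta1 : 1 < beta1) (hbeta12 : beta1 <= beta2)
    (hcF : 0 < cF) (halphaF : 0 < alphaF) (hc : 0 < c) (hgamma : 0 < gamma)
    (heps0 : 0 < eps) (heps1 : eps < 1) :
  exists2 ceps : R, 0 < ceps &
  forall (M : pmetricType R) (mu : {sigma_finite_measure set (borel M) -> \bar R})
    (d : measure_display) (Omega : measurableType d) (H : hunt_process M Omega)
    (N : set (borel M)) (Psi : R -> R) (R0 : R) (U : set M)
    (F : R -> M -> M -> R),
  locally_compact [set: M] -> separable_space M ->
  measurable N ->
  (forall x, ~ N x -> {ae hunt_P H (Some x), forall w, avoids H N w}) ->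
  (forall x, ~ N x -> {ae hunt_P H (Some x), forall w, continuous_path H w}) ->
  homeomorphism_on [set r : R | 0 <= r] [set r : R | 0 <= r] Psi ->
  (forall rho rho', 0 < rho -> rho <= rho' ->
     cPsi^-1 * (rho' / rho) `^ beta1 <= Psi rho' / Psi rho
       <= cPsi * (rho' / rho) `^ beta2) ->
  0 < R0 ->
  U !=set0 -> open U -> (diam U <= R0%:E)%E ->
  measurable_fun
    [set z : R * borel M * borel M | [/\ 0 < z.1.1 <= Psi R0, U z.1.2 & U z.2]]
    (fun z => F z.1.1 z.1.2 z.2) ->
  (forall t x y, 0 < t <= Psi R0 -> U x -> U y -> 0 < F t x y) ->
  (forall t x y s z w, 0 < t <= Psi R0 -> U x -> U y ->
     0 < s <= Psi R0 -> U z -> U w -> s <= t ->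
     F s z w / F t x y <=
     cF * (Num.max (Num.max t (Psi (mdist x z))) (Psi (mdist y w)) / s)
            `^ alphaF) ->
  (forall t x (A : set (borel M)), 0 < t < Psi R0 -> U x -> ~ N x ->
     measurable A -> A `<=` U ->
     (killed_transition H U t x A <= \int[mu]_(y in A) (F t x y)%:E)%E) ->
  (forall x r t, U x -> ~ N x -> 0 < r < R0 -> ball x r `<=` U -> 0 < t ->
     (completed_prob H x [set w | exit_time (hunt_X H) (ball x r) w <= t%:E]
        <= (c * expR (- Phi Psi (gamma * r) t))%:E)%E) ->
  let U' := inner_set U (eps * R0) in
  let gammaeps := 5^-1 * eps * gamma in
  let infF s := inf [set F s x y | x in U & y in U] in
  exists p : R -> M -> M -> R,
  [/\ measurable_fun
        [set z : R * borel M * borel M | [/\ 0 < z.1.1, ~ N z.1.2 & U' z.2]]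
        (fun z => p z.1.1 z.1.2 z.2),
      (forall t x y, 0 < t -> ~ N x -> U' y -> 0 <= p t x y),
      (forall t x (A : set (borel M)), 0 < t -> ~ N x ->
         measurable A -> A `<=` U' ->
         (transition H t x A = \int[mu]_(y in A) (p t x y)%:E)%E)
    & forall t x y, 0 < t -> ~ N x -> U' y ->
      [/\ t < Psi R0 -> U x ->
            p t x y <=
            ceps * F t x y * expR (- Phi Psi (gammaeps * mdist x y) t),
          t < Psi R0 -> ~ U x ->
            p t x y <= ceps * infF (Num.min (2 * t) (Psi R0)) *
                       expR (- Phi Psi (gammaeps * R0) t)
        & Psi R0 <= t -> p t x y <= ceps * infF (Psi R0)]].
Proof.
(* [C0] and [CV] are taken equal to their lower bounds: [C0] is the quasi-monotonicity factor that
   turns [t = Psi d0] with [d0 <= D] into [t <= C0 * Psi D]. *)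
have K_gt0 : 0 < Num.max 1 cPsi by rewrite lt_max ltr01.
have CV_gt0 : 0 < Num.max 1 cPsi * (1 + cPsi * 2 `^ beta2).
  by rewrite mulr_gt0// addr_gt0// mulr_gt0// powR_gt0.
have ge_gt0 : 0 < gamma * eps by rewrite mulr_gt0.
have kappa1_gt0 : 0 < 3 / 10 * (gamma * eps) by rewrite mulr_gt0.
have kappa2_gt0 : 0 < 4^-1 * (gamma * eps) by rewrite mulr_gt0.
have gammaeps_gt0 : 0 < 5^-1 * eps * gamma by rewrite !mulr_gt0.
have kappa12 : 4^-1 * (gamma * eps) < 3 / 10 * (gamma * eps) by lra.
have kappa23 : 5^-1 * eps * gamma < 4^-1 * (gamma * eps) by lra.
have [C1 C1_gt0 Phi_sum] := Phi_geometric_sum beta2 hcPsi hbeta1 kappa1_gt0 K_gt0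
  (powR_ge0 (gauge_ratio cPsi beta2)^-1 alphaF).
have [C2 C2_gt0 Phi_power] :=
  Phi_absorb hcPsi hbeta1 hbeta12 kappa2_gt0 kappa12 K_gt0 halphaF.
have [C4 C4_gt0 Phi_final] :=
  Phi_absorb hcPsi hbeta1 hbeta12 gammaeps_gt0 kappa23 K_gt0 halphaF.
(* The factor 2 in the rate comes from [mdist x w <= 2 * d0] near the diagonal. *)
have [B B_ge0 Phi_near] := Phi_upper beta2 hcPsi hbeta1
  (ltW (mulr_gt0 (ltr0n _ 2) gammaeps_gt0)).
exists (heat_kernel_const cPsi beta2 cF alphaF c C1 C2
  (Num.max 1 cPsi * (1 + cPsi * 2 `^ beta2)) C4 B).
  exact: heat_kernel_const_gt0.
move=> M mu d Omega H N Psi R0 U F _ sepM mN avoidN contN homPsi scalePsi R0_gt0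
  Une oU diamU mF F_gt0 F_scale killed_le exit_le U' gammaeps infF.
have [gPsi Psi0] := gauge_of_homeomorphism hcPsi homPsi scalePsi.
exact: (heat_kernel_exists hcPsi hbeta1 hbeta12 hcF halphaF hc hgamma heps0 heps1
  R0_gt0 mN oU avoidN contN gPsi F_gt0 mF killed_le exit_le C1_gt0 C2_gt0 CV_gt0
  (Phi_sum _ gPsi) (Phi_power _ gPsi) F_scale
  (fun x y => mdist_le_diam diamU) Psi0 C4_gt0 (lexx _) (lexx _)
  (Phi_final _ gPsi) (Phi_near _ gPsi) B_ge0 sepM Une).
Qed.
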